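(* Let $d \in \mathbb{N}$, $L \in (0,\infty)$, $p \in [1, \infty)$ and $\beta \in (2, \infty)$. Then, for all sequences $\{b_n : n \in \mathbb{N}\}$ in $(0,1)$, the family $\{f_{n,b_n}: n \in \mathbb{N}\}$ of Dirichlet kernel density estimators satisfies, for the $L^p$ loss, $$\liminf_{n\to \infty} \frac {R_n(f_{n,b_n}, d, \beta, L)} {r_n(d, \beta, L)} = \infty .$$
   Context: $\mathbb{N} = \{1,2,\ldots\}$, $\mathbb{N}_0 = \{0,1,2,\ldots\}$, $\|\boldsymbol{s}\|_1 = |s_1| + \cdots + |s_d|$, and $\mathcal{S}_d = \{\boldsymbol{s} \in [0,1]^d : \|\boldsymbol{s}\|_1 \leq 1\}$ is the $d$-dimensional simplex, with interior $\mathrm{Int}(\mathcal{S}_d)$. Let $\boldsymbol{1} = (1,\ldots,1) \in \mathbb{R}^d$. Dirichlet density: for $\boldsymbol{u} = (u_1,\ldots,u_d) \in (0,\infty)^d$, $v \in (0,\infty)$ and $\boldsymbol{s} \in \mathcal{S}_d$, $$K_{\boldsymbol{u},v}(\boldsymbol{s}) = \frac{\Gamma(v + u_1 + \cdots + u_d)}{\Gamma (v) \Gamma (u_1) \cdots \Gamma (u_d)} \, (1 - \|\boldsymbol{s}\|_1)^{v - 1} \prod_{i=1}^d s_i^{u_i - 1}.$$ Dirichlet kernel density estimator: given a random sample (i.i.d.) $\boldsymbol{X}_1, \ldots, \boldsymbol{X}_n$ from an unknown density $f$ on $\mathcal{S}_d$ and a bandwidth $b \in (0,\infty)$, for all $\boldsymbol{s}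 \in \mathcal{S}_d$, $$f_{n,b}(\boldsymbol{s}) = \frac{1}{n} \sum_{i=1}^n K_{\boldsymbol{s}/b + \boldsymbol{1}, (1 - \|\boldsymbol{s}\|_1)/b + 1}(\boldsymbol{X}_i).$$ Hölder space: for $\beta, L \in (0,\infty)$, let $m = \sup\{\ell \in \mathbb{N}_0 : \ell < \beta\}$ and let $\Sigma(d,\beta,L)$ be the set of functions $f : \mathcal{S}_d \to \mathbb{R}$ (having the partial derivatives involved on $\mathrm{Int}(\mathcal{S}_d)$) such that for every $\boldsymbol{\gamma} \in \mathbb{N}_0^d$ with $\|\boldsymbol{\gamma}\|_1 = m$ and all $\boldsymbol{s},\boldsymbol{t} \in \mathrm{Int}(\mathcal{S}_d)$, $$|D^{\boldsymbol{\gamma}} f(\boldsymbol{s}) - D^{\boldsymbol{\gamma}} f(\boldsymbol{t})| \leq L\, \|\boldsymbol{s} - \boldsymbol{t}\|_1^{\beta - m},$$ where $D^{\boldsymbol{\gamma}}$ is the partial derivative of multi-index $\boldsymbol{\gamma}$, with $D^{\boldsymbol{0}} f = f$. Risk: for fixed $p \in [1,\infty)$ and an estimator $f_n$ of $f$ (a measurable function of $\boldsymbol{X}_1,\ldots,\boldsymbol{X}_n$), $R_n(f_n, f) = \{\mathsf{E}(\|f_n - f\|_p^p)\}^{1/p}$, where $\|\cdot\|_p$ is the $L^p$ norm on $\mathcal{S}_d$ with respect to Lebesgue measure and the expectation is with respect to the joint law of $\boldsymbol{X}_1,\ldots,\boldsymbol{X}_n$, i.i.d. with density $f$. The risk over the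 class is $R_n(f_n,d,\beta,L) = \sup_f R_n(f_n,f)$, the supremum being over all probability densities $f$ on $\mathcal{S}_d$ belonging to $\Sigma(d,\beta,L)$, and $r_n(d,\beta,L) = \inf_{f_n} R_n(f_n,d,\beta,L)$, the infimum being over all estimators $f_n$ of $f$ based on $\boldsymbol{X}_1,\ldots,\boldsymbol{X}_n$. Both quantities depend on the chosen $p$. *)

(* Defs.v *)
From HB Require Import structures.
From mathcomp Require Import all_boot all_order all_algebra.
From mathcomp Require Import all_classical all_reals all_analysis.

Set Implicit Arguments.
Unset Strict Implicit.
Unset Printing Implicit Defensive.

Import Order.TTheory GRing.Theory Num.Theory.
Import numFieldNormedType.Exports.

Local Open Scope classical_set_scope.
Local Open Scope ring_scope.

(* The sigma-algebra generated by the coordinates, which is the Borel one; the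
   library has it for tuples only, while it has the topology, norm and
   derivatives for row vectors only. *)
Definition rV_display : measure_display. Proof. exact. Qed.

Section rV_measurable.
Context (R : realType) (d : nat).

Let coord (i : 'I_d) (x : 'rV[R]_d) : R := x ord0 i.

Let rV_set0 : g_sigma_preimage coord set0.
Proof. exact: sigma_algebra0. Qed.

Let rV_setC A : g_sigma_preimage coord A -> g_sigma_preimage coord (~` A).
Proof. exact: sigma_algebraC. Qed.

Let rV_bigcup (F : (set 'rV[R]_d)^nat) :
  (forall i, g_sigma_preimage coord (F i)) ->
  g_sigma_preimage coord (\bigcup_i (F i)).
Proof. exact: sigma_algebra_bigcup. Qed.

HB.instance Definition _ := @isMeasurable.Build rV_display 'rV[R]_d
  (g_sigma_preimage coord) rV_set0 rV_setC rV_bigcup.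

Lemma measurable_coord (i : 'I_d) :
  measurable_fun [set: 'rV[R]_d] (fun x => x ord0 i).
Proof.
move=> _ Y mY; rewrite setTI; apply: sub_sigma_algebra => /=.
rewrite -bigcup_seq/=; exists i => /=; first by rewrite mem_index_enum.
by exists Y => //; rewrite setTI.
Qed.

Lemma measurable_fun_rV d' (T : measurableType d') (f : T -> 'rV[R]_d) :
  (forall i, measurable_fun setT (fun x => f x ord0 i)) ->
  measurable_fun setT f.
Proof.
move=> mf; apply: measurability; first by rewrite /measurable /=; reflexivity.
move=> _ [B + <-]; rewrite -bigcup_seq/= => -[i _ [C mC <-]].
by rewrite setTI; rewrite setTI -[X in measurable X]setTI; exact: mf.
Qed.
End rV_measurable.

(* The image of a sigma-finite measure by an injective bimeasurable map; the
   library's pushforward is neither inferred to be a measure (its measurability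
   proof is not an argument) nor known to be sigma-finite. *)
Definition image_measure d1 d2 (T1 : measurableType d1)
    (T2 : measurableType d2) (R : realType) (f : T1 -> T2) (g : T2 -> T1)
    (mf : measurable_fun setT f) (mg : measurable_fun setT g)
    (fK : cancel f g) (mu : {sigma_finite_measure set T1 -> \bar R}) :
  set T2 -> \bar R := pushforward mu f.

Section image_measure.
Local Open Scope ereal_scope.
Context d1 d2 (T1 : measurableType d1) (T2 : measurableType d2) (R : realType).
Context (f : T1 -> T2) (g : T2 -> T1) (mf : measurable_fun setT f)
  (mg : measurable_fun setT g) (fK : cancel f g).
Context (mu : {sigma_finite_measure set T1 -> \bar R}).

Local Notation nu := (image_measure mf mg fK mu).

Let nu0 : nu set0 = 0.
Proof. by rewrite /image_measure /pushforward preimage_set0 measure0. Qed.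

Let nu_ge0 A : 0 <= nu A.
Proof. exact: measure_ge0. Qed.

Let nu_sigma_additive : semi_sigma_additive nu.
Proof.
have mpre A : measurable A -> measurable (f @^-1` A).
  by move=> mA; rewrite -[X in measurable X]setTI; exact: mf.
move=> F mF tF mUF; rewrite /image_measure /pushforward preimage_bigcup.
apply: measure_semi_sigma_additive => [n| |]; first exact: mpre.
- apply/trivIsetP => /= i j _ _ ij; rewrite -preimage_setI.
  by move/trivIsetP : tF => /(_ _ _ _ _ ij) ->//; rewrite preimage_set0.
- by rewrite -preimage_bigcup; exact: mpre.
Qed.

HB.instance Definition _ := isMeasure.Build _ _ _ nu
  nu0 nu_ge0 nu_sigma_additive.

Let nu_sigma_finite : sigma_finite setT nu.
Proof.
have [F TF Foo] := sigma_finiteT mu.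
exists (fun n => g @^-1` F n); first by rewrite -preimage_bigcup -TF.
move=> n; have [mF Fn] := Foo n; split.
  by rewrite -[X in measurable X]setTI; exact: mg.
rewrite /image_measure /pushforward -comp_preimage (_ : g \o f = id)//.
exact/funext.
Qed.

HB.instance Definition _ := Measure_isSigmaFinite.Build _ _ _ nu
  nu_sigma_finite.

End image_measure.

(* A copy of \x: for \x itself, the sigma-finite structure is only inferred
   when both factors are subprobability measures. *)
Section product_measure.
Local Open Scope ereal_scope.
Context d1 d2 (T1 : measurableType d1) (T2 : measurableType d2) (R : realType).
Context (m1 : {sigma_finite_measure set T1 -> \bar R}).
Context (m2 : {sigma_finite_measure set T2 -> \bar R}).

Definition product_measure : set (T1 * T2) -> \bar R := m1 \x m2.

HB.instance Definition _ :=
  Measure.copy product_measure (m1 \x m2 : {measure set (T1 * T2) -> \bar R}).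

Let product_sigma_finite : sigma_finite setT product_measure.
Proof.
have /sigma_finiteP[F [TF ndF Foo]] := sigma_finiteT m1.
have /sigma_finiteP[G [TG ndG Goo]] := sigma_finiteT m2.
exists (fun n => F n `*` G n).
  rewrite -setXTT TF TG predeqE => -[x y]; split.
    move=> [/= [n _ Fnx] [k _ Gky]]; exists (maxn n k) => //; split.
    - by move: x Fnx; exact/subsetPset/ndF/leq_maxl.
    - by move: y Gky; exact/subsetPset/ndG/leq_maxr.
  by move=> [n _ []/= ? ?]; split; exists n.
move=> k; have [? ?] := Foo k; have [? ?] := Goo k.
split; first exact: measurableX.
by rewrite /product_measure product_measure1E// lte_mul_pinfty// ge0_fin_numE.
Qed.

HB.instance Definition _ := Measure_isSigmaFinite.Build _ _ _ product_measure
  product_sigma_finite.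

End product_measure.

(* tuple_measure mu n is the n-fold product of mu with itself. *)
Section tuple_measure.
Local Open Scope ereal_scope.
Context d (T : measurableType d) (R : realType).

Section cons.
Variable n : nat.
Let cons (x : T * n.-tuple T) : n.+1.-tuple T := [tuple of x.1 :: x.2].
Let uncons (x : n.+1.-tuple T) : T * n.-tuple T :=
  (thead x, [tuple of behead x]).

Lemma measurable_tuple_cons : measurable_fun setT cons.
Proof. exact: measurable_cons. Qed.

Lemma measurable_tuple_uncons : measurable_fun setT uncons.
Proof.
apply: measurable_fun_pair; last exact: measurable_behead.
exact: measurable_tnth.
Qed.

Lemma tuple_consK : cancel cons uncons.
Proof. by move=> [x t]; congr pair; apply/val_inj. Qed.

End cons.

Fixpoint tuple_measure (mu : {sigma_finite_measure set T -> \bar R}) n :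
    {sigma_finite_measure set (n.-tuple T) -> \bar R} :=
  match n with
  | 0 => \d_([tuple] : 0.-tuple T)
  | n.+1 => image_measure (@measurable_tuple_cons n)
      (@measurable_tuple_uncons n) (@tuple_consK n)
      (product_measure mu (tuple_measure mu n))
  end.

End tuple_measure.

Lemma tuple_measure_box d (T : measurableType d) (R : realType)
    (mu : {sigma_finite_measure set T -> \bar R}) n (A : 'I_n -> set T) :
  (forall i, measurable (A i)) ->
  tuple_measure mu n [set t | forall i, A i (tnth t i)] =
  (\prod_(i < n) mu (A i))%E.
Proof.
elim: n A => [|n IH] A mA /=; first by rewrite big_ord0 diracE mem_set// => -[].
rewrite /image_measure /pushforward /product_measure big_ord_recl.
rewrite -IH// -product_measure1E//=.
  congr (product_measure1 _ _ _); apply/seteqP; split=> -[x t] /=.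
    move=> H; split; first by have := H ord0.
    by move=> i; have := H (lift ord0 i); rewrite tnthS.
  move=> [H1 H2] i; have [->//|i0] := eqVneq i ord0.
  have [j ->] : exists j, i = lift ord0 j.
    by case: (unliftP ord0 i) i0 => [j -> _|-> /eqP//]; exists j.
  by rewrite tnthS.
rewrite (_ : [set t | _] = \bigcap_(i in [set: 'I_n])
    ((@tnth _ T ^~ i) @^-1` A (lift ord0 i))).
  apply: fin_bigcap_measurable; first exact: finite_finset.
  by move=> i _; rewrite -[X in measurable X]setTI; apply: measurable_tnth.
by apply/seteqP; split=> t /= H i; [move=> _; exact: H|exact: (H i Logic.I)].
Qed.

Section lebesgue_rV.
Context (R : realType) (d : nat).

Let rV_of_tuple (t : d.-tuple (measurableTypeR R)) : 'rV[R]_d := \row_i tnth t i.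
Let tuple_of_rV (x : 'rV[R]_d) : d.-tuple (measurableTypeR R) :=
  [tuple x ord0 i | i < d].

Lemma measurable_rV_of_tuple : measurable_fun setT rV_of_tuple.
Proof.
apply: measurable_fun_rV => i; rewrite (_ : (fun _ => _) = (@tnth _ (measurableTypeR R) ^~ i)).
  exact: (@measurable_tnth _ (measurableTypeR R)).
by apply/funext => t; rewrite mxE.
Qed.

Lemma measurable_tuple_of_rV : measurable_fun setT tuple_of_rV.
Proof.
apply/measurable_fun_tnthP => i.
rewrite (_ : _ \o _ = (fun x : 'rV[R]_d => x ord0 i)).
  exact: measurable_coord.
by apply/funext => x /=; rewrite tnth_mktuple.
Qed.

Lemma rV_of_tupleK : cancel rV_of_tuple tuple_of_rV.
Proof. by move=> t; apply: eq_from_tnth => i; rewrite tnth_mktuple mxE. Qed.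

Definition lebesgue_rV : {sigma_finite_measure set 'rV[R]_d -> \bar R} :=
  image_measure measurable_rV_of_tuple measurable_tuple_of_rV rV_of_tupleK
    (tuple_measure lebesgue_measure d).

End lebesgue_rV.
Arguments lebesgue_rV {R d}.

Lemma lebesgue_rV_box (R : realType) d (a b : 'I_d -> R) :
  (forall i, a i <= b i) ->
  lebesgue_rV [set s : 'rV[R]_d | forall i, a i <= s ord0 i <= b i] =
  (\prod_(i < d) (b i - a i))%:E.
Proof.
move=> ab; rewrite -prodEFin.
transitivity (tuple_measure lebesgue_measure d
    [set t : d.-tuple (measurableTypeR R) | forall i,
      `[a i, b i]%classic (tnth t i)]).
  by congr (tuple_measure _ _ _); apply/seteqP; split=> t /= H i;
    have := H i; rewrite mxE in_itv.
have -> := tuple_measure_box lebesgue_measure (A := fun i => `[a i, b i]%classic).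
  apply: eq_bigr => i _.
  etransitivity; first exact: (lebesgue_measure_itv `[a i, b i]).
  rewrite /= lte_fin; case: ltP => // ba.
  by rewrite (_ : a i = b i) ?subrr//; apply/eqP; rewrite eq_le ab ba.
by move=> i; exact: measurable_itv.
Qed.

Section simplex.
Context {R : realType} {d : nat}.

Definition norm1 (s : 'rV[R]_d) : R := \sum_(i < d) `|s ord0 i|.

Definition simplex : set 'rV[R]_d :=
  [set s : 'rV[R]_d | (forall i, 0 <= s ord0 i <= 1) /\ norm1 s <= 1].

Lemma measurable_simplex : measurable simplex.
Proof.
rewrite (_ : simplex = (\bigcap_(i in [set: 'I_d])
    ((fun s : 'rV[R]_d => s ord0 i) @^-1` `[0, 1])) `&`
    (norm1 @^-1` `]-oo, 1])); last first.
  apply/seteqP; split=> s /=.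
    move=> [s01 s1]; split; last by rewrite in_itv.
    by move=> i _ /=; rewrite in_itv/=.
  rewrite in_itv/= => -[s01 s1]; split=> // i.
  by have /= := s01 i Logic.I; rewrite in_itv.
apply: measurableI.
  apply: fin_bigcap_measurable => [|i _]; first exact: finite_finset.
  by rewrite -[X in measurable X]setTI; apply: measurable_coord.
rewrite -[X in measurable X]setTI; apply: (_ : measurable_fun setT norm1) => //.
apply: measurable_sum => i; apply: measurableT_comp => //.
exact: measurable_coord.
Qed.

End simplex.
Arguments simplex {R} d.

Section dirichlet.
Context {R : realType} {d : nat}.

Definition gamma (x : R) : R :=
  \int[lebesgue_measure]_(t in `]0, +oo[%classic) (t `^ (x - 1) * expR (- t)).

(* With powR, 0 `^ 0 = 1, so that a factor with s_i = 0 and u_i = 1 is 1; for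
   u_i < 1 the factor is 0 at s_i = 0, where the usual formula is undefined.
   At points of the simplex the estimator only uses parameters at least 1. *)
Definition dirichlet_density (u : 'rV[R]_d) (v : R) (s : 'rV[R]_d) : R :=
  gamma (v + \sum_(i < d) u ord0 i)
    / (gamma v * \prod_(i < d) gamma (u ord0 i))
  * (1 - norm1 s) `^ (v - 1)
  * \prod_(i < d) s ord0 i `^ (u ord0 i - 1).

Definition dirichlet_kde (n : nat) (b : R) (X : n.-tuple 'rV[R]_d)
    (s : 'rV[R]_d) : R :=
  n%:R^-1 * \sum_(i < n)
    dirichlet_density (b^-1 *: s + const_mx 1) ((1 - norm1 s) / b + 1)
      (tnth X i).

End dirichlet.

Section hoelder_class.
Context {R : realType} {d : nat}.
Implicit Types (f : 'rV[R]_d -> R) (w : seq 'I_d) (gm : {ffun 'I_d -> nat}).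

Definition partial_along (i : 'I_d) f : 'rV[R]_d -> R :=
  fun s => 'D_(delta_mx ord0 i) f s.

Definition iter_partial w f : 'rV[R]_d -> R := foldr partial_along f w.

Fixpoint has_iter_partial (U : set 'rV[R]_d) w f : Prop :=
  if w is i :: w' then
    has_iter_partial U w' f /\
    forall s, U s -> derivable (iter_partial w' f) s (delta_mx ord0 i)
  else True.

(* The directions of D^gm = d_1^(gm_1) ... d_d^(gm_d): each index i is repeated
   gm_i times. *)
Definition mindex_dirs gm : seq 'I_d :=
  flatten [seq nseq (gm i) i | i <- enum 'I_d].

(* The supremum of the naturals l < beta; all of them are at most the integer
   part of beta. *)
Definition hoelder_order (beta : R) : nat :=
  (\max_(l < (Num.truncn beta).+1 | (l%:R < beta)%R) l)%N.

(* Functions are total on R^d, but only their values on the interior of the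
   simplex matter here. *)
Definition hoelder_class (beta L : R) : set ('rV[R]_d -> R) :=
  [set f | forall gm, (\sum_(i < d) gm i)%N = hoelder_order beta ->
    has_iter_partial (simplex d)^° (mindex_dirs gm) f /\
    forall s t, (simplex d)^° s -> (simplex d)^° t ->
      `|iter_partial (mindex_dirs gm) f s - iter_partial (mindex_dirs gm) f t|
        <= L * norm1 (s - t) `^ (beta - (hoelder_order beta)%:R)].

End hoelder_class.
Arguments hoelder_class {R} d beta L.

Record simplex_density (R : realType) (d : nat) := SimplexDensity {
  density_fun :> 'rV[R]_d -> R;
  measurable_density : measurable_fun (simplex d) density_fun;
  density_ge0 : forall s, simplex d s -> 0 <= density_fun s;
  integral_density :
    (\int[lebesgue_rV]_(s in simplex d) (density_fun s)%:E = 1)%E }.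

Section law.
Local Open Scope ereal_scope.
Context {R : realType} {d : nat} (f : simplex_density R d).

Definition law (A : set 'rV[R]_d) : \bar R :=
  \int[lebesgue_rV]_(s in A `&` simplex d) (f s)%:E.

Let law0 : law set0 = 0.
Proof. by rewrite /law set0I integral_set0. Qed.

Let law_ge0 A : 0 <= law A.
Proof.
by apply: integral_ge0 => s [_ Ss]; rewrite lee_fin; exact: density_ge0.
Qed.

Let law_sigma_additive : semi_sigma_additive law.
Proof.
move=> F mF tF mUF; rewrite /law setI_bigcupl ge0_integral_bigcup/=.
- apply: is_cvg_ereal_nneg_natsum_cond => n _ _; exact: law_ge0.
- by move=> n; apply: measurableI => //; exact: measurable_simplex.
- apply/measurable_realfun.measurable_EFinP; apply: measurable_funS (measurable_density f).
    exact: measurable_simplex.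
  by rewrite -setI_bigcupl; exact: subIsetr.
- by move=> s [n _ [_ Ss]]; rewrite lee_fin; exact: density_ge0.
- exact: trivIset_setIr.
Qed.

HB.instance Definition _ := isMeasure.Build _ _ _ law
  law0 law_ge0 law_sigma_additive.

Let law_setT : law setT = 1.
Proof. by rewrite /law setTI integral_density. Qed.

HB.instance Definition _ := @Measure_isProbability.Build _ _ R law law_setT.

End law.

Section risk.
Local Open Scope ereal_scope.
Context {R : realType} {d n : nat} (p : R).

Definition sample_space : set (n.-tuple 'rV[R]_d) :=
  [set X | forall i, simplex d (tnth X i)].

(* An estimator maps a sample to a function on the simplex; it is measurable
   jointly in the sample and the point. *)
Definition is_estimator (fhat : n.-tuple 'rV[R]_d -> 'rV[R]_d -> R) : Prop :=
  measurable_fun (sample_space `*` simplex d) (fun z => fhat z.1 z.2).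

Definition risk (fhat : n.-tuple 'rV[R]_d -> 'rV[R]_d -> R)
    (f : simplex_density R d) : \bar R :=
  (\int[tuple_measure (law f) n]_(X in sample_space)
    'N[lebesgue_rV]_p%:E[(EFin \o (fhat X \- f)%R) \_ (simplex d)] `^ p)
  `^ p^-1.

Definition class_risk (beta L : R)
    (fhat : n.-tuple 'rV[R]_d -> 'rV[R]_d -> R) : \bar R :=
  ereal_sup [set risk fhat f | f in
    [set f : simplex_density R d | hoelder_class d beta L f]].

End risk.

Definition minimax_risk {R : realType} (d n : nat) (p beta L : R) : \bar R :=
  ereal_inf [set class_risk p beta L fhat | fhat in @is_estimator R d n].

(* Main.v *)
Require Import Defs.
From HB Require Import structures.
From mathcomp Require Import all_boot all_order all_algebra.
From mathcomp Require Import all_classical all_reals all_analysis.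
From mathcomp Require Import measurable_realfun ring lra.
Set Implicit Arguments.
Unset Strict Implicit.
Unset Printing Implicit Defensive.
Import Order.TTheory GRing.Theory Num.Theory.
Import numFieldNormedType.Exports.
Local Open Scope classical_set_scope.
Local Open Scope ring_scope.

(** The Dirichlet kernel estimators cannot exploit a smoothness beta > 2: their risk
    over the class is at least of the order n ^ (- 2 / (d + 4)) whatever the
    bandwidths, while some estimator attains n ^ (- beta / (d + 2 beta)), which is of
    smaller order precisely because beta > 2. So the ratio in the theorem is at least
    a constant times n ^ (beta / (d + 2 beta) - 2 / (d + 4)).

    Lower bound ([kde_class_risk_ge]). The class contains the affine densities,
    since beta > 2 constrains derivatives of order at least 2 only
    ([hoelder_class_affine]). The moments of the Dirichlet distribution show that
    the kernel centred at s has a mean that differs from s by a multiple of b, so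
    that for a linear density the bias is of order b ([kde_error_linear]). Under
    the uniform density the estimator is a centred average whose kernel has most of
    its mass in a cube of side of order the square root of b around s
    ([kernel_mass_cube]), and the mean absolute value of its error is bounded below
    by that of a centred binomial variable that counts the observations in that
    cube ([integral_abs_sum_ge], [kde_error_uniform]). With r ^ (d + 4) = 1 / n one
    of these errors is at least of order r ^ 2, according to whether b is larger or
    smaller than r ^ 2 up to a constant. Both hold at all the points of a cube
    inside the simplex, and [risk_ge] turns this into a bound for the risk with an
    arbitrary exponent p.

    Upper bound ([minimax_risk_rate]). The competing estimator averages kernels that
    are linear combinations of uniform densities on boxes, with coefficients of both
    signs. The combination comes from extrapolating f at s from its values at points
    at a distance of order h from s, one axis after the other; along one axis the
    error is bounded by h ^ beta because the difference of order m + 1 of a function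
    is a difference of two values of its m-th derivative ([extrap_axis_error]). The
    nodes are chosen inside the simplex: they increase all the coordinates, after a
    preliminary decrease of a large coordinate near the face where the coordinates
    sum to 1 ([stencil_open], [stencil_error]). The kernels are of order h ^ (- d), so
    the bias is of order h ^ beta and the variance of order 1 / (n h ^ d); since the
    densities of the class are uniformly bounded ([class_density_le]) an exponential
    moment bound ([integral_powR_mean_le]) controls the p-th moments of the error for
    every p, and h ^ (d + 2 beta) = 1 / n gives the rate. *)

(** * Iterated integrals over tuples *)

Section tuple_integral.
Local Open Scope ereal_scope.
Context d (T : measurableType d) (R : realType).
Variable mu : {sigma_finite_measure set T -> \bar R}.

Lemma integral_tuple_measureS n (F : n.+1.-tuple T -> \bar R) :
  @measurable_fun _ _ (n.+1.-tuple T) (\bar R) setT F -> (forall t, 0 <= F t) ->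
  \int[tuple_measure mu n.+1]_t F t =
  \int[mu]_x \int[tuple_measure mu n]_t F [tuple of x :: t].
Proof.
move=> mF F0.
rewrite [LHS](ge0_integral_pushforward (@measurable_tuple_cons _ T n)
  (product_measure mu (tuple_measure mu n)))//=.
rewrite preimage_setT; apply: fubini_tonelli1 => [|x]; last exact: F0.
by apply: measurableT_comp => //; exact: measurable_tuple_cons.
Qed.

Lemma integral_tuple_measureS_swap n (F : n.+1.-tuple T -> \bar R) :
  @measurable_fun _ _ (n.+1.-tuple T) (\bar R) setT F -> (forall t, 0 <= F t) ->
  \int[tuple_measure mu n.+1]_t F t =
  \int[tuple_measure mu n]_t \int[mu]_x F [tuple of x :: t].
Proof.
move=> mF F0.
rewrite [LHS](ge0_integral_pushforward (@measurable_tuple_cons _ T n)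
  (product_measure mu (tuple_measure mu n)))//=.
rewrite preimage_setT; apply: fubini_tonelli2 => [|x]; last exact: F0.
by apply: measurableT_comp => //; exact: measurable_tuple_cons.
Qed.

Lemma integral_tuple_measure0 (F : 0.-tuple T -> \bar R) :
  @measurable_fun _ _ (0.-tuple T) (\bar R) setT F ->
  \int[tuple_measure mu 0]_t F t = F [tuple].
Proof. by move=> mF; rewrite /= integral_dirac// diracT mul1e. Qed.

Lemma measurable_tuple_prod n (g : 'I_n -> T -> R) :
  (forall i, measurable_fun setT (g i)) ->
  measurable_fun [set: n.-tuple T] (fun t : n.-tuple T => (\prod_(i < n) g i (tnth t i))%R).
Proof.
move=> mg; apply: measurable_prod => i _.
exact: (measurableT_comp (mg i) (@measurable_tnth _ T n i)).
Qed.

Lemma measurable_tuple_sum n (g : 'I_n -> T -> R) :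
  (forall i, measurable_fun setT (g i)) ->
  measurable_fun [set: n.-tuple T] (fun t : n.-tuple T => (\sum_(i < n) g i (tnth t i))%R).
Proof.
move=> mg; apply: measurable_sum => i.
exact: (measurableT_comp (mg i) (@measurable_tnth _ T n i)).
Qed.

Lemma integral_tuple_prod n (g : T -> R) :
  measurable_fun setT g -> (forall x, (0 <= g x)%R) ->
  \int[tuple_measure mu n]_t (\prod_(i < n) g (tnth t i))%:E =
  \prod_(i < n) (\int[mu]_x (g x)%:E).
Proof.
move=> mg g0; elim: n => [|n IH].
  rewrite integral_tuple_measure0 ?big_ord0//.
  apply/measurable_EFinP; exact: (@measurable_tuple_prod 0 (fun=> g)).
rewrite integral_tuple_measureS; last 2 first.
- by apply/measurable_EFinP; apply: (@measurable_tuple_prod _ (fun=> g)) => i; exact: mg.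
- by move=> t; rewrite lee_fin prodr_ge0.
rewrite big_ord_recl -IH.
have mp : measurable_fun [set: n.-tuple T]
    (fun t : n.-tuple T => (\prod_(i < n) g (tnth t i))%:E).
  by apply/measurable_EFinP; apply: (@measurable_tuple_prod _ (fun=> g)) => i; exact: mg.
have p0 (t : n.-tuple T) : 0 <= (\prod_(i < n) g (tnth t i))%:E.
  by rewrite lee_fin prodr_ge0.
rewrite -ge0_integralZr//; last 3 first.
- exact/measurable_EFinP.
- by move=> x _; rewrite lee_fin.
- by apply: integral_ge0.
apply: eq_integral => x _; rewrite -ge0_integralZl//; last by rewrite lee_fin.
by apply: eq_integral => t _; rewrite -EFinM big_ord_recl;
  congr ((_ * _)%:E); apply: eq_bigr => i _; rewrite tnthS.
Qed.

Lemma tuple_measureT n : mu setT = 1 -> tuple_measure mu n setT = 1.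
Proof.
move=> mu1; rewrite -(_ : [set t : n.-tuple T | forall i : 'I_n, setT (tnth t i)] = setT).
  rewrite (tuple_measure_box mu (A := fun=> setT))//.
  by rewrite big1.
by apply/seteqP; split.
Qed.

End tuple_integral.

(** * Sums of independent variables *)

Section two_point.
Context {R : realType}.
Implicit Types (p a b c w : R).

(** The expectation of the absolute value of c plus the sum of n independent
    variables that take the value a with probability p and b otherwise. *)
Fixpoint two_point p a b n c : R :=
  if n is n'.+1 then p * two_point p a b n' (c + a)
                     + (1 - p) * two_point p a b n' (c + b)
  else `|c|.

(** The inequality |x| >= x ^ 2 / tau - x ^ 4 / tau ^ 3 bounds a first absolute
    moment from below by the second and the fourth one; these are given for a sum
    of n independent centred variables of variance V, third moment M3 and fourth
    moment M4, added to the constant c. *)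
Lemma two_point_ge_moments p a b (tau : R) n c V M3 M4 :
  0 <= p <= 1 -> 0 < tau ->
  p * a + (1 - p) * b = 0 ->
  V = p * a ^+ 2 + (1 - p) * b ^+ 2 ->
  M3 = p * a ^+ 3 + (1 - p) * b ^+ 3 ->
  M4 = p * a ^+ 4 + (1 - p) * b ^+ 4 ->
  (c ^+ 2 + n%:R * V) / tau
    - (c ^+ 4 + 6 * c ^+ 2 * (n%:R * V) + 4 * c * (n%:R * M3) + n%:R * M4
       + 3 * n%:R * (n%:R - 1) * V ^+ 2) / tau ^+ 3 <= two_point p a b n c.
Proof.
move=> /andP[p0 p1] tau0 mean VE M3E M4E.
elim: n c => [|n IH] c.
  rewrite /= !(mul0r, mulr0, addr0).
  have -> : c ^+ 2 / tau - c ^+ 4 / tau ^+ 3 =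
      tau * ((`|c| / tau) ^+ 2 - (`|c| / tau) ^+ 4).
    have -> : c ^+ 2 = `|c| ^+ 2 by rewrite real_normK// num_real.
    have -> : c ^+ 4 = `|c| ^+ 4.
      by rewrite -[4%N]/(2 * 2)%N !exprM real_normK// num_real.
    by field; rewrite gt_eqF.
  have -> : `|c| = tau * (`|c| / tau) by field; rewrite gt_eqF.
  set x := (X in _ <= tau * X).
  have -> : tau * x / tau = x by field; rewrite gt_eqF.
  have x0 : 0 <= x by rewrite divr_ge0// ltW.
  rewrite ler_pM2l//; have [x1|x1] := leP x 1.
    have : 0 <= x ^+ 4 by rewrite exprn_ge0.
    nra.
  have : x ^+ 2 <= x ^+ 4 by rewrite ler_eXn2l.
  lra.
rewrite /=.
apply: (le_trans _ (lerD (ler_wpM2l p0 (IH (c + a)))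
  (ler_wpM2l (_ : 0 <= 1 - p) (IH (c + b))))); last by rewrite subr_ge0.
have it : (tau ^+ 3)^-1 = tau^-1 ^+ 3 by rewrite exprVn.
rewrite it; set t := tau^-1.
rewrite le_eqVlt; apply/orP; left; rewrite eq_sym -subr_eq0; apply/eqP.
transitivity ((p * a + (1 - p) * b) *
   (2 * c * t - (4 * c ^+ 3 + 12 * c * (n%:R * V) + 4 * n%:R * M3) * t ^+ 3));
  last by rewrite mean mul0r.
by rewrite VE M3E M4E -natr1; ring.
Qed.

(** With tau of the order of the standard deviation the second moment dominates
    the fourth: the condition n p >= 1 makes the summands bounded by the standard
    deviation of the sum. *)
Lemma two_point_ge p w n : 0 < p <= 2^-1 -> 0 < w -> 1 <= n%:R * p ->
  w * Num.sqrt (n%:R / p) / 10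
    <= two_point p (w / p) (- w / (1 - p)) n 0.
Proof.
move=> /andP[p0 p2] w0 np1.
have q0 : 0 < 1 - p by lra.
have n0 : 0 < n%:R :> R by have := ltr01 (R := R); nra.
pose B := n%:R / p * w ^+ 2.
pose r := w * Num.sqrt (n%:R / p).
have r0 : 0 < r by rewrite mulr_gt0// sqrtr_gt0 divr_gt0.
have rB : r ^+ 2 = B.
  by rewrite exprMn sqr_sqrtr ?divr_ge0 ?ltW// mulrC.
have B0 : 0 < B by rewrite -rB exprn_gt0.
have mean : p * (w / p) + (1 - p) * (- w / (1 - p)) = 0.
  by field; rewrite !gt_eqF.
have p01 : 0 <= p <= 1 by lra.
(* The factor 6 in tau = 6 r makes the loss 14 / 6 ^ 3 in the fourth moment
   smaller than the gain 1 / 6. *)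
have r60 : 0 < 6 * r by lra.
have := two_point_ge_moments n 0 p01 r60 mean erefl erefl erefl.
set V := p * _ ^+ 2 + _; set M3 := p * _ ^+ 3 + _; set M4 := p * _ ^+ 4 + _.
rewrite !(expr0n, mulr0, mul0r, add0r) /=.
apply: le_trans.
have VE : V = w ^+ 2 / (p * (1 - p)) by rewrite /V; field; rewrite !gt_eqF.
have nV1 : B <= n%:R * V.
  rewrite VE /B -mulrA [_^-1 * _]mulrC ler_pM2l// ler_pM2l ?exprn_gt0//.
  by rewrite lef_pV2 ?posrE ?mulr_gt0//; nra.
have nV2 : n%:R * V <= 2 * B.
  rewrite VE /B (_ : 2 * _ = n%:R * (w ^+ 2 * (2 / p))); last by ring.
  rewrite ler_pM2l// ler_pM2l ?exprn_gt0//.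
  rewrite invfM [2 / p]mulrC ler_pM2l ?invr_gt0//.
  by rewrite -[leRHS]invrK lef_pV2 ?posrE ?invr_gt0//; lra.
have nM4 : n%:R * M4 <= 2 * B ^+ 2.
  have -> : M4 = w ^+ 4 * ((p ^+ 3)^-1 + ((1 - p) ^+ 3)^-1).
    by rewrite /M4; field; rewrite !gt_eqF.
  have h1 : ((1 - p) ^+ 3)^-1 <= (p ^+ 3)^-1.
    rewrite lef_pV2 ?posrE ?exprn_gt0//.
    by rewrite lerXn2r ?nnegrE; lra.
  apply: (@le_trans _ _ (n%:R * (w ^+ 4 * (2 * (p ^+ 3)^-1)))).
    by rewrite ler_pM2l// ler_pM2l ?exprn_gt0//; lra.
  rewrite (_ : 2 * B ^+ 2 = n%:R * (w ^+ 4 * (2 * (p ^+ 3)^-1)) * (n%:R * p)).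
    by rewrite ler_peMr// !mulr_ge0// ?invr_ge0 ?exprn_ge0// ltW.
  by rewrite /B; field; rewrite gt_eqF.
have nn : 3 * n%:R * (n%:R - 1) * V ^+ 2 <= 12 * B ^+ 2.
  apply: (@le_trans _ _ (3 * (n%:R * V) ^+ 2)).
    rewrite [leLHS](_ : _ = 3 * (n%:R * V) ^+ 2 - 3 * n%:R * V ^+ 2); last by ring.
    by rewrite gerBl mulr_ge0 ?sqr_ge0// mulr_ge0.
  have : (n%:R * V) ^+ 2 <= (2 * B) ^+ 2.
    have h0 : 0 <= n%:R * V by rewrite (le_trans _ nV1)// ltW.
    by rewrite lerXn2r ?nnegrE ?(le_trans h0).
  by rewrite [X in _ <= X -> _]exprMn; lra.
apply: (@le_trans _ _ (B / (6 * r) - 14 * B ^+ 2 / (6 * r) ^+ 3)).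
  rewrite -rB -/r.
  have -> : r ^+ 2 / (6 * r) - 14 * (r ^+ 2) ^+ 2 / (6 * r) ^+ 3 = r * (11 / 108).
    by field; rewrite gt_eqF.
  by rewrite ler_pM2l//; lra.
apply: lerB.
  by rewrite ler_pM2r ?invr_gt0; lra.
rewrite ler_pM2r ?invr_gt0 ?exprn_gt0//; lra.
Qed.

End two_point.

Section iid_sums.
Context d (T : measurableType d) (R : realType) (mu : probability T R).

(** The summands are integrated one at a time, and Jensen's inequality is applied
    on A and on its complement, where the conditional means of W are a and b. *)
Lemma two_point_le_integral (W : T -> R) (A : set T) (p a b : R) n c :
  measurable A -> measurable_fun setT W -> mu.-integrable setT (EFin \o W) ->
  mu A = p%:E ->
  (\int[mu]_(x in A) (W x)%:E = (p * a)%:E)%E ->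
  (\int[mu]_(x in ~` A) (W x)%:E = ((1 - p) * b)%:E)%E ->
  ((two_point p a b n c)%:E <=
   \int[tuple_measure mu n]_t `|c + \sum_(i < n) W (tnth t i)|%:E)%E.
Proof.
move=> mA mW iW muA intA intC.
have muC : mu (~` A) = (1 - p)%:E.
  by rewrite probability_setC// muA.
have p0 : 0 <= p by rewrite -lee_fin -muA.
have q0 : 0 <= 1 - p by rewrite -lee_fin -muC.
have step y : ((p * `|y + a| + (1 - p) * `|y + b|)%:E <=
    \int[mu]_x (`|y + W x|)%:E)%E.
  have iy : mu.-integrable setT (fun x => (y + W x)%:E).
    under eq_fun do rewrite EFinD.
    by apply: integrableD => //; exact: finite_measure_integrable_cst.
  have my : measurable_fun setT (fun x => (y + W x)).
    exact: measurable_funD.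
  have part (D : set T) q e : measurable D -> mu D = q%:E -> 0 <= q ->
      (\int[mu]_(x in D) (W x)%:E = (q * e)%:E)%E ->
      ((q * `|y + e|)%:E <= \int[mu]_(x in D) (`|y + W x|)%:E)%E.
    move=> mD muD q_ge0 intD.
    have -> : (q * `|y + e|)%:E = (`|\int[mu]_(x in D) (y + W x)%:E|)%E.
      under eq_integral do rewrite EFinD.
      rewrite integralD//; last 2 first.
      - by apply: (integrableS measurableT) => //; exact: finite_measure_integrable_cst.
      - exact: (integrableS measurableT).
      rewrite [X in (X + _)%E]integral_cst// intD [X in (_ * X + _)%E]muD -EFinM -EFinD /=.
      by rewrite [y * q]mulrC -mulrDr normrM ger0_norm.
    apply: le_abse_integral => //.
    by apply/measurable_EFinP; exact: measurable_funS my.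
  rewrite -(setUv A) ge0_integral_setU//=.
  - rewrite EFinD; apply: leeD; apply: part => //; exact: measurableC.
  - exact: measurableC.
  - by rewrite setUv; apply/measurable_EFinP; exact: measurableT_comp.
  - by rewrite disj_set2E setICr.
elim: n c => [|n IH] c.
  rewrite integral_tuple_measure0 ?big_ord0 ?addr0//.
  apply/measurable_EFinP; apply: measurableT_comp => //.
  apply: measurable_funD => //.
  exact: (@measurable_tuple_sum _ T R 0 (fun=> W)).
have msum k e : measurable_fun [set: k.-tuple T]
    (fun t : k.-tuple T => (`|e + \sum_(i < k) W (tnth t i)|)).
  apply: measurableT_comp => //; apply: measurable_funD => //.
  exact: (@measurable_tuple_sum _ T R k (fun=> W)).
rewrite integral_tuple_measureS_swap//; last by apply/measurable_EFinP; exact: msum.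
have -> : (\int[tuple_measure mu n]_t \int[mu]_x
      (`|c + \sum_(i < n.+1) W (tnth [tuple of x :: t] i)|)%:E =
   \int[tuple_measure mu n]_t \int[mu]_x
      (`|(c + \sum_(i < n) W (tnth t i)) + W x|)%:E)%E.
  apply: eq_integral => t _; apply: eq_integral => x _.
  rewrite big_ord_recl; congr (`|_|%:E).
  rewrite [tnth _ ord0]/=  -addrA; congr (_ + _); rewrite addrC.
  by congr (_ + _); apply: eq_bigr => i _; rewrite tnthS.
have ms z : measurable_fun [set: n.-tuple T]
    (fun t : n.-tuple T => (`|c + \sum_(i < n) W (tnth t i) + z|)).
  under eq_fun do rewrite addrAC; exact: msum.
apply: (@le_trans _ _ (\int[tuple_measure mu n]_t
   (p * `|c + \sum_(i < n) W (tnth t i) + a|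
    + (1 - p) * `|c + \sum_(i < n) W (tnth t i) + b|)%:E)%E).
  under eq_integral do rewrite EFinD.
  rewrite ge0_integralD//; last 4 first.
  - by move=> t _; rewrite lee_fin mulr_ge0.
  - by apply/measurable_EFinP; exact: measurable_funM.
  - by move=> t _; rewrite lee_fin mulr_ge0.
  - by apply/measurable_EFinP; exact: measurable_funM.
  have scal q z : 0 <= q -> ((q * two_point p a b n (c + z))%:E <=
      \int[tuple_measure mu n]_t (q * `|c + \sum_(i < n) W (tnth t i) + z|)%:E)%E.
    move=> q0'; under eq_integral do rewrite EFinM.
    rewrite ge0_integralZl//; last by apply/measurable_EFinP.
    rewrite EFinM lee_wpmul2l ?lee_fin// (le_trans (IH _))//.
    by under eq_integral do rewrite addrAC.
  by rewrite /= EFinD leeD// scal.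
apply: ge0_le_integral => //.
- by move=> t _; rewrite lee_fin addr_ge0 ?mulr_ge0.
- by apply/measurable_EFinP; apply: measurable_funD; exact: measurable_funM.
- pose F (z : n.-tuple T * T) :=
    (`|c + \sum_(i < n) W (tnth z.1 i) + W z.2|)%:E.
  apply: (measurable_fun_fubini_tonelli_F F) => [|z]; last by rewrite lee_fin.
  apply/measurable_EFinP; apply: measurableT_comp => //.
  apply: measurable_funD; last exact: measurableT_comp.
  apply: measurable_funD => //.
  exact: (measurableT_comp (@measurable_tuple_sum _ T R n (fun=> W) _)).
Qed.

(** Conditioning each summand on its membership in the event A replaces W by a
    variable with two values, which by Jensen's inequality can only decrease the
    mean absolute value of the sum; what is left is a centred binomial sum, whose
    mean absolute value is of the order of its standard deviation. *)
Lemma integral_abs_sum_ge (W : T -> R) (A : set T) (p w : R) n :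
  measurable A -> measurable_fun setT W -> mu.-integrable setT (EFin \o W) ->
  mu A = p%:E -> 0 < p <= 2^-1 -> 1 <= n%:R * p -> 0 < w ->
  (\int[mu]_x (W x)%:E = 0)%E ->
  (w%:E <= \int[mu]_(x in A) (W x)%:E)%E ->
  ((w * Num.sqrt (n%:R / p) / 10)%:E <=
   \int[tuple_measure mu n]_t `|\sum_(i < n) W (tnth t i)|%:E)%E.
Proof.
move=> mA mW iW muA p02 np w0 W0 wA.
have iA : (\int[mu]_(x in A) (W x)%:E \is a fin_num)%E.
  by apply: integrable_fin_num => //; exact: (integrableS measurableT).
pose w' := fine (\int[mu]_(x in A) (W x)%:E).
have w'E : (\int[mu]_(x in A) (W x)%:E = w'%:E)%E by rewrite fineK.
have ww' : w <= w' by rewrite -lee_fin -w'E.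
have w'0 : 0 < w' by exact: lt_le_trans ww'.
have /andP[p0 p2] := p02.
have wC : (\int[mu]_(x in ~` A) (W x)%:E = (- w')%:E)%E.
  have iC : (\int[mu]_(x in ~` A) (W x)%:E \is a fin_num)%E.
    apply: integrable_fin_num => //; first exact: measurableC.
    by apply: (integrableS measurableT) => //; exact: measurableC.
  move: W0; rewrite -(setUv A) integral_setU//=; last 3 first.
  - exact: measurableC.
  - by rewrite setUv; exact/measurable_EFinP.
  - by rewrite disj_set2E setICr.
  rewrite w'E -(fineK iC) -EFinD => -[] h; congr (_%:E); lra.
apply: (@le_trans _ _ (two_point p (w' / p) (- w' / (1 - p)) n 0)%:E).
  rewrite lee_fin (le_trans _ (two_point_ge p02 w'0 np))//.
  by rewrite ler_pM2r ?invr_gt0// ler_wpM2r// sqrtr_ge0.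
have := @two_point_le_integral W A p (w' / p) (- w' / (1 - p)) n 0 mA mW iW muA.
have q0 : 0 < 1 - p by lra.
rewrite w'E wC (_ : p * (w' / p) = w'); last by field; rewrite gt_eqF.
rewrite (_ : (1 - p) * (- w' / (1 - p)) = - w'); last by field; rewrite gt_eqF.
move=> /(_ erefl erefl) /le_trans; apply.
by under eq_integral do rewrite add0r.
Qed.

Lemma expR_le1Dx2sqr (x : R) : x <= 2^-1 -> expR x <= 1 + x + 2 * x ^+ 2.
Proof.
move=> x2; have x1 : 0 < 1 - x by lra.
apply: (@le_trans _ _ (1 - x)^-1).
  rewrite -[leLHS]invrK -expRN lef_pV2 ?posrE ?expR_gt0//.
  exact: expR_ge1Dx.
rewrite -[leLHS]mul1r ler_pdivrMr//.
have -> : (1 + x + 2 * x ^+ 2) * (1 - x) = 1 + x ^+ 2 * (1 - 2 * x) by ring.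
by rewrite lerDl mulr_ge0 ?sqr_ge0//; lra.
Qed.

Lemma powR_le_expR (p y : R) : 0 < p -> 0 <= y -> y `^ p <= p `^ p * expR y.
Proof.
move=> p0 y0; have -> : y = p * (y / p) by field; rewrite gt_eqF.
have yp : 0 <= y / p by rewrite divr_ge0// ltW.
rewrite powRM// ?(ltW p0)// ler_wpM2l ?powR_ge0//.
rewrite (_ : expR _ = expR (y / p) `^ p); last first.
  by rewrite -expRM mulrC.
rewrite ge0_ler_powR ?nnegrE ?expR_ge0// ?(ltW p0)//.
by rewrite (le_trans _ (expR_ge1Dx _))// lerDr.
Qed.

End iid_sums.

Section exponential_moment.
Context d (T : measurableType d) (R : realType) (mu : probability T R).

(** The exponential moment of the average factors over the observations, and each
    summand, once multiplied by the parameter, is at most 1 / 2 in absolute value,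
    where expR x <= 1 + x + 2 x ^ 2. *)
Lemma integral_expR_mean_le (W : T -> R) (S m v lambda y : R) n :
  (0 < n)%N -> measurable_fun setT W -> (forall x, `|W x| <= S) ->
  (\int[mu]_x (W x)%:E = m%:E)%E ->
  (\int[mu]_x (W x ^+ 2)%:E <= v%:E)%E ->
  `|lambda| * S / n%:R <= 2^-1 ->
  (\int[tuple_measure mu n]_t
      (expR (lambda * (n%:R^-1 * \sum_(i < n) W (tnth t i) - y)))%:E
   <= (expR (lambda * (m - y) + 2 * lambda ^+ 2 * v / n%:R))%:E)%E.
Proof.
move=> n0 mW WS Wm Wv lS.
have n0' : 0 < n%:R :> R by rewrite ltr0n.
pose th := lambda / n%:R.
have mg : measurable_fun setT (fun x => expR (th * W x)).
  by apply: measurableT_comp => //; exact: measurable_funM.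
have thW x : `|th * W x| <= 2^-1.
  rewrite normrM normrM normfV [`|n%:R|]ger0_norm ?ler0n//.
  rewrite (le_trans _ lS)// mulrAC ler_wpM2r ?invr_ge0 ?ler0n//.
  by rewrite ler_wpM2l.
have S0 : 0 <= S.
  have [[x _]|T0] := pselect (exists x : T, True).
    exact: (le_trans (normr_ge0 _) (WS x)).
  exfalso.
  suff : (mu [set: T] = 0)%E.
    by rewrite probability_setT => /eqP; rewrite onee_eq0.
  rewrite (_ : [set: T] = set0) ?measure0//.
  by apply/seteqP; split => // x _; apply: T0; exists x.
have iW : mu.-integrable setT (EFin \o W).
  apply: (@le_integrable _ _ _ mu _ measurableT (EFin \o W) (EFin \o cst S)) => //.
  - exact/measurable_EFinP.
  - by move=> x _; rewrite /= lee_fin (ger0_norm S0).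
  - exact: finite_measure_integrable_cst.
have iW2 : mu.-integrable setT (EFin \o (fun x => W x ^+ 2)).
  apply: (@le_integrable _ _ _ mu _ measurableT _ (EFin \o cst (S ^+ 2))) => //.
  - by apply/measurable_EFinP; exact: measurable_funX.
  - move=> x _; rewrite /= lee_fin normrX [`|S ^+ 2|]ger0_norm ?exprn_ge0//.
    by rewrite lerXn2r ?nnegrE.
  - exact: finite_measure_integrable_cst.
pose M := 1 + th * m + 2 * th ^+ 2 * v.
have gM : (\int[mu]_x (expR (th * W x))%:E <= M%:E)%E.
  apply: (@le_trans _ _ (\int[mu]_x (1 + th * W x + 2 * th ^+ 2 * W x ^+ 2)%:E)%E).
    apply: ge0_le_integral => //.
    - exact/measurable_EFinP.
    - apply/measurable_EFinP; apply: measurable_funD; last first.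
        by apply: measurable_funM => //; exact: measurable_funX.
      by apply: measurable_funD => //; exact: measurable_funM.
    - move=> x _; rewrite lee_fin (le_trans (expR_le1Dx2sqr _))//.
        by rewrite (le_trans (ler_norm _)).
      by rewrite exprMn mulrA.
  have -> : (\int[mu]_x (1 + th * W x + 2 * th ^+ 2 * W x ^+ 2)%:E =
     (1 + th * m)%:E + (2 * th ^+ 2)%:E * \int[mu]_x (W x ^+ 2)%:E)%E.
    under eq_integral do rewrite EFinD.
    rewrite integralD//; last 2 first.
    - under eq_fun do rewrite EFinD EFinM.
      apply: integrableD => //; first exact: finite_measure_integrable_cst.
      exact: integrableZl.
    - under eq_fun do rewrite EFinM.
      exact: integrableZl.
    congr (_ + _)%E.
      under eq_integral do rewrite EFinD EFinM.
      rewrite integralD//; last 2 first.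
      - exact: finite_measure_integrable_cst.
      - exact: integrableZl.
      rewrite integral_cst// [X in (1 * X)%E]probability_setT mule1.
      by rewrite integralZl// Wm EFinD EFinM.
    under eq_integral do rewrite EFinM.
    by rewrite integralZl.
  rewrite /M [leRHS]EFinD leeD2l// [leRHS]EFinM lee_wpmul2l// lee_fin.
  by rewrite mulr_ge0// sqr_ge0.
have -> : (\int[tuple_measure mu n]_t
      (expR (lambda * (n%:R^-1 * \sum_(i < n) W (tnth t i) - y)))%:E =
   (expR (- lambda * y))%:E *
     \prod_(i < n) (\int[mu]_x (expR (th * W x))%:E))%E.
  rewrite -integral_tuple_prod//.
  rewrite -ge0_integralZl//; last 2 first.
  - apply/measurable_EFinP.
    exact: (@measurable_tuple_prod _ T R n (fun=> fun x => expR (th * W x))).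
  - by move=> t _; rewrite lee_fin prodr_ge0// => i _; exact: expR_ge0.
  apply: eq_integral => t _; rewrite -EFinM; congr (_%:E).
  rewrite -expR_sum -expRD; congr expR.
  by rewrite -mulr_sumr /th; ring.
rewrite (_ : lambda * (m - y) + 2 * lambda ^+ 2 * v / n%:R =
  - lambda * y + (th * m + 2 * th ^+ 2 * v) * n%:R); last first.
  by rewrite /th; field; rewrite gt_eqF.
rewrite expRD EFinM lee_pmul2l ?lte_fin ?expR_gt0//.
rewrite mulrC expRM_natl.
have e0 : (0 <= \int[mu]_x (expR (th * W x))%:E)%E.
  by apply: integral_ge0 => x _; rewrite lee_fin expR_ge0.
have eM : (\int[mu]_x (expR (th * W x))%:E <=
    (expR (th * m + 2 * th ^+ 2 * v))%:E)%E.
  by rewrite (le_trans gM)// lee_fin (le_trans _ (expR_ge1Dx _))// addrA.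
have ef : (\int[mu]_x (expR (th * W x))%:E \is a fin_num)%E.
  by rewrite ge0_fin_numE// (le_lt_trans eM)// ltry.
rewrite -(fineK ef) prodEFin lee_fin.
rewrite prodr_const card_ord lerXn2r ?nnegrE ?expR_ge0//.
  by rewrite fine_ge0.
by rewrite -lee_fin fineK.
Qed.

(** A power of |x| is dominated by a multiple of the sum of the exponentials of
    lambda x and of - lambda x, with 1 / lambda of the order of the expected error,
    so that all the powers p are treated alike. *)
Lemma integral_powR_mean_le (W : T -> R) (S m v lambda y p : R) n :
  0 < p -> 0 < lambda ->
  (0 < n)%N -> measurable_fun setT W -> (forall x, `|W x| <= S) ->
  (\int[mu]_x (W x)%:E = m%:E)%E ->
  (\int[mu]_x (W x ^+ 2)%:E <= v%:E)%E ->
  lambda * S / n%:R <= 2^-1 ->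
  (\int[tuple_measure mu n]_t
      (`|n%:R^-1 * \sum_(i < n) W (tnth t i) - y| `^ p)%:E
   <= ((p / lambda) `^ p * 2 *
       expR (lambda * `|m - y| + 2 * lambda ^+ 2 * v / n%:R))%:E)%E.
Proof.
move=> p0 l0 n0 mW WS Wm Wv lS.
pose Z (t : n.-tuple T) := n%:R^-1 * \sum_(i < n) W (tnth t i) - y.
have mZ : measurable_fun [set: n.-tuple T] Z.
  apply: measurable_funB => //; apply: measurable_funM => //.
  exact: (@measurable_tuple_sum _ T R n (fun=> W)).
have mE q : measurable_fun [set: n.-tuple T] (fun t => expR (q * Z t)).
  by apply: measurableT_comp => //; exact: measurable_funM.
have pw (t : n.-tuple T) : `|Z t| `^ p <=
    (p / lambda) `^ p * (expR (lambda * Z t) + expR (- lambda * Z t)).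
  have -> : `|Z t| = lambda^-1 * (lambda * `|Z t|) by rewrite mulKf// gt_eqF.
  have l0' := ltW l0.
  rewrite [leLHS]powRM ?invr_ge0 ?mulr_ge0//.
  rewrite [p / lambda]mulrC [(lambda^-1 * p) `^ p]powRM ?invr_ge0 ?(ltW p0)//.
  rewrite -[leRHS]mulrA ler_wpM2l ?powR_ge0//.
  rewrite (le_trans (powR_le_expR p0 _)) ?mulr_ge0//.
  rewrite ler_wpM2l ?powR_ge0//.
  have [Z0|Z0] := ger0P (Z t).
    by rewrite lerDl expR_ge0.
  by rewrite mulrN mulNr lerDr expR_ge0.
have bound q : `|q| = lambda -> (\int[tuple_measure mu n]_t (expR (q * Z t))%:E <=
    (expR (lambda * `|m - y| + 2 * lambda ^+ 2 * v / n%:R))%:E)%E.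
  move=> ql; apply: le_trans; first by apply: (@integral_expR_mean_le W S m v q y n); rewrite ?ql.
  rewrite lee_fin ler_expR.
  have -> : q ^+ 2 = lambda ^+ 2 by rewrite -ql real_normK// num_real.
  by rewrite lerD2r (le_trans (ler_norm _))// normrM ql.
apply: (@le_trans _ _ (\int[tuple_measure mu n]_t
    ((p / lambda) `^ p * (expR (lambda * Z t) + expR (- lambda * Z t)))%:E)%E).
  apply: ge0_le_integral => //.
  - apply/measurable_EFinP; apply: (measurableT_comp (measurable_powR _)).
    exact: measurableT_comp.
  - apply/measurable_EFinP; apply: measurable_funM => //.
    by apply: measurable_funD; exact: mE.
  - by move=> t _; rewrite lee_fin pw.
under eq_integral do rewrite EFinM EFinD.
rewrite ge0_integralZl//; last 3 first.
- apply: emeasurable_funD; apply/measurable_EFinP; exact: mE.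
- by move=> t _; rewrite adde_ge0// lee_fin expR_ge0.
- by rewrite lee_fin powR_ge0.
rewrite ge0_integralD//; last 2 first.
- by apply/measurable_EFinP; exact: mE.
- by apply/measurable_EFinP; exact: mE.
rewrite -mulrA EFinM lee_wpmul2l ?lee_fin ?powR_ge0//.
rewrite mulrDl mul1r EFinD leeD// bound ?normrN// gtr0_norm//.
Qed.

End exponential_moment.

(** * Integration against the law of an observation *)

Section law_integral.
Local Open Scope ereal_scope.
Context {R : realType} {d : nat} (f : simplex_density R d).

Import HBNNSimple.

(** The law is defined by integrals of the density over sets, so that the formula
    holds for simple functions, and monotone convergence extends it. *)
Lemma ge0_integral_law (g : 'rV[R]_d -> \bar R) :
  measurable_fun setT g -> (forall x, 0 <= g x) ->
  \int[law f]_x g x = \int[lebesgue_rV]_(x in simplex d) (g x * (f x)%:E).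
Proof.
move=> mg g0.
have mS : measurable (simplex d : set 'rV[R]_d) := measurable_simplex.
have mf : measurable_fun (simplex d) (fun x => (f x)%:E).
  by apply/measurable_EFinP; exact: measurable_density.
have f0 x : simplex d x -> 0 <= (f x)%:E.
  by move=> Sx; rewrite lee_fin density_ge0.
pose g_ := nnsfun_approx measurableT mg.
have mg_ n D : measurable_fun D (fun x => (g_ n x)%:E).
  by apply/measurable_EFinP; exact: measurable_funTS.
have -> : \int[law f]_x g x = limn (fun n => \int[law f]_x (g_ n x)%:E).
  rewrite -monotone_convergence//.
  - apply: eq_integral => x _; apply/esym/cvg_lim => //.
    exact: cvg_nnsfun_approx.
  - by move=> n y _; rewrite lee_fin.
  - by move=> y _ m n mn; rewrite lee_fin; exact/lefP/nd_nnsfun_approx.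
have -> : \int[lebesgue_rV]_(x in simplex d) (g x * (f x)%:E) =
   limn (fun n => \int[lebesgue_rV]_(x in simplex d) ((g_ n x)%:E * (f x)%:E)).
  rewrite -monotone_convergence//.
  - apply: eq_integral => x /[!inE] Sx; apply/esym/cvg_lim => //.
    apply: cvgeZr => //; exact: cvg_nnsfun_approx.
  - by move=> n; exact: emeasurable_funM.
  - by move=> n y Sy; rewrite mule_ge0 ?f0// lee_fin.
  - move=> y Sy m n mn; rewrite lee_wpmul2r ?f0// lee_fin.
    exact/lefP/nd_nnsfun_approx.
congr (limn _); apply/funext => n.
under eq_integral do rewrite fimfunE -fsumEFin//.
rewrite ge0_integral_fsum//; last 2 first.
- by move=> y; exact/measurable_EFinP/measurable_funM.
- by move=> y x _; rewrite nnfun_muleindic_ge0.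
have -> : \int[lebesgue_rV]_(x in simplex d) ((g_ n x)%:E * (f x)%:E) =
  \int[lebesgue_rV]_(x in simplex d) (\sum_(y \in range (g_ n))
     (y * \1_(g_ n @^-1` [set y]) x)%:E * (f x)%:E).
  apply: eq_integral => x _; rewrite fimfunE -fsumEFin//.
  rewrite ge0_mule_fsuml// => r.
  by rewrite nnfun_muleindic_ge0.
rewrite ge0_integral_fsum//; last 2 first.
- by move=> y; apply: emeasurable_funM => //; exact/measurable_EFinP/measurable_funM.
- by move=> y x Sx; rewrite mule_ge0 ?f0// nnfun_muleindic_ge0.
apply: eq_fsbigr => r _.
have [r0|r0] := ltP r 0%R.
  rewrite (_ : g_ n @^-1` [set r] = set0) ?preimage_nnfun0//.
  rewrite !integral0_eq// => x _; by rewrite indic0 mulr0 ?mul0e.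
have mA : measurable (g_ n @^-1` [set r]) by [].
under eq_integral do rewrite EFinM.
rewrite ge0_integralZl//; last exact/measurable_EFinP.
rewrite integral_indic// setIT.
under [RHS]eq_integral do rewrite EFinM -muleA.
rewrite ge0_integralZl//; last 2 first.
- by apply: emeasurable_funM => //; exact/measurable_EFinP.
- by move=> x Sx; rewrite mule_ge0 ?f0// lee_fin.
congr (_ * _); transitivity (\int[lebesgue_rV]_(y in
    (g_ n @^-1` [set r]) `&` simplex d) (f y)%:E) => //.
rewrite setIC integral_mkcondr.
apply: eq_integral => x _; rewrite patchE indicE.
by case: ifPn; rewrite ?mul1e ?mul0e.
Qed.

End law_integral.

(** * Affine changes of variables *)

Section affine_line.
Local Open Scope ereal_scope.
Context {R : realType}.
Local Notation leb := (@lebesgue_measure R).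

Section scale.
Variables (c a : R).
Hypothesis c0 : (0 < c)%R.

Let MR := measurableTypeR R.
Let phi (x : MR) : MR := (a + c * x)%R.
Let psi (x : MR) : MR := ((x - a) / c)%R.

Let mphi : measurable_fun setT phi.
Proof. by apply: measurable_funD => //; exact: measurable_funM. Qed.

Let mpsi : measurable_fun setT psi.
Proof. by apply: measurable_funM => //; exact: measurable_funB. Qed.

Let phiK : cancel phi psi.
Proof. by move=> x; rewrite /psi /phi; field; rewrite gt_eqF. Qed.

Let nu : {measure set MR -> \bar R} :=
  mscale (NngNum (ltW c0)) (image_measure mphi mpsi phiK leb).

Let lebesgue_measure_affine (A : set R) : measurable A -> leb A = nu A.
Proof.
move=> mA; apply: lebesgue_measure_unique => //= _ [[x y]] _ <- /=.
rewrite /nu /mscale/= /image_measure /pushforward/=.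
rewrite (_ : phi @^-1` `]x, y] = `](x - a) / c, (y - a) / c]%classic)%R; last first.
  by apply/seteqP; split => z /=; rewrite !in_itv/= /phi
    ltr_pdivrMr// ler_pdivlMr// ltrBlDl lerBrDl [(z * c)%R]mulrC.
rewrite !lebesgue_measure_itv/= !lte_fin ltr_pM2r ?invr_gt0//.
rewrite ltrD2r; case: ifPn => _; last by rewrite mule0.
rewrite -!EFinD -EFinM; congr (_%:E); field; exact: lt0r_neq0.
Qed.

Lemma ge0_integral_affine_pos (f : R -> \bar R) : measurable_fun setT f ->
  (forall x, 0 <= f x) ->
  \int[leb]_x f x = c%:E * \int[leb]_x f (a + c * x)%R.
Proof.
move=> mf f0; transitivity (\int[nu]_x f x).
  by apply: eq_measure_integral => //= A mA _; exact: lebesgue_measure_affine.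
rewrite ge0_integral_mscale//=.
by congr (_ * _); rewrite ge0_integral_pushforward.
Qed.

End scale.

Lemma ge0_integral_opp (f : R -> \bar R) : measurable_fun setT f ->
  (forall x, 0 <= f x) -> \int[leb]_x f x = \int[leb]_x f (- x)%R.
Proof.
move=> mf f0.
transitivity (\int[pushforward leb (-%R : R -> measurableTypeR R)]_x f x).
  apply: eq_measure_integral => //= A mA _.
  exact/esym/lebesgue_measureN.
by rewrite ge0_integral_pushforward.
Qed.

Lemma ge0_integral_reflect (f : R -> \bar R) (a : R) : measurable_fun setT f ->
  (forall x, 0 <= f x) -> \int[leb]_x f x = \int[leb]_x f (a - x)%R.
Proof.
move=> mf f0; rewrite (ge0_integral_affine_pos a ltr01 mf)// mul1e.
rewrite (ge0_integral_opp (f := fun x => f (a + 1 * x)%R))//.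
  by under eq_integral do rewrite mul1r.
by apply: (measurableT_comp mf); exact: measurable_funD.
Qed.

End affine_line.

Section affine_space.
Local Open Scope ereal_scope.
Context {R : realType}.
Local Notation leb := (@lebesgue_measure R).

Let MR := measurableTypeR R.

Definition affine_tuple n (v l : 'I_n -> R) (t : n.-tuple MR) : n.-tuple MR :=
  [tuple (v i + l i * tnth t i)%R | i < n].

Lemma measurable_affine_tuple n (v l : 'I_n -> R) :
  measurable_fun [set: n.-tuple MR] (affine_tuple v l).
Proof.
apply/measurable_fun_tnthP => i.
rewrite (_ : _ \o _ = (fun t : n.-tuple MR => v i + l i * tnth t i)%R).
  apply: measurable_funD => //; apply: measurable_funM => //.
  exact: (@measurable_tnth _ MR n i).
by apply/funext => t /=; rewrite tnth_mktuple.
Qed.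

Lemma ge0_integral_affine_tuple n (v l : 'I_n -> R)
    (F : n.-tuple MR -> \bar R) :
  (forall i, (0 < l i)%R) ->
  @measurable_fun _ _ (n.-tuple MR) (\bar R) setT F -> (forall t, 0 <= F t) ->
  \int[tuple_measure leb n]_t F t =
  (\prod_(i < n) l i)%:E * \int[tuple_measure leb n]_t F (affine_tuple v l t).
Proof.
elim: n v l F => [|n IH] v l F l0 mF F0.
  rewrite big_ord0 mul1e !integral_tuple_measure0//.
    by congr F; apply: eq_from_tnth => -[].
  by apply: (measurableT_comp mF); exact: measurable_affine_tuple.
have mFa : @measurable_fun _ _ (n.+1.-tuple MR) (\bar R) setT
    (fun t => F (affine_tuple v l t)).
  by apply: (measurableT_comp mF); exact: measurable_affine_tuple.
rewrite !integral_tuple_measureS//.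
set v' := fun i => v (lift ord0 i); set l' := fun i => l (lift ord0 i).
have l'0 i : (0 < l' i)%R by exact: l0.
have mpr : measurable_fun setT (fun z : MR * n.-tuple MR =>
    F [tuple of z.1 :: affine_tuple v' l' z.2]).
  apply: (measurableT_comp mF).
  apply: measurable_cons => //.
  exact: (measurableT_comp (measurable_affine_tuple v' l')).
have mG : measurable_fun setT (fun x : MR =>
    \int[tuple_measure leb n]_t F [tuple of x :: affine_tuple v' l' t]).
  exact: (measurable_fun_fubini_tonelli_F
    (fun z => F [tuple of z.1 :: affine_tuple v' l' z.2])).
have -> : \int[leb]_x \int[tuple_measure leb n]_t F [tuple of x :: t] =
   \int[leb]_x ((\prod_(i < n) l' i)%:E * \int[tuple_measure leb n]_t
       F [tuple of x :: affine_tuple v' l' t]).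
  apply: eq_integral => x _; apply: (IH v' l' (fun t => F [tuple of x :: t])) => //.
  apply: (measurableT_comp mF).
  exact: measurable_cons.
rewrite ge0_integralZl//; last 2 first.
- by move=> x _; exact: integral_ge0.
- by rewrite lee_fin prodr_ge0// => i _; exact: ltW.
rewrite (ge0_integral_affine_pos (v ord0) (l0 ord0)) //; last first.
  by move=> x; exact: integral_ge0.
rewrite muleA -EFinM [X in X%:E * _]mulrC big_ord_recl; congr (_ * _).
apply: eq_integral => x _; apply: eq_integral => t _; congr F.
apply: eq_from_tnth => i; rewrite tnth_mktuple.
have [->|[j ->]] : i = ord0 \/ exists j, i = lift ord0 j.
- by case: (unliftP ord0 i) => [j ->|->]; [right; exists j|left].
- by rewrite /=.
- by rewrite !tnthS tnth_mktuple.
Qed.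

Context {d : nat}.

Lemma measurable_row_of_tuple :
  measurable_fun [set: d.-tuple MR] (fun t => \row_i tnth t i : 'rV[R]_d).
Proof. exact: measurable_rV_of_tuple. Qed.

Lemma integral_lebesgue_rV (F : 'rV[R]_d -> \bar R) :
  measurable_fun setT F -> (forall x, 0 <= F x) ->
  \int[lebesgue_rV]_x F x = \int[tuple_measure leb d]_t F (\row_i tnth t i).
Proof.
move=> mF F0.
by rewrite [LHS](ge0_integral_pushforward (@measurable_rV_of_tuple R d)
  (tuple_measure leb d)).
Qed.

Lemma ge0_integral_affine (v l : 'rV[R]_d) (F : 'rV[R]_d -> \bar R) :
  (forall i, (0 < l ord0 i)%R) ->
  measurable_fun setT F -> (forall x, 0 <= F x) ->
  \int[lebesgue_rV]_x F x = (\prod_(i < d) l ord0 i)%:E *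
    \int[lebesgue_rV]_w F (v + \row_i (l ord0 i * w ord0 i))%R.
Proof.
move=> l0 mF F0.
have mA : measurable_fun setT
   (fun w : 'rV[R]_d => (v + \row_i (l ord0 i * w ord0 i))%R).
  apply: measurable_fun_rV => i; under eq_fun do rewrite !mxE.
  apply: measurable_funD => //; apply: measurable_funM => //.
  exact: measurable_coord.
rewrite !integral_lebesgue_rV//; last exact: (measurableT_comp mF mA).
rewrite (@ge0_integral_affine_tuple _ (v ord0) (l ord0) (fun t => F (\row_i tnth t i)))//.
  congr (_ * _); apply: eq_integral => t _; congr F.
  by apply/rowP => i; rewrite !mxE tnth_mktuple.
exact: (measurableT_comp mF measurable_row_of_tuple).
Qed.

End affine_space.

(** * The Dirichlet integral *)

Section gamma_function.
Local Open Scope ereal_scope.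
Context {R : realType}.
Local Notation leb := (@lebesgue_measure R).
Implicit Types u v t r : R.

(** The power t ^ (u - 1) cut off at the negative numbers: in this form the beta
    integral says that these functions are closed under convolution. *)
Definition cut_pow u t : R := (if 0 <= t then t `^ (u - 1) else 0)%R.

Lemma cut_pow_ge0 u t : (0 <= cut_pow u t)%R.
Proof. by rewrite /cut_pow; case: ifPn => // _; exact: powR_ge0. Qed.

Lemma measurable_cut_pow u : measurable_fun setT (cut_pow u).
Proof.
apply: measurable_fun_ifT => //=.
exact: measurable_fun_ler.
Qed.

Lemma cut_powM u r t : (0 < r)%R -> cut_pow u (r * t) = (r `^ (u - 1) * cut_pow u t)%R.
Proof.
move=> r0; rewrite /cut_pow pmulr_rge0//; case: ifPn => t0; last by rewrite mulr0.
by rewrite powRM// ltW.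
Qed.

Lemma cut_pow_le1 u t : (1 <= u)%R -> (t <= 1)%R -> (cut_pow u t <= 1)%R.
Proof.
move=> u1 t1; rewrite /cut_pow; case: ifPn => // t0.
rewrite [leRHS](_ : _ = 1 `^ (u - 1))%R; last by rewrite powR1.
by rewrite ge0_ler_powR ?nnegrE// subr_ge0.
Qed.

Lemma cut_pow1 t : cut_pow 1 t = (0 <= t)%R%:R.
Proof. by rewrite /cut_pow subrr powRr0; case: ifPn. Qed.

Lemma cut_pow_lt0 u t : (t < 0)%R -> cut_pow u t = 0%R.
Proof. by move=> t0; rewrite /cut_pow leNgt t0. Qed.

Lemma cut_pow0 u : (1 < u)%R -> cut_pow u 0%R = 0%R.
Proof. by move=> u1; rewrite /cut_pow lexx powR0// subr_eq0 gt_eqF. Qed.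

Definition egamma u := \int[leb]_t (cut_pow u t * expR (- t))%:E.

Definition ebeta u v := \int[leb]_t (cut_pow u t * cut_pow v (1 - t))%:E.

Lemma gammaE u : gamma u = fine (egamma u).
Proof.
rewrite /gamma /Rintegral; congr fine.
rewrite integral_itv_obnd_cbnd; last first.
  apply/measurable_EFinP; apply: measurable_funTS; apply: measurable_funM => //.
  by apply: measurableT_comp => //; exact: oppr_measurable.
rewrite integral_mkcond; apply: eq_integral => t _; rewrite patchE mem_setE in_itv/= andbT.
by rewrite /cut_pow; case: ifPn => // _; rewrite mul0r.
Qed.

Lemma measurable_cut_powM2 u v r :
  measurable_fun setT (fun t => cut_pow u t * cut_pow v (r - t))%R.
Proof.
apply: measurable_funM; first exact: measurable_cut_pow.
apply: (measurableT_comp (measurable_cut_pow v)).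
exact: measurable_funB.
Qed.

Lemma ebetaC u v : ebeta u v = ebeta v u.
Proof.
rewrite /ebeta (ge0_integral_reflect 1); last 2 first.
- by apply/measurable_EFinP; exact: measurable_cut_powM2.
- by move=> x; rewrite lee_fin mulr_ge0// cut_pow_ge0.
by apply: eq_integral => t _; rewrite subKr mulrC.
Qed.

Lemma ebeta_ge0 u v : 0 <= ebeta u v.
Proof.
by apply: integral_ge0 => t _; rewrite lee_fin mulr_ge0// cut_pow_ge0.
Qed.

Lemma ebeta_fin_num u v : (1 <= u)%R -> (1 <= v)%R -> ebeta u v \is a fin_num.
Proof.
move=> u1 v1; rewrite ge0_fin_numE ?ebeta_ge0//.
apply: (@le_lt_trans _ _ (\int[leb]_t (\1_(`[0%R, 1%R]%classic : set R) t)%:E)).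
  apply: ge0_le_integral => //.
  - by move=> t _; rewrite lee_fin mulr_ge0// cut_pow_ge0.
  - by apply/measurable_EFinP; exact: measurable_cut_powM2.
  - by apply/measurable_EFinP.
  - move=> t _; rewrite lee_fin indicE mem_setE in_itv/=.
    have [t0|t0] := leP 0%R t; last by rewrite cut_pow_lt0// mul0r.
    have [t1|t1] := leP t 1%R; last first.
      by rewrite (@cut_pow_lt0 v) ?subr_lt0// mulr0.
    rewrite -[leRHS]mulr1 ler_pM ?cut_pow_ge0 ?cut_pow_le1//.
    by rewrite gerBl.
rewrite integral_indic// setIT /= lebesgue_measure_itv/= lte_fin ltr01.
by rewrite -EFinB ltry.
Qed.

(** The convolution is homogeneous, so that it is a multiple of a power, and the
    multiple is found at 1. *)
Lemma cut_pow_conv u v r : (1 <= u)%R -> (1 <= v)%R ->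
  \int[leb]_t (cut_pow u t * cut_pow v (r - t))%:E =
  ebeta u v * (cut_pow (u + v) r)%:E.
Proof.
move=> u1 v1; have [r0|r0|->] := ltgtP r 0%R.
- rewrite (cut_pow_lt0 _ r0) mule0 integral0_eq// => t _.
  have [t0|t0] := leP 0%R t; last by rewrite cut_pow_lt0// mul0r.
  by rewrite (@cut_pow_lt0 v) ?subr_lt0 ?(lt_le_trans r0 t0)// mulr0.
- rewrite (ge0_integral_affine_pos 0 r0); last 2 first.
  + by apply/measurable_EFinP; exact: measurable_cut_powM2.
  + by move=> t; rewrite lee_fin mulr_ge0// cut_pow_ge0.
  rewrite [X in _ * X](_ : _ = (r `^ (u - 1) * r `^ (v - 1))%:E * ebeta u v).
    rewrite muleA -EFinM [LHS]muleC; congr (_ * _%:E).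
    apply/esym; transitivity (r `^ (1 + (u - 1) + (v - 1)))%R.
      by rewrite /cut_pow (ltW r0); congr (_ `^ _)%R; ring.
    have rD x y : (r `^ (x + y) = r `^ x * r `^ y)%R.
      by rewrite powRD// (gt_eqF r0) implybT.
    by rewrite (rD _ (v - 1)%R) (rD 1%R) powRr1 ?(ltW r0)// mulrA.
  rewrite /ebeta -ge0_integralZl//; last 3 first.
  + by apply/measurable_EFinP; exact: measurable_cut_powM2.
  + by move=> t _; rewrite lee_fin mulr_ge0// cut_pow_ge0.
  + by rewrite lee_fin mulr_ge0 ?powR_ge0.
  apply: eq_integral => t _; rewrite -EFinM; congr (_%:E).
  rewrite add0r (_ : r - r * t = r * (1 - t))%R; last by ring.
  by rewrite !cut_powM//; ring.
- rewrite (@cut_pow0 (u + v)%R) ?mule0; last by lra.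
  have -> : \int[leb]_t (cut_pow u t * cut_pow v (0 - t))%:E =
      \int[leb]_t ((cut_pow u 0 * cut_pow v 0)%:E * (\1_([set 0%R] : set R) t)%:E).
    apply: eq_integral => t _; rewrite indicE -EFinM.
    have [->|t0] := eqVneq t 0%R; first by rewrite subr0 mem_set// mulr1.
    rewrite memNset ?mulr0; last by move=> /= te; rewrite te eqxx in t0.
    move: t0; rewrite neq_lt => /orP[t0|t0].
      by rewrite cut_pow_lt0// mul0r.
    by rewrite (@cut_pow_lt0 v) ?sub0r ?oppr_lt0// mulr0.
  rewrite ge0_integralZl//; last 2 first.
  + exact/measurable_EFinP.
  + by rewrite lee_fin mulr_ge0 ?cut_pow_ge0.
  by rewrite integral_indic// setIT [X in _ * X]lebesgue_measure_set1 mule0.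
Qed.

Lemma egamma_ge0 u : 0 <= egamma u.
Proof.
by apply: integral_ge0 => t _; rewrite lee_fin mulr_ge0 ?cut_pow_ge0 ?expR_ge0.
Qed.

Lemma measurable_gamma_integrand u :
  measurable_fun setT (fun t => cut_pow u t * expR (- t))%R.
Proof.
apply: measurable_funM; first exact: measurable_cut_pow.
by apply: measurableT_comp => //; exact: oppr_measurable.
Qed.

(** The beta integral: both sides are the integral of exp (- r) against the
    convolution of the two powers. *)
Lemma egammaM u v : (1 <= u)%R -> (1 <= v)%R ->
  egamma u * egamma v = ebeta u v * egamma (u + v).
Proof.
move=> u1 v1.
have mF : measurable_fun setT (fun z : measurableTypeR R * measurableTypeR R =>
    (cut_pow u z.1 * cut_pow v (z.2 - z.1) * expR (- z.2))%:E).
  apply/measurable_EFinP; apply: measurable_funM; last first.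
    apply: measurableT_comp => //.
    exact: measurableT_comp.
  apply: measurable_funM; first exact: (measurableT_comp (measurable_cut_pow u)).
  apply: (measurableT_comp (measurable_cut_pow v)).
  exact: measurable_funB.
have F0 (z : measurableTypeR R * measurableTypeR R) :
    0 <= (cut_pow u z.1 * cut_pow v (z.2 - z.1) * expR (- z.2))%:E.
  by rewrite lee_fin !mulr_ge0 ?cut_pow_ge0 ?expR_ge0.
transitivity (\int[leb]_x \int[leb]_z
    (cut_pow u x * cut_pow v (z - x) * expR (- z))%:E).
  rewrite /egamma -ge0_integralZr//; last 3 first.
  - by apply/measurable_EFinP; exact: measurable_gamma_integrand.
  - by move=> t _; rewrite lee_fin mulr_ge0 ?cut_pow_ge0 ?expR_ge0.
  - exact: egamma_ge0.
  apply: eq_integral => x _.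
  rewrite (ge0_integral_affine_pos (- x) ltr01); last 2 first.
  - by apply/measurable_EFinP; exact: measurable_gamma_integrand.
  - by move=> t; rewrite lee_fin mulr_ge0 ?cut_pow_ge0 ?expR_ge0.
  rewrite mul1e -ge0_integralZl//; last 3 first.
  - apply: (measurableT_comp (f := fun t => (cut_pow v t * expR (- t))%:E)).
      by apply/measurable_EFinP; exact: measurable_gamma_integrand.
    by apply: measurable_funD => //; exact: measurable_funM.
  - by move=> t _; rewrite lee_fin mulr_ge0 ?cut_pow_ge0 ?expR_ge0.
  - by rewrite lee_fin mulr_ge0 ?cut_pow_ge0 ?expR_ge0.
  apply: eq_integral => z _; rewrite -EFinM; congr (_%:E).
  rewrite mul1r addrC opprB expRD; have := expRxMexpNx_1 x.
  by move: (expR x) (expR (- x)) => a b ab; rewrite -[RHS]mulr1 -ab; ring.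
rewrite (fubini_tonelli (fun z : measurableTypeR R * measurableTypeR R =>
    (cut_pow u z.1 * cut_pow v (z.2 - z.1) * expR (- z.2))%:E) mF F0) /=.
rewrite /egamma -ge0_integralZl//; last 3 first.
- by apply/measurable_EFinP; exact: measurable_gamma_integrand.
- by move=> t _; rewrite lee_fin mulr_ge0 ?cut_pow_ge0 ?expR_ge0.
- exact: ebeta_ge0.
apply: eq_integral => z _.
under eq_integral do rewrite EFinM.
rewrite ge0_integralZr//; last 2 first.
- by apply/measurable_EFinP; exact: measurable_cut_powM2.
- by move=> t _; rewrite lee_fin mulr_ge0 ?cut_pow_ge0.
by rewrite cut_pow_conv// EFinM muleA.
Qed.

Lemma egamma1 : egamma 1 = 1.
Proof.
rewrite -(@integral_exponential_pdf R 1 ltr01); apply: eq_integral => t _.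
rewrite cut_pow1 /exponential_pdf patchE mem_setE in_itv/= andbT.
by case: ifPn => _; rewrite ?mul0r// !mul1r mulN1r.
Qed.

Lemma integral_cut_pow01 v : (1 <= v)%R ->
  \int[leb]_(t in `[0%R, 1%R]) (t `^ (v - 1))%:E = (v^-1)%:E.
Proof.
rewrite le_eqVlt => /orP[/eqP <-|v1].
  under eq_integral do rewrite subrr powRr0.
  rewrite integral_cst// [X in _ * X]lebesgue_measure_itv/= lte_fin ltr01 invr1 mul1e.
  by rewrite -EFinB subr0.
have v0 : (0 < v)%R by lra.
have cpow a x : (0 < x)%R -> {for x, continuous (fun t : R => t `^ a)%R}.
  move=> x0; apply: differentiable_continuous; apply/derivable1_diffP.
  by apply: derivable_powR; rewrite in_itv/= x0.
have cont a : (0 < a)%R -> {within `[0%R, 1%R], continuous (fun t : R => t `^ a)%R}.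
  move=> a0; apply/continuous_within_itvP => //; split.
  - by move=> x; rewrite in_itv/= => /andP[x0 _]; exact: cpow.
  - rewrite powR0 ?gt_eqF//; exact: powR_cvg0.
  - by apply: cvg_at_left_filter; exact: cpow.
rewrite (@continuous_FTC2 _ _ (fun t : R => v^-1 * t `^ v)%R)//.
- by rewrite powR1 powR0 ?gt_eqF// mulr0 mulr1 -EFinB subr0.
- by apply: cont; rewrite subr_gt0.
- split.
  + move=> x; rewrite in_itv/= => /andP[x0 _]; apply: derivableM => //.
    by apply: derivable_powR; rewrite in_itv/= x0.
  + apply: cvgM; first exact: cvg_cst.
    rewrite powR0 ?gt_eqF//; exact: powR_cvg0.
  + apply: cvgM; first exact: cvg_cst.
    by apply: cvg_at_left_filter; exact: cpow.
- move=> x; rewrite in_itv/= => /andP[x0 _].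
  rewrite derive1E deriveM//=; last first.
    by apply: derivable_powR; rewrite in_itv/= x0.
  have dpow := is_derive1_powR v x0.
  rewrite derive_cst scaler0 addr0 derive_val /GRing.scale/= mulKf// gt_eqF//.
Qed.

Lemma ebeta1 v : (1 <= v)%R -> ebeta 1 v = (v^-1)%:E.
Proof.
move=> v1; rewrite ebetaC -integral_cut_pow01// integral_mkcond.
apply: eq_integral => t _; rewrite cut_pow1 patchE mem_setE in_itv/= subr_ge0.
rewrite /cut_pow; case: (0 <= t)%R => /=; last by rewrite mul0r.
by case: (t <= 1)%R; rewrite ?mulr1 ?mulr0.
Qed.

Lemma egammaS v : (1 <= v)%R -> egamma (v + 1) = v%:E * egamma v.
Proof.
move=> v1; have v0 : (0 < v)%R by lra.
have := egammaM (lexx 1%R) v1; rewrite egamma1 mul1e ebeta1// => ->.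
by rewrite muleA -EFinM divff ?gt_eqF// mul1e addrC.
Qed.

(** The recursion gives the integer parameters, and t ^ (u - 1) is at most
    1 + t ^ n on the positive half-line when u - 1 <= n. *)
Lemma egamma_fin_num u : (1 <= u)%R -> egamma u \is a fin_num.
Proof.
move=> u1.
have fn n : egamma n.+1%:R \is a fin_num.
  elim: n => [|n IH]; first by rewrite egamma1.
  rewrite -[n.+2]addn1 natrD egammaS ?fin_numM//.
  by rewrite ler1n.
pose n := Num.bound u.
have un : (u <= n%:R)%R.
  by apply: ltW; apply: le_lt_trans (archi_boundP _); [exact: lexx|lra].
rewrite ge0_fin_numE ?egamma_ge0//.
apply: (@le_lt_trans _ _ (egamma 1 + egamma n.+1%:R)); last first.
  by rewrite lte_add_pinfty// -ge0_fin_numE ?egamma_ge0// egamma1.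
rewrite /egamma -ge0_integralD//; last 4 first.
- by move=> t _; rewrite lee_fin mulr_ge0 ?cut_pow_ge0 ?expR_ge0.
- by apply/measurable_EFinP; exact: measurable_gamma_integrand.
- by move=> t _; rewrite lee_fin mulr_ge0 ?cut_pow_ge0 ?expR_ge0.
- by apply/measurable_EFinP; exact: measurable_gamma_integrand.
apply: ge0_le_integral => //.
- by move=> t _; rewrite lee_fin mulr_ge0 ?cut_pow_ge0 ?expR_ge0.
- by apply/measurable_EFinP; exact: measurable_gamma_integrand.
- by apply: emeasurable_funD; apply/measurable_EFinP; exact: measurable_gamma_integrand.
move=> t _; rewrite -EFinD lee_fin -mulrDl ler_wpM2r ?expR_ge0//.
have [t1|t1] := leP t 1%R.
  have [t0|t0] := leP 0%R t; last first.
    by rewrite (@cut_pow_lt0 u)// addr_ge0// cut_pow_ge0.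
  by rewrite (le_trans (cut_pow_le1 u1 t1))// cut_pow1 t0 lerDl cut_pow_ge0.
rewrite (@le_trans _ _ (cut_pow n.+1%:R t))// ?lerDr ?cut_pow_ge0//.
rewrite /cut_pow; case: ifPn => // _; apply: ler_powR; first exact: ltW.
by rewrite -natr1; lra.
Qed.

Lemma egamma_gt0 u : (1 <= u)%R -> 0 < egamma u.
Proof.
move=> u1.
apply: (@lt_le_trans _ _ (\int[leb]_t ((expR (- 2))%:E * (\1_(`[1%R, 2%R]%classic : set R) t)%:E))).
  rewrite ge0_integralZl//; last exact/measurable_EFinP.
  rewrite integral_indic// setIT /= lebesgue_measure_itv/= lte_fin ltr1n.
  by rewrite -EFinB -EFinM lte_fin mulr_gt0 ?expR_gt0//; lra.
apply: ge0_le_integral => //.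
- apply: emeasurable_funM => //; exact/measurable_EFinP.
- by apply/measurable_EFinP; exact: measurable_gamma_integrand.
move=> t _; rewrite -EFinM lee_fin indicE mem_setE in_itv/=.
have [/andP[t1 t2]|_] := boolP (1 <= t <= 2)%R; last first.
  by rewrite mulr0 mulr_ge0 ?cut_pow_ge0 ?expR_ge0.
rewrite mulrC ler_pM ?expR_ge0 ?ler_expR ?lerN2//.
rewrite /cut_pow (le_trans ler01 t1) -[leLHS](powRr0 t).
by apply: ler_powR => //; rewrite subr_ge0.
Qed.

Lemma EFin_gamma u : (1 <= u)%R -> (gamma u)%:E = egamma u.
Proof. by move=> u1; rewrite gammaE fineK// egamma_fin_num. Qed.

Lemma gamma_gt0 u : (1 <= u)%R -> (0 < gamma u)%R.
Proof. by move=> u1; rewrite -lte_fin EFin_gamma// egamma_gt0. Qed.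

Lemma gammaS u : (1 <= u)%R -> gamma (u + 1) = (u * gamma u)%R.
Proof.
move=> u1; apply: EFin_inj; rewrite EFinM !EFin_gamma ?egammaS//.
by lra.
Qed.

Lemma gamma1 : @gamma R 1 = 1%R.
Proof. by rewrite gammaE egamma1. Qed.

Lemma ebetaE u v : (1 <= u)%R -> (1 <= v)%R ->
  ebeta u v = (gamma u * gamma v / gamma (u + v))%:E.
Proof.
move=> u1 v1; have uv1 : (1 <= u + v)%R by lra.
have := egammaM u1 v1; rewrite -!EFin_gamma// -(fineK (ebeta_fin_num u1 v1)).
rewrite -!EFinM => -[->]; congr (_%:E).
by rewrite mulfK// gt_eqF// gamma_gt0.
Qed.

End gamma_function.

(* Otherwise unification unfolds the integral that defines the function. *)
Local Opaque gamma.

Section dirichlet_integral.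
Local Open Scope ereal_scope.
Context {R : realType}.
Local Notation leb := (@lebesgue_measure R).
Let MR := measurableTypeR R.

Lemma measurable_dirichlet_tuple n (u : 'I_n -> R) (v r : R) :
  measurable_fun [set: n.-tuple MR] (fun t : n.-tuple MR =>
    (\prod_(i < n) cut_pow (u i) (tnth t i)
       * cut_pow v (r - \sum_(i < n) tnth t i))%R).
Proof.
apply: measurable_funM.
  apply: (measurable_tuple_prod (g := fun i => cut_pow (u i) : MR -> R)) => i.
  exact: measurable_cut_pow.
apply: (measurableT_comp (measurable_cut_pow v)); apply: measurable_funB => //.
exact: (measurable_tuple_sum (g := fun i => (id : MR -> R))).
Qed.

(** Integrating one coordinate after the other, each integral is a convolution of
    two cut-off powers; keeping the total mass r as a parameter makes the induction
    go through. *)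
Lemma integral_dirichlet_tuple n (u : 'I_n -> R) (v r : R) :
  (forall i, (1 <= u i)%R) -> (1 <= v)%R ->
  \int[tuple_measure leb n]_t (\prod_(i < n) cut_pow (u i) (tnth t i)
       * cut_pow v (r - \sum_(i < n) tnth t i))%:E =
  ((\prod_(i < n) gamma (u i)) * gamma v / gamma (v + \sum_(i < n) u i)
    * cut_pow (v + \sum_(i < n) u i) r)%:E.
Proof.
move=> u1 v1; elim: n u r u1 => [|n IH] u r u1.
  rewrite integral_tuple_measure0; last first.
    by apply/measurable_EFinP; exact: measurable_dirichlet_tuple.
  by rewrite !big_ord0 subr0 addr0 !mul1r divff ?mul1r// gt_eqF// gamma_gt0.
have D0 k (u' : 'I_k -> R) r' (t : k.-tuple MR) :
    (0 <= \prod_(i < k) cut_pow (u' i) (tnth t i)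
       * cut_pow v (r' - \sum_(i < k) tnth t i))%R.
  by rewrite mulr_ge0 ?cut_pow_ge0 ?prodr_ge0// => i _; exact: cut_pow_ge0.
rewrite integral_tuple_measureS; last 2 first.
- by apply/measurable_EFinP; exact: measurable_dirichlet_tuple.
- by move=> t; rewrite lee_fin.
pose u' i := u (lift ord0 i).
have u'1 i : (1 <= u' i)%R by exact: u1.
pose S := (v + \sum_(i < n) u' i)%R.
have S1 : (1 <= S)%R.
  by rewrite (le_trans v1)// lerDl sumr_ge0// => i _; rewrite (le_trans ler01).
pose C := ((\prod_(i < n) gamma (u' i)) * gamma v / gamma S)%R.
have C0 : (0 <= C)%R.
  rewrite divr_ge0 ?mulr_ge0 ?prodr_ge0 ?ltW ?gamma_gt0// => i _.
  by rewrite ltW ?gamma_gt0.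
transitivity (\int[leb]_x (C%:E * (cut_pow (u ord0) x * cut_pow S (r - x))%:E)).
  apply: eq_integral => x _.
  transitivity ((cut_pow (u ord0) x)%:E *
    \int[tuple_measure leb n]_t (\prod_(i < n) cut_pow (u' i) (tnth t i)
       * cut_pow v ((r - x) - \sum_(i < n) tnth t i))%:E).
    rewrite -ge0_integralZl//; last 3 first.
    - by apply/measurable_EFinP; exact: measurable_dirichlet_tuple.
    - by move=> t _; rewrite lee_fin.
    - by rewrite lee_fin cut_pow_ge0.
    apply: eq_integral => t _; rewrite -EFinM !big_ord_recl mulrA.
    congr ((_ * _ * cut_pow v _)%:E).
      by apply: eq_bigr => i _; rewrite tnthS.
    rewrite opprD addrA; congr (_ - _)%R.
    by apply: eq_bigr => i _; rewrite tnthS.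
  by rewrite IH// -!EFinM; congr (_%:E); rewrite -/S -/C; ring.
rewrite ge0_integralZl//; last 2 first.
- by apply/measurable_EFinP; exact: measurable_cut_powM2.
- by move=> x _; rewrite lee_fin mulr_ge0 ?cut_pow_ge0.
rewrite cut_pow_conv// ebetaE//.
have -> : (v + \sum_(i < n.+1) u i)%R = (u ord0 + S)%R.
  by rewrite big_ord_recl /S; ring.
rewrite -!EFinM big_ord_recl -/(u' _) /C; congr (_%:E); field.
by rewrite !gt_eqF ?gamma_gt0//; have := u1 ord0; lra.
Qed.

End dirichlet_integral.

Section dirichlet_density_theory.
Context {R : realType} {d : nat}.
Implicit Types (u s x : 'rV[R]_d) (v : R).

Lemma norm1_simplex s : (forall i, 0 <= s ord0 i) ->
  norm1 s = \sum_(i < d) s ord0 i.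
Proof. by move=> s0; apply: eq_bigr => i _; rewrite ger0_norm. Qed.

Lemma simplexP s : simplex d s <->
  (forall i, 0 <= s ord0 i) /\ \sum_(i < d) s ord0 i <= 1.
Proof.
split=> [[s01 s1]|[s0 s1]].
  have s0 i : 0 <= s ord0 i by have /andP[] := s01 i.
  by split => //; rewrite -norm1_simplex.
split; last by rewrite norm1_simplex.
move=> i; rewrite s0 (le_trans _ s1)// (bigD1 i)//= lerDl.
by rewrite sumr_ge0.
Qed.

Lemma measurable_norm1 : measurable_fun setT (@norm1 R d).
Proof.
apply: measurable_sum => i; apply: measurableT_comp => //.
exact: measurable_coord.
Qed.

Lemma measurable_dirichlet_density u v :
  measurable_fun setT (dirichlet_density u v).
Proof.
apply: measurable_funM.
  apply: measurable_funM => //; apply: (measurableT_comp (measurable_powR _)).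
  by apply: measurable_funB => //; exact: measurable_norm1.
apply: measurable_prod => i _; apply: (measurableT_comp (measurable_powR _)).
exact: measurable_coord.
Qed.

Lemma dirichlet_density_ge0 u v x : (forall i, 1 <= u ord0 i) -> 1 <= v ->
  0 <= dirichlet_density u v x.
Proof.
move=> u1 v1; rewrite !mulr_ge0 ?powR_ge0//; last first.
- by apply: prodr_ge0 => i _; exact: powR_ge0.
- rewrite invr_ge0 mulr_ge0 ?prodr_ge0 ?ltW ?gamma_gt0// => i _.
  by rewrite ltW ?gamma_gt0.
- rewrite ltW// gamma_gt0// (le_trans v1)// lerDl sumr_ge0// => i _.
  by rewrite (le_trans ler01).
Qed.

(** The cut-off powers vanish outside the simplex, so that the integral over the
    simplex becomes one over the whole space. *)
Lemma dirichlet_density_cut u v x :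
  (dirichlet_density u v \_ (simplex d)) x =
  gamma (v + \sum_(i < d) u ord0 i)
    / (gamma v * \prod_(i < d) gamma (u ord0 i))
  * (\prod_(i < d) cut_pow (u ord0 i) (x ord0 i)
     * cut_pow v (1 - \sum_(i < d) x ord0 i)).
Proof.
rewrite patchE; case: ifPn => [|xS].
  rewrite inE => /simplexP[x0 x1]; rewrite /dirichlet_density norm1_simplex//.
  rewrite /(cut_pow v) subr_ge0 x1 -mulrA; congr (_ * _).
  by rewrite mulrC; congr (_ * _); apply: eq_bigr => i _; rewrite /cut_pow x0.
have [[i xi]|x0] := pselect (exists i, x ord0 i < 0).
  by rewrite [\prod_(j < d) cut_pow _ _](bigD1 i)//= cut_pow_lt0// !(mul0r, mulr0).
rewrite (@cut_pow_lt0 _ v) ?mulr0// subr_lt0 ltNge; apply/negP => x1.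
move/negP : xS; apply; rewrite inE; apply/simplexP; split=> // i.
by rewrite leNgt; apply/negP => xi; apply: x0; exists i.
Qed.

Lemma integral_dirichlet_density u v : (forall i, 1 <= u ord0 i) -> 1 <= v ->
  (\int[lebesgue_rV]_(x in simplex d) (dirichlet_density u v x)%:E = 1)%E.
Proof.
move=> u1 v1.
have gS : 0 < gamma (v + \sum_(i < d) u ord0 i).
  rewrite gamma_gt0// (le_trans v1)// lerDl sumr_ge0// => i _.
  by rewrite (le_trans ler01).
have gP : 0 < \prod_(i < d) gamma (u ord0 i).
  by rewrite prodr_gt0// => i _; rewrite gamma_gt0.
have gv := gamma_gt0 v1.
rewrite integral_mkcond integral_lebesgue_rV; last 2 first.
- apply/(measurable_restrictT _ _).1; first exact: measurable_simplex.
  apply/measurable_EFinP; apply: measurable_funTS.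
  exact: measurable_dirichlet_density.
- by move=> x; rewrite patchE; case: ifPn => // _; rewrite lee_fin dirichlet_density_ge0.
have E (t : d.-tuple (measurableTypeR R)) :
    (dirichlet_density u v \_ (simplex d)) (\row_i tnth t i) =
    gamma (v + \sum_(i < d) u ord0 i)
      / (gamma v * \prod_(i < d) gamma (u ord0 i))
    * (\prod_(i < d) cut_pow (u ord0 i) (tnth t i)
       * cut_pow v (1 - \sum_(i < d) tnth t i)).
  rewrite dirichlet_density_cut; congr (_ * (_ * cut_pow v (1 - _))).
    by apply: eq_bigr => i _; rewrite mxE.
  by apply: eq_bigr => i _; rewrite mxE.
rewrite (eq_integral (fun t : d.-tuple (measurableTypeR R) =>
    ((gamma (v + \sum_(i < d) u ord0 i)
      / (gamma v * \prod_(i < d) gamma (u ord0 i)))%:E *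
     (\prod_(i < d) cut_pow (u ord0 i) (tnth t i)
       * cut_pow v (1 - \sum_(i < d) tnth t i))%:E)%E)); last first.
  by move=> t _; rewrite -EFinM -E !patchE; case: ifPn.
rewrite ge0_integralZl//; last 3 first.
- apply/measurable_EFinP.
  exact: (@measurable_dirichlet_tuple R d (fun i => u ord0 i) v 1).
- move=> t _; rewrite lee_fin mulr_ge0 ?cut_pow_ge0 ?prodr_ge0// => i _.
  exact: cut_pow_ge0.
- by rewrite lee_fin divr_ge0 ?mulr_ge0 ?ltW.
rewrite (@integral_dirichlet_tuple R d (fun i => u ord0 i) v 1)// -EFinM.
rewrite /cut_pow ler01 powR1; congr (_%:E).
have alg (a b p : R) : 0 < a -> 0 < b -> 0 < p ->
    a / (b * p) * (p * b / a * 1) = 1.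
  by move=> *; field; rewrite !gt_eqF.
exact: alg.
Qed.

(** Multiplying by a coordinate raises the corresponding parameter by one, which
    gives all the moments from the normalisation. *)
Lemma dirichlet_density_coord u v x i : (forall j, 1 <= u ord0 j) -> 1 <= v ->
  simplex d x ->
  x ord0 i * dirichlet_density u v x =
  u ord0 i / (v + \sum_(j < d) u ord0 j)
    * dirichlet_density (u + delta_mx ord0 i) v x.
Proof.
move=> u1 v1 /simplexP[x0 _].
pose S := v + \sum_(j < d) u ord0 j.
have S1 : 1 <= S.
  rewrite (le_trans v1)// lerDl sumr_ge0// => j _.
  by rewrite (le_trans ler01).
have e j : (u + delta_mx ord0 i) ord0 j = u ord0 j + (j == i)%:R.
  by rewrite !mxE eqxx.
have eS : v + \sum_(j < d) (u + delta_mx ord0 i) ord0 j = S + 1.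
  rewrite (eq_bigr _ (fun j _ => e j)) big_split/= addrA; congr (_ + _).
  by rewrite (bigD1 i)//= eqxx big1 ?addr0// => j /negbTE ->.
have eG : \prod_(j < d) gamma ((u + delta_mx ord0 i) ord0 j) =
    u ord0 i * \prod_(j < d) gamma (u ord0 j).
  rewrite (bigD1 i)//= [in RHS](bigD1 i)//= e eqxx gammaS// mulrA; congr (_ * _).
  by apply: eq_bigr => j /negbTE ji; rewrite e ji addr0.
have eP : \prod_(j < d) x ord0 j `^ ((u + delta_mx ord0 i) ord0 j - 1) =
    x ord0 i * \prod_(j < d) x ord0 j `^ (u ord0 j - 1).
  rewrite (bigD1 i)//= [in RHS](bigD1 i)//= e eqxx mulrA; congr (_ * _).
    by rewrite addrK mulr_powRB1// (lt_le_trans ltr01).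
  by apply: eq_bigr => j /negbTE ji; rewrite e ji addr0.
rewrite /dirichlet_density eS eG eP gammaS// -/S.
have gv := gamma_gt0 v1.
have gP : 0 < \prod_(j < d) gamma (u ord0 j).
  by rewrite prodr_gt0// => j _; rewrite gamma_gt0.
have ui : 0 < u ord0 i by rewrite (lt_le_trans ltr01).
have Sgt0 : 0 < S by exact: lt_le_trans ltr01 _.
have alg (a b p w G A B y : R) : 0 < b -> 0 < p -> 0 < w -> 0 < a ->
    y * (G / (b * p) * B * A) = w / a * (a * G / (b * (w * p)) * B * (y * A)).
  by move=> *; field; rewrite !gt_eqF.
exact: alg.
Qed.

Lemma integral_dirichlet_coord u v i : (forall j, 1 <= u ord0 j) -> 1 <= v ->
  (\int[lebesgue_rV]_(x in simplex d) (x ord0 i * dirichlet_density u v x)%:E =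
   (u ord0 i / (v + \sum_(j < d) u ord0 j))%:E)%E.
Proof.
move=> u1 v1.
have S0 : 0 <= v + \sum_(j < d) u ord0 j.
  rewrite addr_ge0//; first exact: le_trans ler01 _.
  by apply: sumr_ge0 => j _; exact: le_trans ler01 _.
have u'1 j : 1 <= (u + delta_mx ord0 i) ord0 j.
  by rewrite !mxE (le_trans (u1 j))// lerDl ler0n.
under eq_integral => x /[!inE] xS do rewrite dirichlet_density_coord// EFinM.
rewrite ge0_integralZl//.
- by rewrite integral_dirichlet_density// mule1.
- exact: measurable_simplex.
- apply/measurable_EFinP; apply: measurable_funTS.
  exact: measurable_dirichlet_density.
- by move=> x _; rewrite lee_fin dirichlet_density_ge0.
- by rewrite lee_fin divr_ge0// (le_trans ler01).
Qed.

Lemma integral_dirichlet_coord2 u v i : (forall j, 1 <= u ord0 j) -> 1 <= v ->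
  (\int[lebesgue_rV]_(x in simplex d) (x ord0 i ^+ 2 * dirichlet_density u v x)%:E =
   (u ord0 i / (v + \sum_(j < d) u ord0 j)
     * ((u ord0 i + 1) / (v + \sum_(j < d) u ord0 j + 1)))%:E)%E.
Proof.
move=> u1 v1.
have S0 : 0 <= v + \sum_(j < d) u ord0 j.
  rewrite addr_ge0//; first exact: le_trans ler01 _.
  by apply: sumr_ge0 => j _; exact: le_trans ler01 _.
have u'1 j : 1 <= (u + delta_mx ord0 i) ord0 j.
  by rewrite !mxE (le_trans (u1 j))// lerDl ler0n.
under eq_integral => x /[!inE] xS.
  rewrite exprS expr1 -mulrA dirichlet_density_coord// mulrCA EFinM; over.
rewrite ge0_integralZl//.
- rewrite integral_dirichlet_coord// -EFinM; congr ((_ * (_ / _))%:E).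
    by rewrite !mxE !eqxx.
  rewrite -addrA; congr (_ + _).
  under eq_bigr do rewrite !mxE eqxx.
  rewrite big_split/=; congr (_ + _).
  by rewrite (bigD1 i)//= eqxx big1 ?addr0// => j /negbTE ->.
- exact: measurable_simplex.
- apply/measurable_EFinP; apply: measurable_funTS; apply: measurable_funM.
    exact: measurable_coord.
  exact: measurable_dirichlet_density.
- move=> x /simplexP[x0 _]; rewrite lee_fin mulr_ge0 ?dirichlet_density_ge0//.
- by rewrite lee_fin divr_ge0// (le_trans ler01).
Qed.

End dirichlet_density_theory.

(** * The risk as an iterated integral *)

Section risk_integral.
Local Open Scope ereal_scope.
Context {R : realType} {d n : nat}.
Variables (p : R) (f : simplex_density R d).
Variable fhat : n.-tuple 'rV[R]_d -> 'rV[R]_d -> R.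
Hypothesis p1 : (1 <= p)%R.
Hypothesis mfhat : is_estimator fhat.

Local Notation Omega := (@sample_space R d n).
Local Notation leb := (@lebesgue_rV R d).
Local Notation P := (tuple_measure (law f) n).

Lemma measurable_sample_space : measurable Omega.
Proof.
rewrite (_ : Omega = \bigcap_(i in [set: 'I_n])
    ((@tnth _ 'rV[R]_d ^~ i) @^-1` simplex d)).
  apply: fin_bigcap_measurable; first exact: finite_finset.
  move=> i _; rewrite -[X in measurable X]setTI.
  by apply: measurable_tnth => //; exact: measurable_simplex.
by apply/seteqP; split=> t /= H i; [move=> _; exact: H|exact: (H i Logic.I)].
Qed.

Lemma law_simplex : law f (simplex d) = 1.
Proof. by rewrite /law setIid integral_density. Qed.

Lemma tuple_law_sample_space : P Omega = 1.
Proof.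
rewrite (tuple_measure_box (law f) (A := fun=> simplex d)).
  by rewrite big1// => i _; exact: law_simplex.
by move=> i; exact: measurable_simplex.
Qed.

Lemma tuple_lawT : P setT = 1.
Proof. by apply: tuple_measureT; exact: probability_setT. Qed.

Lemma integral_sample_space (g : n.-tuple 'rV[R]_d -> \bar R) :
  measurable_fun setT g -> (forall X, 0 <= g X) ->
  \int[P]_(X in Omega) g X = \int[P]_X g X.
Proof.
move=> mg g0; have mO := measurable_sample_space.
have PC : P (~` Omega) = 0.
  have := measureU P mO (measurableC mO) (setICr Omega).
  rewrite setUv => PE.
  have : 1 + P (~` Omega) = 1.
    by rewrite -{1}tuple_law_sample_space -[RHS]tuple_lawT PE.
  have := measure_ge0 P (~` Omega); case: (P (~` Omega)) => [r| |]//= _.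
  by rewrite -EFinD => -[h]; have -> : r = 0%R by lra.
rewrite -(setUv Omega) ge0_integral_setU//=; last 3 first.
- exact: measurableC.
- by rewrite setUv.
- by rewrite disj_set2E setICr.
rewrite [X in _ = _ + X]null_set_integral ?adde0//.
- exact: measurableC.
- exact: measurable_funTS.
Qed.

Let loss (z : n.-tuple 'rV[R]_d * 'rV[R]_d) : \bar R :=
  (`|fhat z.1 z.2 - f z.2| `^ p)%:E.

Let D : set (n.-tuple ('rV[R]_d) * 'rV[R]_d) := Omega `*` simplex d.

Let mD : measurable D.
Proof.
by apply: measurableX; [exact: measurable_sample_space|exact: measurable_simplex].
Qed.

Let mloss : measurable_fun setT (loss \_ D).
Proof.
apply/(measurable_restrictT _ _).1 => //; apply/measurable_EFinP.
apply: (measurableT_comp (measurable_powR _)).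
apply: measurableT_comp => //; apply: measurable_funB => //.
move=> _ Y mY.
rewrite (_ : D `&` _ = Omega `*` (simplex d `&` f @^-1` Y)).
  apply: measurableX; first exact: measurable_sample_space.
  by apply: measurable_density => //; exact: measurable_simplex.
by apply/seteqP; split => -[X s] /=; rewrite /D /=; tauto.
Qed.

Let loss_ge0 z : 0 <= (loss \_ D) z.
Proof. by rewrite patchE; case: ifPn => // _; rewrite lee_fin powR_ge0. Qed.

Let restrict_loss X s : (loss \_ D) (X, s) =
  ((fun X => (loss (X, s)) * (\1_(simplex d) s)%:E) \_ Omega) X.
Proof.
rewrite !patchE indicE /D; case: (boolP (X \in Omega)) => [XO|XO].
  case: (boolP (s \in simplex d)) => sS.
    by rewrite mem_set ?mule1//; split; apply: set_mem.
  rewrite memNset ?mule0// => -[_ /= sS'].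
  by rewrite mem_set in sS.
by rewrite memNset// => -[/= XO' _]; rewrite mem_set in XO.
Qed.

Definition mean_loss s : \bar R :=
  \int[P]_(X in Omega) (`|fhat X s - f s| `^ p)%:E.

Let mean_lossE s : \int[P]_X (loss \_ D) (X, s) = (mean_loss \_ (simplex d)) s.
Proof.
under eq_integral do rewrite restrict_loss.
rewrite -integral_mkcond patchE indicE; case: ifPn => sS.
  by apply: eq_integral => X _; rewrite mule1.
by rewrite integral0_eq// => X _; rewrite mule0.
Qed.

Lemma measurable_mean_loss : measurable_fun (simplex d) mean_loss.
Proof.
apply/measurable_restrictT; first exact: measurable_simplex.
have := measurable_fun_fubini_tonelli_G (m1 := P) _ mloss loss_ge0.
by congr measurable_fun; apply/funext => s; rewrite -mean_lossE.
Qed.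

Lemma mean_loss_ge0 s : 0 <= mean_loss s.
Proof. by apply: integral_ge0 => X _; rewrite lee_fin powR_ge0. Qed.

(** By the theorem of Tonelli the risk is determined by the mean loss at each
    point, where the estimator is a function of the sample only. *)
Lemma riskE : risk p fhat f =
  (\int[leb]_(s in simplex d) mean_loss s) `^ p^-1.
Proof.
have p0 : p != 0%R by rewrite gt_eqF// (lt_le_trans ltr01).
rewrite /risk; congr (_ `^ _).
transitivity (\int[P]_X \int[leb]_s (loss \_ D) (X, s)).
  rewrite integral_mkcond; apply: eq_integral => X _; rewrite patchE.
  case: ifPn => [XO|XO]; last first.
    by rewrite integral0_eq// => s _; rewrite restrict_loss patchE (negbTE XO).
  rewrite poweR_Lnorm//; apply: eq_integral => s _.
  rewrite restrict_loss [in RHS]patchE XO [in LHS]patchE indicE; case: ifPn => sS.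
    by rewrite mule1.
  by rewrite /= normr0 powR0// mule0.
rewrite (fubini_tonelli _ mloss loss_ge0) [RHS]integral_mkcond.
by apply: eq_integral => s _; rewrite -mean_lossE.
Qed.

(** By Young's inequality y <= e + e ^ (1 - p) * y ^ p, a lower bound for the mean
    absolute error on a set of positive volume bounds the risk from below for
    every exponent. *)
Lemma risk_ge (A : set 'rV[R]_d) (e V : R) :
  measurable A -> A `<=` simplex d -> (0 < e)%R -> (0 < V <= 1)%R ->
  leb A = V%:E ->
  (forall s, A s -> e%:E <= \int[P]_X (`|fhat X s - f s|)%:E) ->
  (forall s, A s -> measurable_fun [set: n.-tuple 'rV[R]_d] (fhat ^~ s)) ->
  (e * V / 3)%:E <= risk p fhat f.
Proof.
move=> mA AS e0 /andP[V0 V1] AV eA mfs.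
have p0 : (0 < p)%R by exact: lt_le_trans ltr01 p1.
have eps0 : (0 < e * V / 3)%R by rewrite divr_gt0// mulr_gt0.
rewrite leNgt; apply/negP => rlt.
set eps := (e * V / 3)%R in rlt eps0.
have Ilt : \int[leb]_(s in simplex d) mean_loss s <= (eps `^ p)%:E.
  have pN0 : p != 0%R by rewrite gt_eqF.
  have I0 : 0 <= \int[leb]_(s in simplex d) mean_loss s.
    by apply: integral_ge0 => s _; exact: mean_loss_ge0.
  rewrite -(poweRe1 I0) -(mulVf pN0) poweRrM// -poweR_EFin -riskE.
  apply: (gt0_ler_poweR (ltW p0)); last exact: ltW.
  - by rewrite in_itv/= riskE poweR_ge0 leey.
  - by rewrite in_itv/= lee_fin ltW ?leey.
have key s : A s -> e%:E <= eps%:E + (eps `^ (1 - p))%:E * mean_loss s.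
  move=> As; apply: (le_trans (eA s As)).
  have mg : measurable_fun [set: n.-tuple 'rV[R]_d] (fun X => `|fhat X s - f s|)%R.
    apply: measurableT_comp => //; apply: measurable_funB => //; exact: mfs.
  have mgp : measurable_fun [set: n.-tuple 'rV[R]_d]
      (fun X => (`|fhat X s - f s| `^ p)%:E).
    by apply/measurable_EFinP; exact: (measurableT_comp (measurable_powR _) mg).
  rewrite /mean_loss integral_sample_space//.
  rewrite -ge0_integralZl//; last by rewrite lee_fin powR_ge0.
  have -> : eps%:E = \int[P]_X (cst eps%:E X).
    by rewrite integral_cst// [X in _ * X]tuple_lawT mule1.
  rewrite -ge0_integralD//; last 3 first.
  - by move=> X _; rewrite lee_fin ltW.
  - by move=> X _; rewrite -EFinM lee_fin mulr_ge0 ?powR_ge0.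
  - exact: measurable_funeM.
  apply: ge0_le_integral => //.
  - exact/measurable_EFinP.
  - by apply: emeasurable_funD => //; exact: measurable_funeM.
  move=> X _; rewrite /= -EFinM -EFinD lee_fin.
  set y := (`|_ - _|)%R; have y0 : (0 <= y)%R by exact: normr_ge0.
  have [ye|ye] := leP y eps.
    by rewrite (le_trans ye)// lerDl mulr_ge0 ?powR_ge0.
  rewrite -[leLHS]add0r lerD ?(ltW eps0)//.
  have yp : (y = y `^ (1 - p) * y `^ p)%R.
    rewrite -powRD; last by rewrite subrK oner_eq0.
    by rewrite subrK powRr1.
  rewrite {1}yp ler_wpM2r ?powR_ge0//.
  rewrite -(opprB p) !powRN lef_pV2 ?posrE ?powR_gt0//; last exact: lt_trans ye.
  by rewrite ge0_ler_powR ?nnegrE ?subr_ge0 ?(ltW eps0)// ltW.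
have : (e * V)%:E <= (eps * V + eps)%:E.
  have -> : (e * V)%:E = \int[leb]_(s in A) (cst e%:E s).
    by rewrite integral_cst// [X in _ * X]AV.
  have mlA : measurable_fun A mean_loss.
    by apply: measurable_funS measurable_mean_loss => //; exact: measurable_simplex.
  apply: (@le_trans _ _ (\int[leb]_(s in A)
      (eps%:E + (eps `^ (1 - p))%:E * mean_loss s))).
    apply: ge0_le_integral => //.
    - by move=> x _; rewrite lee_fin ltW.
    - by apply: emeasurable_funD => //; exact: measurable_funeM.
  rewrite ge0_integralD//; last 3 first.
  - by move=> x _; rewrite lee_fin ltW.
  - by move=> x _; rewrite mule_ge0 ?lee_fin ?powR_ge0 ?mean_loss_ge0.
  - exact: measurable_funeM.
  rewrite integral_cst// [X in _ * X + _]AV EFinD leeD//.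
  rewrite ge0_integralZl//; last 2 first.
  - by move=> s _; exact: mean_loss_ge0.
  - by rewrite lee_fin powR_ge0.
  have -> : eps%:E = (eps `^ (1 - p))%:E * (eps `^ p)%:E.
    rewrite -EFinM -powRD; last by rewrite subrK oner_eq0.
    by rewrite subrK powRr1 ?ltW.
  rewrite lee_wpmul2l ?lee_fin ?powR_ge0// (le_trans _ Ilt)//.
  apply: ge0_subset_integral => //; first exact: measurable_simplex.
  - exact: measurable_mean_loss.
  - by move=> s _; exact: mean_loss_ge0.
rewrite lee_fin; have : (e * V = 3 * eps)%R by rewrite /eps; field.
move=> ->; have : (eps * V <= eps)%R by rewrite ler_piMr// ltW.
lra.
Qed.

Lemma lebesgue_simplex_le1 : leb (simplex d) <= 1.
Proof.
apply: (@le_trans _ _ (leb [set s : 'rV[R]_d | forall i, (0 <= s ord0 i <= 1)%R])).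
  apply: le_measure; rewrite ?inE//.
  - exact: measurable_simplex.
  - rewrite (_ : [set s | _] = (\bigcap_(i in [set: 'I_d])
        ((fun s : 'rV[R]_d => s ord0 i) @^-1` `[0%R, 1%R]))).
      apply: fin_bigcap_measurable => [|i _]; first exact: finite_finset.
      by rewrite -[X in measurable X]setTI; apply: measurable_coord.
    apply/seteqP; split=> s /= H i; first by move=> _; have := H i; rewrite ?in_itv/=.
    by have := H i Logic.I; rewrite ?in_itv/=.
  - by move=> s [].
rewrite (@lebesgue_rV_box R d (fun=> 0%R) (fun=> 1%R))//.
by rewrite big1// => i _; rewrite subr0.
Qed.

(** The simplex has volume at most 1, so that a uniform bound of the pointwise
    loss is a bound of the risk. *)
Lemma risk_le (A : set 'rV[R]_d) (e : R) :
  measurable A -> A `<=` simplex d -> leb (simplex d `\` A) = 0 ->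
  (0 <= e)%R ->
  (forall s, A s -> mean_loss s <= (e `^ p)%:E) ->
  risk p fhat f <= e%:E.
Proof.
move=> mA AS A0 e0 bound.
have p0 : (0 < p)%R by exact: lt_le_trans ltr01 p1.
have mS : measurable (simplex d : set 'rV[R]_d) := measurable_simplex.
have mSA : measurable (simplex d `\` A) by exact: measurableD.
rewrite riskE.
have -> : e%:E = (e `^ p)%:E `^ p^-1.
  by rewrite poweR_EFin -powRrM divff ?gt_eqF// powRr1.
have pV0 : (0 <= p^-1)%R by rewrite invr_ge0 ltW.
apply: (gt0_ler_poweR pV0).
- rewrite in_itv/= leey andbT; apply: integral_ge0 => s _.
  exact: mean_loss_ge0.
- by rewrite in_itv/= lee_fin powR_ge0 leey.
have -> : \int[leb]_(s in simplex d) mean_loss s = \int[leb]_(s in A) mean_loss s.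
  have SE : simplex d = A `|` (simplex d `\` A).
    apply/seteqP; split=> s; last by case=> [/AS|[]].
    by move=> Ss; have [?|?] := pselect (A s); [left|right].
  rewrite SE ge0_integral_setU//=; last 3 first.
  - by rewrite -SE; exact: measurable_mean_loss.
  - by move=> s _; exact: mean_loss_ge0.
  - by apply/disj_setPS => s [As []].
  rewrite [X in _ + X]null_set_integral ?adde0//.
  by apply: measurable_funS measurable_mean_loss => //; exact: subDsetl.
apply: (@le_trans _ _ (\int[leb]_(s in A) cst (e `^ p)%:E s)).
  apply: ge0_le_integral => //.
  - by move=> s _; exact: mean_loss_ge0.
  - exact: measurable_funS measurable_mean_loss.
rewrite integral_cst// -[leRHS]mule1 lee_wpmul2l ?lee_fin ?powR_ge0//.
rewrite (le_trans _ lebesgue_simplex_le1)//.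
by apply: le_measure; rewrite ?inE.
Qed.

End risk_integral.

(** * Measurability of the Dirichlet kernel estimator *)

Section kde_measurable.
Context {R : realType}.

Lemma measurable_fun_powR d (T : measurableType d) (f g : T -> R) :
  measurable_fun setT f -> measurable_fun setT g ->
  measurable_fun setT (fun x => f x `^ g x).
Proof.
move=> mf mg; rewrite /powR; apply: measurable_fun_ifT => //.
- exact: measurable_fun_eqr.
- by apply: measurableT_comp => //; exact: measurable_fun_eqr.
- apply: measurableT_comp => //; apply: measurable_funM => //.
  exact: measurableT_comp.
Qed.

(** The parameters of the Dirichlet kernel vary with the point, so that an
    estimator that is jointly measurable in the sample and the point requires the
    measurability of the normalising constant in the parameters. *)
Lemma measurable_gamma : measurable_fun setT (@gamma R).
Proof.
rewrite (_ : @gamma R = fun x => fine (egamma x)); last first.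
  by apply/funext => x; rewrite gammaE.
apply: measurableT_comp => //.
apply: (measurable_fun_fubini_tonelli_F (m2 := @lebesgue_measure R)
  (fun z : R * measurableTypeR R => (cut_pow z.1 z.2 * expR (- z.2))%:E)).
- apply/measurable_EFinP; apply: measurable_funM; last first.
    by apply: measurableT_comp => //; exact: measurableT_comp.
  apply: measurable_fun_ifT => //; first exact: measurable_fun_ler.
  by apply: measurable_fun_powR => //; exact: measurable_funB.
- by move=> z; rewrite lee_fin mulr_ge0 ?cut_pow_ge0 ?expR_ge0.
Qed.

Lemma gamma_ge0 (x : R) : 0 <= gamma x.
Proof. by rewrite gammaE fine_ge0// egamma_ge0. Qed.

Lemma measurable_fun_dirichlet_density d0 (T : measurableType d0) d
    (u x : T -> 'rV[R]_d) (v : T -> R) :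
  measurable_fun setT u -> measurable_fun setT v -> measurable_fun setT x ->
  measurable_fun setT (fun t => dirichlet_density (u t) (v t) (x t)).
Proof.
move=> mu mv mx.
have mi (w : T -> 'rV[R]_d) i : measurable_fun setT w ->
    measurable_fun setT (fun t => w t ord0 i).
  by move=> mw; exact: (measurableT_comp (measurable_coord i) mw).
apply: measurable_funM; last first.
  apply: measurable_prod => i _; apply: measurable_fun_powR; first exact: mi.
  by apply: measurable_funB => //; exact: mi.
apply: measurable_funM; last first.
  apply: measurable_fun_powR; apply: measurable_funB => //.
  exact: (measurableT_comp measurable_norm1).
apply: measurable_funM.
  apply: (measurableT_comp measurable_gamma); apply: measurable_funD => //.
  by apply: measurable_sum => i; exact: mi.
have gp0 t : 0 <= gamma (v t) * \prod_(i < d) gamma (u t ord0 i).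
  by rewrite mulr_ge0 ?gamma_ge0 ?prodr_ge0// => i _; exact: gamma_ge0.
under eq_fun do rewrite -powR_inv1//.
apply: (measurableT_comp (measurable_powR _)).
apply: measurable_funM; first exact: (measurableT_comp measurable_gamma).
apply: measurable_prod => i _.
by apply: (measurableT_comp measurable_gamma); exact: mi.
Qed.

Variables (d : nat) (b : R).

Definition dirichlet_kernel (s : 'rV[R]_d) : 'rV[R]_d -> R :=
  dirichlet_density (b^-1 *: s + const_mx 1) ((1 - norm1 s) / b + 1).

Lemma measurable_dirichlet_kde n : measurable_fun setT
  (fun z : n.-tuple 'rV[R]_d * 'rV[R]_d => dirichlet_kde b z.1 z.2).
Proof.
have ms : measurable_fun setT (fun z : n.-tuple 'rV[R]_d * 'rV[R]_d => z.2).
  exact: measurable_snd.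
apply: measurable_funM => //; apply: measurable_sum => i.
apply: measurable_fun_dirichlet_density.
- apply: measurable_fun_rV => j; under eq_fun do rewrite !mxE.
  apply: measurable_funD => //; apply: measurable_funM => //.
  exact: (measurableT_comp (measurable_coord j) ms).
- apply: measurable_funD => //; apply: measurable_funM => //.
  apply: measurable_funB => //; exact: (measurableT_comp measurable_norm1 ms).
- exact: (measurableT_comp (@measurable_tnth _ 'rV[R]_d n i)).
Qed.

Lemma is_estimator_dirichlet_kde n : is_estimator (@dirichlet_kde R d n b).
Proof. by apply: measurable_funTS; exact: measurable_dirichlet_kde. Qed.

End kde_measurable.

Section real_integrals.
Context d (T : measurableType d) (R : realType) (mu : {measure set T -> \bar R}).
Variables (D : set T) (mD : measurable D).

Lemma ge0_integral_EFinD (f g : T -> R) :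
  measurable_fun D f -> (forall x, D x -> 0 <= f x) ->
  measurable_fun D g -> (forall x, D x -> 0 <= g x) ->
  (\int[mu]_(x in D) (f x + g x)%:E =
   \int[mu]_(x in D) (f x)%:E + \int[mu]_(x in D) (g x)%:E)%E.
Proof.
move=> mf f0 mg g0; under eq_integral do rewrite EFinD.
by rewrite ge0_integralD//; apply/measurable_EFinP.
Qed.

Lemma ge0_integral_EFinZl (k : R) (f : T -> R) :
  measurable_fun D f -> (forall x, D x -> 0 <= f x) -> 0 <= k ->
  (\int[mu]_(x in D) (k * f x)%:E = k%:E * \int[mu]_(x in D) (f x)%:E)%E.
Proof.
move=> mf f0 k0; under eq_integral do rewrite EFinM.
by rewrite ge0_integralZl//; apply/measurable_EFinP.
Qed.

End real_integrals.

(** * Moments of the Dirichlet kernel *)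

Section kernel_moments.
Context {R : realType} {d : nat} (b : R) (s : 'rV[R]_d).
Hypothesis b01 : 0 < b < 1.
Hypothesis sS : simplex d s.
Local Notation K := (dirichlet_kernel b s).
Local Notation D := (d%:R : R).

Let b0 : 0 < b. Proof. by case/andP: b01. Qed.

Let s0 i : 0 <= s ord0 i.
Proof. by have [] := (simplexP s).1 sS. Qed.

Let u1 i : 1 <= (b^-1 *: s + const_mx 1) ord0 i.
Proof. by rewrite !mxE lerDr mulr_ge0// invr_ge0 ltW. Qed.

Let v1 : 1 <= (1 - norm1 s) / b + 1.
Proof.
by rewrite lerDr divr_ge0 ?subr_ge0//; [case: sS|exact: ltW].
Qed.

Let uE i : (b^-1 *: s + const_mx 1) ord0 i = (s ord0 i + b) / b.
Proof. by rewrite !mxE; field; rewrite gt_eqF. Qed.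

Let SE : (1 - norm1 s) / b + 1 +
  \sum_(i < d) (b^-1 *: s + const_mx 1) ord0 i = (1 + (D + 1) * b) / b.
Proof.
under eq_bigr do rewrite !mxE.
rewrite big_split/= sumr_const card_ord -mulr_sumr norm1_simplex//.
by field; rewrite gt_eqF.
Qed.

Lemma dirichlet_kernel_ge0 x : 0 <= K x.
Proof. exact: dirichlet_density_ge0. Qed.

Lemma measurable_dirichlet_kernel : measurable_fun setT K.
Proof. exact: measurable_dirichlet_density. Qed.

Lemma integral_dirichlet_kernel :
  (\int[lebesgue_rV]_(x in simplex d) (K x)%:E = 1)%E.
Proof. exact: integral_dirichlet_density. Qed.

Lemma integral_dirichlet_kernel_coord i :
  (\int[lebesgue_rV]_(x in simplex d) (x ord0 i * K x)%:E =
   ((s ord0 i + b) / (1 + (D + 1) * b))%:E)%E.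
Proof.
rewrite integral_dirichlet_coord// SE uE; congr (_%:E).
have h : 0 < 1 + (D + 1) * b by rewrite addr_gt0// mulr_gt0// addr_gt0_ge0 ?ler0n.
by field; rewrite !gt_eqF.
Qed.

Lemma integral_dirichlet_kernel_coord2 i :
  (\int[lebesgue_rV]_(x in simplex d) (x ord0 i ^+ 2 * K x)%:E =
   ((s ord0 i + b) * (s ord0 i + 2 * b) /
    ((1 + (D + 1) * b) * (1 + (D + 2) * b)))%:E)%E.
Proof.
rewrite integral_dirichlet_coord2// SE uE; congr (_%:E).
have D0 : 0 <= D by rewrite ler0n.
have h1 : 0 < 1 + (D + 1) * b by rewrite addr_gt0// mulr_gt0//; lra.
have h2 : 0 < 1 + (D + 2) * b by rewrite addr_gt0// mulr_gt0//; lra.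
by field; rewrite !gt_eqF.
Qed.

(** The kernel centred at s is concentrated at a distance of s of the order of the
    square root of the bandwidth. *)
Lemma integral_dirichlet_kernel_dev i :
  (\int[lebesgue_rV]_(x in simplex d) ((x ord0 i - s ord0 i) ^+ 2 * K x)%:E <=
   (b * ((D + 1) * (D + 2) + 3))%:E)%E.
Proof.
have mS : measurable (simplex d : set 'rV[R]_d) := measurable_simplex.
have mi : measurable_fun (simplex d : set 'rV[R]_d) (fun x => x ord0 i).
  by apply: measurable_funTS; exact: measurable_coord.
have mK : measurable_fun (simplex d : set 'rV[R]_d) K.
  by apply: measurable_funTS; exact: measurable_dirichlet_kernel.
have x0 (x : 'rV[R]_d) : simplex d x -> 0 <= x ord0 i by move=> /simplexP[].
have K0 := dirichlet_kernel_ge0.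
have E2 := integral_dirichlet_kernel_coord2 i.
have E1 := integral_dirichlet_kernel_coord i.
have E0 := integral_dirichlet_kernel.
set I := (X in (X <= _)%E).
have mdev : measurable_fun (simplex d : set 'rV[R]_d)
    (fun x => (x ord0 i - s ord0 i) ^+ 2 * K x).
  by apply: measurable_funM => //; apply: measurable_funX; exact: measurable_funB.
have mxK : measurable_fun (simplex d : set 'rV[R]_d) (fun x => x ord0 i * K x).
  exact: measurable_funM.
have mx2K : measurable_fun (simplex d : set 'rV[R]_d) (fun x => x ord0 i ^+ 2 * K x).
  by apply: measurable_funM => //; exact: measurable_funX.
have dev0 x : simplex d x -> 0 <= (x ord0 i - s ord0 i) ^+ 2 * K x.
  by move=> _; rewrite mulr_ge0// sqr_ge0.
have xK0 (x : 'rV[R]_d) : simplex d x -> 0 <= x ord0 i * K x.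
  by move=> Sx; rewrite mulr_ge0// x0.
have x2K0 (x : 'rV[R]_d) : simplex d x -> 0 <= x ord0 i ^+ 2 * K x.
  by move=> _; rewrite mulr_ge0// sqr_ge0.
have sxK0 (x : 'rV[R]_d) : simplex d x -> 0 <= 2 * s ord0 i * (x ord0 i * K x).
  by move=> Sx; rewrite mulr_ge0 ?xK0// mulr_ge0.
have s2K0 (x : 'rV[R]_d) : simplex d x -> 0 <= s ord0 i ^+ 2 * K x.
  by move=> _; rewrite mulr_ge0// sqr_ge0.
have msxK : measurable_fun (simplex d : set 'rV[R]_d)
    (fun x => 2 * s ord0 i * (x ord0 i * K x)) by exact: measurable_funM.
have ms2K : measurable_fun (simplex d : set 'rV[R]_d)
    (fun x => s ord0 i ^+ 2 * K x) by exact: measurable_funM.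
have : (I + (2 * s ord0 i)%:E * ((s ord0 i + b) / (1 + (D + 1) * b))%:E =
   ((s ord0 i + b) * (s ord0 i + 2 * b) /
    ((1 + (D + 1) * b) * (1 + (D + 2) * b)))%:E + (s ord0 i ^+ 2)%:E * 1)%E.
  rewrite -E2 -E1 -{}E0 -!ge0_integral_EFinZl ?mulr_ge0 ?sqr_ge0//.
  rewrite -!ge0_integral_EFinD//.
  by apply: eq_integral => x _; congr (_%:E); ring.
have D0 : 0 <= D by rewrite ler0n.
have h1 : 1 <= 1 + (D + 1) * b by rewrite lerDl mulr_ge0 ?(ltW b0)//; lra.
have h2 : 1 <= 1 + (D + 2) * b by rewrite lerDl mulr_ge0 ?(ltW b0)//; lra.
have si1 : s ord0 i <= 1 by case: sS => /(_ i)/andP[].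
have [b0' b1] : 0 <= b /\ b <= 1 by case/andP: b01 => /ltW ? /ltW.
move: (s0 i) => si0.
rewrite mule1 -EFinM -EFinD.
have : (0 <= I)%E.
  by apply: integral_ge0 => x Sx; rewrite lee_fin dev0.
case: I => [r| |]// r0; rewrite -EFinD lee_fin => -[rE].
set q1 := 1 + (D + 1) * b in h1 rE.
set q2 := 1 + (D + 2) * b in h2 rE.
set si := s ord0 i in rE si0 si1.
have : r * (q1 * q2) = b * (si - si ^+ 2) + b ^+ 2 *
    (2 - 2 * si * (D + 2) + si ^+ 2 * ((D + 1) * (D + 2))).
  have -> : r = (si + b) * (si + 2 * b) / (q1 * q2) + si ^+ 2
               - 2 * si * ((si + b) / q1) by rewrite -rE; ring.
  have q10 : q1 != 0 by rewrite gt_eqF// (lt_le_trans ltr01).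
  have q20 : q2 != 0 by rewrite gt_eqF// (lt_le_trans ltr01).
  transitivity ((si + b) * (si + 2 * b) + si ^+ 2 * q1 * q2
    - 2 * si * (si + b) * q2); first by field; rewrite q10.
  by rewrite /q1 /q2; ring.
move=> rq.
have r_0 : 0 <= r by rewrite -lee_fin.
have : r <= r * (q1 * q2).
  by rewrite ler_peMr// (le_trans h1)// ler_peMr// (le_trans ler01).
rewrite rq => /le_trans; apply.
have si2 : si ^+ 2 <= 1 by rewrite exprn_ile1.
have DD : 0 <= (D + 1) * (D + 2) by rewrite mulr_ge0//; lra.
have t1 : b * (si - si ^+ 2) <= b.
  by rewrite -[leRHS]mulr1 ler_wpM2l//; have := sqr_ge0 si; lra.
have t2 : si ^+ 2 * ((D + 1) * (D + 2)) <= (D + 1) * (D + 2).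
  by rewrite -[leRHS]mul1r ler_wpM2r.
have t3 : 0 <= 2 * si * (D + 2) by rewrite !mulr_ge0//; lra.
rewrite [leRHS](_ : _ = b + b * ((D + 1) * (D + 2) + 2)); last by ring.
rewrite lerD// (@le_trans _ _ (b ^+ 2 * ((D + 1) * (D + 2) + 2)))//.
  by rewrite ler_wpM2l ?sqr_ge0//; lra.
rewrite ler_wpM2r ?addr_ge0//.
by rewrite expr2 ler_piMl.
Qed.

End kernel_moments.

(** * Affine densities *)

Section affine_densities.
Context {R : realType} {d : nat}.

Lemma derive_along_line (V : normedModType R) (f : V -> R) s v k :
  (forall h, f (h *: v + s) = f s + h * k) ->
  derivable f s v /\ 'D_v f s = k.
Proof.
move=> fE.
have C : h^-1 *: ((f \o shift s) (h *: v) - f s) @[h --> 0^'] --> (k : R^o).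
  apply: cvg_near_cst; near=> h.
  have h0 : h != 0 by near: h; exact: nbhs_dnbhs_neq.
  by rewrite /= fE addrC addKr /GRing.scale/= mulKf.
by split; [exact: cvgP C|exact: cvg_lim C].
Unshelve. all: by end_near. Qed.

Lemma derive_affine (i j : 'I_d) (c a : R) s :
  derivable (fun x : 'rV[R]_d => c + a * x ord0 i) s (delta_mx ord0 j) /\
  partial_along j (fun x : 'rV[R]_d => c + a * x ord0 i) s = a * (i == j)%:R.
Proof.
apply: derive_along_line => h; rewrite !mxE eqxx /=; ring.
Qed.

Lemma iter_partial_affine (i : 'I_d) (c a : R) w :
  exists c' a' : R, iter_partial w (fun x : 'rV[R]_d => c + a * x ord0 i) =
    (fun x => c' + a' * x ord0 i) /\
  ((0 < size w)%N -> a' = 0) /\ ((1 < size w)%N -> c' = 0).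
Proof.
elim: w => [|j w [c' [a' [wE [w1 w2]]]]]; first by exists c, a.
exists (a' * (i == j)%:R), 0; split; last first.
  by split=> // w0; rewrite w1 ?mul0r.
apply/funext => s; rewrite /= wE mul0r addr0.
by have [] := derive_affine i j c' a' s.
Qed.

Lemma has_iter_partial_affine (i : 'I_d) (c a : R) U w :
  has_iter_partial U w (fun x : 'rV[R]_d => c + a * x ord0 i).
Proof.
elim: w => //= j w IH; split=> // s _.
have [c' [a' [-> _]]] := iter_partial_affine i c a w.
by have [] := derive_affine i j c' a' s.
Qed.

Lemma size_mindex_dirs (gm : {ffun 'I_d -> nat}) :
  size (mindex_dirs gm) = (\sum_(i < d) gm i)%N.
Proof.
rewrite /mindex_dirs size_flatten /shape -map_comp sumnE big_map big_enum/=.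
by apply: eq_bigr => i _; rewrite size_nseq.
Qed.

Lemma hoelder_order_ge2 (beta : R) : 2 < beta -> (2 <= hoelder_order beta)%N.
Proof.
move=> b2; have t2 : (2 < (Num.truncn beta).+1)%N.
  by rewrite ltnS truncn_ge_nat ?ltW// (lt_trans _ b2).
exact: (@leq_bigmax_cond _ (fun l : 'I_(Num.truncn beta).+1 => (l%:R < beta)%R)
  (fun l => val l) (Ordinal t2)).
Qed.

Lemma hoelder_order_lt (beta : R) : 0 < beta -> (hoelder_order beta)%:R < beta.
Proof.
move=> b0; rewrite /hoelder_order.
by apply: (big_ind (fun l : nat => l%:R < beta)) => // x y xb yb;
  rewrite /maxn; case: ifP.
Qed.

(** The smoothness beta > 2 only constrains derivatives of order at least 2, so
    that affine functions belong to the class for every constant. *)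
Lemma hoelder_class_affine (beta L : R) (i : 'I_d) (c a : R) :
  2 < beta -> 0 <= L ->
  hoelder_class d beta L (fun x : 'rV[R]_d => c + a * x ord0 i).
Proof.
move=> b2 L0 gm gmE; split; first exact: has_iter_partial_affine.
move=> s t _ _; have [c' [a' [-> [w1 w2]]]] := iter_partial_affine i c a (mindex_dirs gm).
have sz : (1 < size (mindex_dirs gm))%N.
  by rewrite size_mindex_dirs gmE hoelder_order_ge2.
rewrite w1 ?w2//; last exact: ltn_trans sz.
by rewrite !mul0r subrr normr0 mulr_ge0 ?powR_ge0.
Qed.

(** The factorial of d, as the constant of the Dirichlet density with all
    parameters equal to 1. *)
Definition simplex_const : R := gamma (1 + d%:R).

Lemma simplex_const_gt0 : 0 < simplex_const.
Proof. by rewrite gamma_gt0// lerDl ler0n. Qed.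

Lemma dirichlet_density1 x :
  dirichlet_density (const_mx 1 : 'rV[R]_d) 1 x = simplex_const.
Proof.
rewrite /dirichlet_density; under eq_bigr do rewrite mxE.
rewrite sumr_const card_ord subrr powRr0 mulr1.
rewrite !big1 ?mulr1 => [|i _|i _].
- by rewrite gamma1 divr1.
- by rewrite mxE subrr powRr0.
- by rewrite mxE gamma1.
Qed.

Lemma integral_simplex_const :
  (\int[lebesgue_rV]_(x in simplex d) (simplex_const)%:E = 1)%E.
Proof.
have u1 i : 1 <= (const_mx 1 : 'rV[R]_d) ord0 i by rewrite mxE.
rewrite -(integral_dirichlet_density u1 (lexx 1)).
by apply: eq_integral => x _; rewrite dirichlet_density1.
Qed.

Definition uniform_fun (x : 'rV[R]_d) : R := simplex_const.

Lemma measurable_uniform_fun : measurable_fun (simplex d) uniform_fun.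
Proof. exact: measurable_cst. Qed.

Lemma uniform_fun_ge0 s : simplex d s -> 0 <= uniform_fun s.
Proof. by move=> _; exact: ltW simplex_const_gt0. Qed.

Definition uniform_density : simplex_density R d :=
  SimplexDensity measurable_uniform_fun uniform_fun_ge0 integral_simplex_const.

Variable i : 'I_d.

Definition linear_fun (x : 'rV[R]_d) : R := (d%:R + 1) * simplex_const * x ord0 i.

Lemma measurable_linear_fun : measurable_fun (simplex d) linear_fun.
Proof.
apply: measurable_funM => //; apply: measurable_funTS; exact: measurable_coord.
Qed.

Lemma linear_const_gt0 : 0 < (d%:R + 1) * simplex_const :> R.
Proof. by rewrite mulr_gt0 ?simplex_const_gt0// addr_gt0_ge0// ler0n. Qed.

Lemma linear_fun_ge0 s : simplex d s -> 0 <= linear_fun s.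
Proof.
by move=> /simplexP[s0 _]; rewrite mulr_ge0// ltW// linear_const_gt0.
Qed.

Lemma integral_linear_fun :
  (\int[lebesgue_rV]_(x in simplex d) (linear_fun x)%:E = 1)%E.
Proof.
have u1 j : 1 <= (const_mx 1 : 'rV[R]_d) ord0 j by rewrite mxE.
have mS : measurable (simplex d : set 'rV[R]_d) := measurable_simplex.
have d1 : 0 < d%:R + 1 :> R by rewrite ltr_pwDr// ler0n.
transitivity ((d%:R + 1)%:E * \int[lebesgue_rV]_(x in simplex d)
    (x ord0 i * dirichlet_density (const_mx 1 : 'rV[R]_d) 1 x)%:E)%E.
  rewrite -ge0_integral_EFinZl ?(ltW d1)//.
  - apply: eq_integral => x _; rewrite dirichlet_density1 /linear_fun.
    by congr (_%:E); ring.
  - apply: measurable_funTS; apply: measurable_funM; first exact: measurable_coord.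
    exact: measurable_dirichlet_density.
  - by move=> x /simplexP[x0 _]; rewrite mulr_ge0// dirichlet_density_ge0.
rewrite integral_dirichlet_coord// -EFinM; under eq_bigr do rewrite mxE.
rewrite sumr_const card_ord mxE; congr (_%:E); field.
by rewrite gt_eqF// addrC.
Qed.

Definition linear_density : simplex_density R d :=
  SimplexDensity measurable_linear_fun linear_fun_ge0 integral_linear_fun.

End affine_densities.

(** * Lower bounds for the error of the Dirichlet kernel estimator *)

Section kde_lower.
Context {R : realType} {d n : nat} (b : R) (s : 'rV[R]_d).
Hypothesis b01 : 0 < b < 1.
Hypothesis sS : simplex d s.
Hypothesis n0 : (0 < n)%N.
Local Notation K := (dirichlet_kernel b s).
Local Notation D := (d%:R : R).
Local Notation C0 := (@simplex_const R d).

Let mS : measurable (simplex d : set 'rV[R]_d) := measurable_simplex.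
Let mK : measurable_fun setT K := measurable_dirichlet_kernel b s.
Let K0 := dirichlet_kernel_ge0 b01 sS.

Lemma integral_law_kernel (f : simplex_density R d) :
  (\int[law f]_x (K x)%:E =
   \int[lebesgue_rV]_(x in simplex d) (K x * f x)%:E)%E.
Proof.
rewrite ge0_integral_law//; exact/measurable_EFinP.
Qed.

Lemma kde_errorE (f : simplex_density R d) (y : R) :
  (\int[tuple_measure (law f) n]_X (`|dirichlet_kde b X s - y|)%:E =
   (n%:R^-1)%:E * \int[tuple_measure (law f) n]_X
     (`|- (n%:R * y) + \sum_(i < n) K (tnth X i)|)%:E)%E.
Proof.
have n0' : 0 < n%:R :> R by rewrite ltr0n.
rewrite -ge0_integral_EFinZl ?invr_ge0 ?ler0n//.
- apply: eq_integral => X _; congr (_%:E).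
  rewrite -[n%:R^-1]ger0_norm ?invr_ge0 ?ler0n// -normrM; congr (`|_|).
  by rewrite mulrDr mulrN mulKf ?gt_eqF// addrC.
- apply: measurableT_comp => //; apply: measurable_funD => //.
  exact: (@measurable_tuple_sum _ 'rV[R]_d R n (fun=> K)).
Qed.

Lemma integrable_law_kernel (f : simplex_density R d) m :
  (\int[law f]_x (K x)%:E = m%:E)%E -> (law f).-integrable setT (EFin \o K).
Proof.
move=> E; apply/integrableP; split; first exact/measurable_EFinP.
under eq_integral do rewrite /= ger0_norm//.
by rewrite E ltry.
Qed.

(** Jensen's inequality, as the degenerate case of the two-value comparison in
    which the event is the whole space. *)
Lemma kde_error_ge_bias (f : simplex_density R d) (m y : R) :
  (\int[law f]_x (K x)%:E = m%:E)%E ->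
  ((`|m - y|)%:E <=
    \int[tuple_measure (law f) n]_X (`|dirichlet_kde b X s - y|)%:E)%E.
Proof.
move=> E; have n0' : 0 < n%:R :> R by rewrite ltr0n.
rewrite kde_errorE.
have two1 k c : two_point 1 m 0 k c = `|c + k%:R * m|.
  elim: k c => [|k IH] c /=; first by rewrite mul0r addr0.
  by rewrite subrr mul0r addr0 mul1r IH -addrA -natr1; congr (`|_|); ring.
have := @two_point_le_integral _ _ R (law f) K setT 1 m 0 n (- (n%:R * y))
  measurableT mK (integrable_law_kernel E) (probability_setT (law f)).
rewrite E mul1r setCT integral_set0 mulr0 => /(_ erefl erefl).
rewrite two1 => le1.
apply: (@le_trans _ _ ((n%:R^-1)%:E * (`|- (n%:R * y) + n%:R * m|)%:E)%E).
  rewrite -EFinM lee_fin.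
  rewrite (_ : m - y = n%:R^-1 * (- (n%:R * y) + n%:R * m)); last first.
    by field; rewrite gt_eqF.
  by rewrite normrM ger0_norm ?invr_ge0 ?ler0n.
by rewrite lee_wpmul2l// lee_fin invr_ge0 ler0n.
Qed.

(** The mean of the Dirichlet kernel centred at s is not s: it is off by a multiple
    of the bandwidth, and no smoothness of the density compensates for that. *)
Lemma kde_error_linear (i : 'I_d) :
  (((D + 1) * C0 * (b * `|1 - (D + 1) * s ord0 i| / (D + 2)))%:E <=
    \int[tuple_measure (law (linear_density i)) n]_X
       (`|dirichlet_kde b X s - linear_density i s|)%:E)%E.
Proof.
have [b0 b1] : 0 < b /\ b < 1 by case/andP: b01.
have D0 : 0 <= D by rewrite ler0n.
have c0 := @linear_const_gt0 R d.
have q0 : 0 < 1 + (D + 1) * b by rewrite addr_gt0// mulr_gt0//; lra.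
have E : (\int[law (linear_density i)]_x (K x)%:E =
    ((D + 1) * C0 * ((s ord0 i + b) / (1 + (D + 1) * b)))%:E)%E.
  rewrite integral_law_kernel EFinM -(integral_dirichlet_kernel_coord b01 sS i).
  rewrite -ge0_integral_EFinZl ?(ltW c0)//.
  - by apply: eq_integral => x _; rewrite /= /linear_fun; congr (_%:E); ring.
  - apply: measurable_funTS; apply: measurable_funM => //; exact: measurable_coord.
  - by move=> x /simplexP[x0 _]; rewrite mulr_ge0.
apply: le_trans (kde_error_ge_bias _ E); rewrite lee_fin /= /linear_fun -mulrBr.
rewrite normrM (gtr0_norm c0) ler_pM2l//.
have -> : (s ord0 i + b) / (1 + (D + 1) * b) - s ord0 i =
    b * (1 - (D + 1) * s ord0 i) / (1 + (D + 1) * b).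
  by field; rewrite gt_eqF.
rewrite normrM normrM normfV (gtr0_norm b0) (gtr0_norm q0).
rewrite ler_wpM2l ?mulr_ge0 ?(ltW b0)// lef_pV2 ?posrE//.
have : (D + 1) * b <= D + 1 by rewrite ler_piMr ?(ltW b1)//; lra.
lra.
Qed.

(** By Chebyshev's inequality the kernel keeps most of its mass in a cube whose
    side is a large multiple of the square root of the bandwidth. *)
Lemma kernel_mass_cube (r : R) : 0 < r ->
  4 * D * ((D + 1) * (D + 2) + 3) * b <= r ^+ 2 ->
  ((3 / 4)%:E <= \int[lebesgue_rV]_(x in [set x : 'rV[R]_d | forall i,
      (s ord0 i - r <= x ord0 i <= s ord0 i + r)%R] `&` simplex d) (K x)%:E)%E.
Proof.
move=> r0 rb; set A := [set x : 'rV[R]_d | _].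
have D0 : 0 <= D by rewrite ler0n.
have mA : measurable A.
  rewrite (_ : A = (\bigcap_(i in [set: 'I_d])
      ((fun x : 'rV[R]_d => x ord0 i) @^-1` `[s ord0 i - r, s ord0 i + r]))).
    apply: fin_bigcap_measurable => [|i _]; first exact: finite_finset.
    by rewrite -[X in measurable X]setTI; apply: measurable_coord.
  by apply/seteqP; split=> x /= H i; [move=> _|]; have := H i; rewrite ?in_itv//=; apply.
pose dev i (x : 'rV[R]_d) := (x ord0 i - s ord0 i) ^+ 2 * K x.
have mdev i : measurable_fun (simplex d) (dev i).
  apply: measurable_funTS; apply: measurable_funM => //; apply: measurable_funX.
  by apply: measurable_funB => //; exact: measurable_coord.
have dev0 i x : 0 <= dev i x by rewrite mulr_ge0// sqr_ge0.
have sum_le : (\int[lebesgue_rV]_(x in simplex d)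
    (\sum_(i < d) (r ^- 2 * dev i x))%:E <= (4^-1)%:E)%E.
  under eq_integral do rewrite -sumEFin.
  rewrite ge0_integral_sum//; last 2 first.
  - by move=> i; apply/measurable_EFinP; exact: measurable_funM.
  - by move=> i x _; rewrite lee_fin mulr_ge0// invr_ge0 exprn_ge0 ?ltW.
  apply: (@le_trans _ _ (\sum_(i < d)
      (r ^- 2 * (b * ((D + 1) * (D + 2) + 3)))%:E)%E).
    apply: lee_sum => i _.
    rewrite ge0_integral_EFinZl//; last by rewrite invr_ge0 exprn_ge0 ?ltW.
    rewrite EFinM lee_wpmul2l ?lee_fin ?invr_ge0 ?exprn_ge0 ?(ltW r0)//.
    exact: integral_dirichlet_kernel_dev.
  rewrite sumEFin lee_fin sumr_const card_ord -[leLHS]mulr_natr.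
  rewrite -mulrA ler_pdivrMl ?exprn_gt0//; move: rb.
  rewrite (_ : 4 * _ * _ * _ = 4 * (b * ((D + 1) * (D + 2) + 3) * D)); last by ring.
  by move=> h; rewrite -[leLHS](mulKf (_ : 4 != 0 :> R))// [leLHS]mulrC ler_wpM2r.
have split_le : (\int[lebesgue_rV]_(x in simplex d) (K x)%:E <=
    \int[lebesgue_rV]_(x in simplex d) (K x * \1_A x)%:E +
    \int[lebesgue_rV]_(x in simplex d)
      (\sum_(i < d) (r ^- 2 * dev i x))%:E)%E.
  have mKA : measurable_fun (simplex d) (fun x => K x * \1_A x).
    by apply: measurable_funTS; apply: measurable_funM.
  have ms : measurable_fun (simplex d) (fun x => \sum_(i < d) (r ^- 2 * dev i x)).
    by apply: measurable_sum => i; exact: measurable_funM.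
  have s0 x : 0 <= \sum_(i < d) (r ^- 2 * dev i x).
    by apply: sumr_ge0 => i _; rewrite mulr_ge0// invr_ge0 exprn_ge0 ?ltW.
  rewrite -ge0_integral_EFinD//; last by move=> x _; rewrite mulr_ge0.
  apply: ge0_le_integral => //.
  - by move=> x _; rewrite lee_fin.
  - by apply/measurable_EFinP; exact: measurable_funTS.
  - by apply/measurable_EFinP; exact: measurable_funD.
  move=> x _; rewrite lee_fin indicE.
  have [xA|xA] := boolP (x \in A); first by rewrite mulr1 lerDl.
  rewrite mulr0 add0r.
  have [i xi] : exists i, ~~ (s ord0 i - r <= x ord0 i <= s ord0 i + r).
    apply: contrapT => /forallNP H; move/negP : xA; apply; rewrite inE => i.
    by apply: contrapT => /negP h; exact: (H i).
  rewrite (bigD1 i)//= -[leLHS]addr0 lerD//; last first.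
    by apply: sumr_ge0 => j _; rewrite mulr_ge0// invr_ge0 exprn_ge0 ?ltW.
  rewrite /dev mulrA -[leLHS]mul1r ler_wpM2r//.
  rewrite ler_pdivlMl ?exprn_gt0// mulr1.
  rewrite -[leRHS]real_normK ?num_real// lerXn2r ?nnegrE ?(ltW r0)//.
  move: xi; rewrite negb_and -!ltNge ler_normr => /orP[h|h]; apply/orP.
    by right; lra.
  by left; lra.
have intA : (\int[lebesgue_rV]_(x in A `&` simplex d) (K x)%:E =
    \int[lebesgue_rV]_(x in simplex d) (K x * \1_A x)%:E)%E.
  rewrite setIC integral_mkcondr; apply: eq_integral => x _.
  by rewrite patchE indicE; case: ifPn => _; rewrite ?mulr1 ?mulr0.
have aux (I J : \bar R) : (1 <= I + J -> J <= (4^-1)%:E -> 0 <= I ->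
    (3 / 4)%:E <= I)%E.
  move=> IJ J4; have : (1 <= I + (4^-1)%:E)%E by rewrite (le_trans IJ)// leeD2l.
  case: I {IJ} => [u| |]//=; rewrite ?leey//.
  by rewrite -EFinD !lee_fin => h _; lra.
rewrite intA; move: split_le; rewrite integral_dirichlet_kernel//.
move=> /aux; apply => //; apply: integral_ge0 => x _.
by rewrite lee_fin mulr_ge0.
Qed.

(** Under the uniform density the estimator is unbiased. An observation falls in
    the cube of side 2 r around s with probability p = C0 (2 r) ^ d at most 1 / 4,
    while the kernel has at least 3 / 4 of its mass there: hence the number of
    observations in that cube makes the estimator fluctuate. *)
Lemma kde_error_uniform (r : R) : 0 < r ->
  4 * D * ((D + 1) * (D + 2) + 3) * b <= r ^+ 2 ->
  (forall i, r <= s ord0 i) -> \sum_(i < d) (s ord0 i + r) <= 1 ->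
  C0 * (2 * r) ^+ d <= 4^-1 -> 1 <= n%:R * (C0 * (2 * r) ^+ d) ->
  ((C0 / 20 / Num.sqrt (n%:R * (C0 * (2 * r) ^+ d)))%:E <=
    \int[tuple_measure (law (@uniform_density R d)) n]_X
       (`|dirichlet_kde b X s - uniform_density s|)%:E)%E.
Proof.
move=> r0 rb rs sr p4 np.
have c0 := @simplex_const_gt0 R d.
have n0' : 0 < n%:R :> R by rewrite ltr0n.
set p := C0 * (2 * r) ^+ d in p4 np *.
have p0 : 0 < p by rewrite mulr_gt0// exprn_gt0// mulr_gt0.
set f := @uniform_density R d.
pose A := [set x : 'rV[R]_d | forall i, s ord0 i - r <= x ord0 i <= s ord0 i + r].
have AS : A `<=` simplex d.
  move=> x Ax; apply/simplexP; split=> [i|].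
    by have /andP[+ _] := Ax i; apply: le_trans; rewrite subr_ge0.
  by rewrite (le_trans _ sr)// ler_sum// => i _; have /andP[] := Ax i.
have mA : measurable A.
  rewrite (_ : A = (\bigcap_(i in [set: 'I_d])
      ((fun x : 'rV[R]_d => x ord0 i) @^-1` `[s ord0 i - r, s ord0 i + r]))).
    apply: fin_bigcap_measurable => [|i _]; first exact: finite_finset.
    by rewrite -[X in measurable X]setTI; apply: measurable_coord.
  by apply/seteqP; split=> x /= H i; [move=> _|]; have := H i; rewrite ?in_itv//=; apply.
have PA : law f A = p%:E.
  transitivity (\int[lebesgue_rV]_(x in A) cst C0%:E x)%E.
    by rewrite /law setIidl.
  rewrite integral_cst// [X in (_ * X)%E]lebesgue_rV_box.
    rewrite -EFinM; congr (_ * _)%:E.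
    rewrite (eq_bigr (fun=> 2 * r)) ?prodr_const ?card_ord// => i _; ring.
  by move=> i; lra.
have E : (\int[law f]_x (K x)%:E = C0%:E)%E.
  rewrite integral_law_kernel -[RHS]mule1 -(integral_dirichlet_kernel b01 sS).
  rewrite -ge0_integral_EFinZl ?(ltW c0)//; last exact: measurable_funTS.
  by apply: eq_integral => x _; rewrite mulrC.
have iK := integrable_law_kernel E.
pose W x := K x - C0.
have mW : measurable_fun setT W by exact: measurable_funB.
have iC : (law f).-integrable setT (EFin \o cst C0).
  exact: finite_measure_integrable_cst.
have iW : (law f).-integrable setT (EFin \o W).
  rewrite (_ : EFin \o W = ((EFin \o K) \- (EFin \o cst C0))%E)//.
  exact: integrableB.
have W0 : (\int[law f]_x (W x)%:E = 0)%E.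
  under eq_integral do rewrite EFinB.
  rewrite integralB// E integral_cst// [X in (_ - _ * X)%E]probability_setT.
  by rewrite mule1 subee.
have WA : ((C0 / 2)%:E <= \int[law f]_(x in A) (W x)%:E)%E.
  under eq_integral do rewrite EFinB.
  rewrite integralB//; [|exact: integrableS iK|exact: integrableS iC].
  rewrite integral_cst// [X in (_ - _ * X)%E]PA.
  have : ((C0 * (3 / 4))%:E <= \int[law f]_(x in A) (K x)%:E)%E.
    rewrite integral_mkcond ge0_integral_law; last 2 first.
    - apply/(measurable_restrictT _ _).1 => //; apply/measurable_EFinP.
      exact: measurable_funTS.
    - by move=> x; rewrite patchE; case: ifPn => // _; rewrite lee_fin.
    rewrite EFinM (le_trans (lee_wpmul2l _ (kernel_mass_cube r0 rb))) ?lee_fin ?(ltW c0)//.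
    rewrite -/A -ge0_integral_EFinZl ?(ltW c0)//; last 2 first.
    - exact: measurableI.
    - exact: measurable_funTS.
    rewrite setIC [leLHS]integral_mkcondr.
    rewrite le_eqVlt; apply/orP; left; apply/eqP.
    apply: eq_integral => x _; rewrite !patchE.
    by case: ifPn => _; rewrite ?mul0e// -EFinM mulrC.
  have iKA : (\int[law f]_(x in A) (K x)%:E \is a fin_num)%E.
    by apply: integrable_fin_num => //; exact: integrableS iK.
  rewrite -(fineK iKA) -EFinM -EFinB !lee_fin.
  have : C0 * p <= C0 * 4^-1 by rewrite ler_pM2l.
  lra.
have c20 : 0 < C0 / 2 by rewrite divr_gt0.
have p02 : 0 < p <= 2^-1 by lra.
have := integral_abs_sum_ge mA mW iW PA p02 np c20 W0 WA.
rewrite kde_errorE => h.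
have -> : (\int[tuple_measure (law f) n]_X
   (`|- (n%:R * f s) + \sum_(i < n) K (tnth X i)|)%:E =
   \int[tuple_measure (law f) n]_X (`|\sum_(i < n) W (tnth X i)|)%:E)%E.
  apply: eq_integral => X _; congr (`|_|%:E).
  rewrite /W sumrB sumr_const card_ord addrC; congr (_ - _).
  by rewrite mulr_natl.
apply: le_trans (lee_wpmul2l _ h); last by rewrite lee_fin invr_ge0 ler0n.
rewrite -EFinM lee_fin le_eqVlt; apply/orP; left; apply/eqP.
have q0 : 0 < Num.sqrt (n%:R * p) by rewrite sqrtr_gt0 mulr_gt0.
have sq : Num.sqrt (n%:R / p) = n%:R / Num.sqrt (n%:R * p).
  apply: (mulIf (lt0r_neq0 q0)); rewrite divfK ?lt0r_neq0//.
  rewrite -sqrtrM ?divr_ge0 ?ler0n ?(ltW p0)//.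
  rewrite (_ : n%:R / p * (n%:R * p) = n%:R ^+ 2).
    by rewrite sqrtr_sqr ger0_norm ?ler0n.
  by field; rewrite gt_eqF.
by rewrite sq; field; rewrite !gt_eqF.
Qed.

End kde_lower.

Section kde_class_risk.
Context {R : realType} (d : nat) (L p beta : R).
Hypotheses (hd : (0 < d)%N) (hL : 0 < L) (hp : 1 <= p) (hbeta : 2 < beta).
Local Notation D := (d%:R : R).
Local Notation C0 := (@simplex_const R d).

Let i0 : 'I_d := Ordinal hd.
Let e0 : R := (4 * (D + 1))^-1.
Let A := [set s : 'rV[R]_d | forall i, e0 <= s ord0 i <= 2 * e0].

Let D1 : 1 <= D. Proof. by rewrite ler1n. Qed.

Let e0_gt0 : 0 < e0.
Proof. by rewrite invr_gt0; have := D1; lra. Qed.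

Let e0D : (D + 1) * e0 = 4^-1.
Proof. by rewrite /e0; field; have := D1; rewrite gt_eqF//; lra. Qed.

Let sum_le (s : 'rV[R]_d) (r : R) : A s -> r <= e0 -> \sum_(i < d) (s ord0 i + r) <= 1.
Proof.
move=> As re; apply: (@le_trans _ _ (\sum_(i < d) (3 * e0))).
  apply: ler_sum => i _; have /andP[_ h] := As i; lra.
rewrite sumr_const card_ord -[leLHS]mulr_natr.
have := e0D; have := e0_gt0; lra.
Qed.

Let mA : measurable A.
Proof.
rewrite (_ : A = (\bigcap_(i in [set: 'I_d])
    ((fun x : 'rV[R]_d => x ord0 i) @^-1` `[e0, 2 * e0]))).
  apply: fin_bigcap_measurable => [|i _]; first exact: finite_finset.
  by rewrite -[X in measurable X]setTI; apply: measurable_coord.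
by apply/seteqP; split=> x /= H i; [move=> _|]; have := H i; rewrite ?in_itv//=; apply.
Qed.

Let AS : A `<=` simplex d.
Proof.
move=> s As; apply/simplexP; split=> [i|].
  by have /andP[+ _] := As i; apply: le_trans; exact: ltW.
have := sum_le As (lexx e0); apply: le_trans.
by apply: ler_sum => i _; rewrite lerDl ltW.
Qed.

Let leA : lebesgue_rV A = (e0 ^+ d)%:E.
Proof.
rewrite lebesgue_rV_box => [|i]; last by have := e0_gt0; lra.
rewrite (eq_bigr (fun=> e0)) ?prodr_const ?card_ord// => i _; ring.
Qed.

Let V01 : 0 < e0 ^+ d <= 1.
Proof.
rewrite exprn_gt0//= exprn_ile1 ?(ltW e0_gt0)//.
by have := e0D; have := e0_gt0; have := D1; nra.
Qed.

Let class_risk_ge n (b e : R) (f : simplex_density R d) :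
  hoelder_class d beta L f -> 0 < e ->
  (forall s, A s -> (e%:E <= \int[tuple_measure (law f) n]_X
     (`|dirichlet_kde b X s - f s|)%:E)%E) ->
  ((e * e0 ^+ d / 3)%:E <= class_risk p beta L (@dirichlet_kde R d n b))%E.
Proof.
move=> fH e_gt0 eA.
apply: (@le_trans _ _ (risk p (@dirichlet_kde R d n b) f)); last first.
  by apply: ereal_sup_ubound; exists f.
apply: (risk_ge hp (@is_estimator_dirichlet_kde R d b n) mA AS e_gt0 V01 leA eA).
move=> s As.
have mp : measurable_fun setT (fun X : n.-tuple 'rV[R]_d => (X, s)).
  exact: measurable_fun_pair.
exact: (measurableT_comp (@measurable_dirichlet_kde R d b n) mp).
Qed.

(** Whatever the bandwidth, either the bias or the fluctuations of the estimator
    are at least of the order of the rate for smoothness 2: with r ^ (d + 4) = 1 / n,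
    both are at least r ^ 2, the bias when b >= r ^ 2 and the fluctuations, which are
    those of an average over n r ^ d observations, when b <= r ^ 2. *)
Lemma kde_class_risk_ge : exists2 c : R, 0 < c & exists2 r0 : R, 0 < r0 &
  forall (n : nat) (b r : R), (0 < n)%N -> 0 < b < 1 -> 0 < r <= r0 ->
  n%:R * r ^+ (d + 4) = 1 ->
  ((c * r ^+ 2)%:E <= class_risk p beta L (@dirichlet_kde R d n b))%E.
Proof.
have c0 := @simplex_const_gt0 R d.
have V0 : 0 < e0 ^+ d by case/andP: V01.
have D_ge1 := D1.
pose k := 4 * D * ((D + 1) * (D + 2) + 3).
have k0 : 0 < k.
  have h1 : 0 < 4 * D by lra.
  have h2 : 0 < (D + 1) * (D + 2) by apply: mulr_gt0; lra.
  by apply: mulr_gt0 => //; lra.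
pose q := C0 * 2 ^+ d.
have q0 : 0 < q by rewrite mulr_gt0// exprn_gt0.
pose c1 := C0 / 20 / Num.sqrt q.
have c10 : 0 < c1 by rewrite !divr_gt0// sqrtr_gt0.
pose c2 := (D + 1) * C0 / (2 * (D + 2)) / k.
have c20 : 0 < c2.
  by rewrite divr_gt0// divr_gt0// ?mulr_gt0//; lra.
pose c := Num.min c1 c2.
have cc1 : c <= c1 by rewrite ge_min lexx.
have cc2 : c <= c2 by rewrite ge_min lexx orbT.
have c_gt0 : 0 < c by rewrite lt_min c10.
exists (c * (e0 ^+ d / 3)); first by rewrite mulr_gt0// divr_gt0.
pose r0 := Num.min (Num.min e0 2^-1) (Num.min q (8 * C0)^-1).
exists r0; first by rewrite !lt_min e0_gt0 q0/= !invr_gt0 mulr_gt0//=; lra.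
move=> n b r n0 b01 /andP[r_gt0]; rewrite !le_min => /andP[/andP[re r2] /andP[rq rC]] nr.
have b0 : 0 < b by case/andP: b01.
have r2_gt0 : 0 < r ^+ 2 by rewrite exprn_gt0.
rewrite -mulrA [_ * r ^+ 2]mulrC 2!mulrA.
have [kb|kb] := leP (k * b) (r ^+ 2).
- have p4 : C0 * (2 * r) ^+ d <= 4^-1.
    apply: (@le_trans _ _ (C0 * (2 * r))).
      rewrite ler_pM2l// -(prednK hd) exprS ler_piMr ?mulr_ge0 ?(ltW r_gt0)//.
      by rewrite exprn_ile1 ?mulr_ge0 ?(ltW r_gt0)//; lra.
    move: rC; rewrite -[_^-1]mul1r ler_pdivlMr ?mulr_gt0// => h; lra.
  have nq : n%:R * (C0 * (2 * r) ^+ d) = q / r ^+ 4.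
    rewrite exprMn /q; have r4 : r ^+ 4 != 0 by rewrite expf_neq0// gt_eqF.
    apply: (mulIf r4); rewrite divfK// -[RHS]mulr1 -[X in _ = _ * X]nr exprD.
    by move: (r ^+ d) (r ^+ 4) => x y; ring.
  have np : 1 <= n%:R * (C0 * (2 * r) ^+ d).
    rewrite nq ler_pdivlMr ?exprn_gt0// mul1r (le_trans _ rq)//.
    rewrite exprS ler_piMr ?(ltW r_gt0)// exprn_ile1 ?(ltW r_gt0)//; lra.
  have sq : Num.sqrt (n%:R * (C0 * (2 * r) ^+ d)) = Num.sqrt q / r ^+ 2.
    rewrite nq sqrtrM ?(ltW q0)// sqrtrV ?exprn_ge0 ?(ltW r_gt0)//.
    by rewrite -[4%N]/(2 * 2)%N exprM sqrtr_sqr ger0_norm// sqr_ge0.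
  apply: (@le_trans _ _ ((c1 * r ^+ 2 * e0 ^+ d / 3)%:E)).
    by rewrite lee_fin ler_pM2r ?invr_gt0// ler_pM2r// ler_pM2r.
  apply: (class_risk_ge (f := @uniform_density R d)).
  + rewrite (_ : density_fun _ = fun x : 'rV[R]_d => C0 + 0 * x ord0 i0).
      by apply: hoelder_class_affine => //; exact: ltW.
    by apply/funext => x; rewrite /= mul0r addr0.
  + by rewrite mulr_gt0.
  + move=> s As; have sS := AS As.
    have := kde_error_uniform b01 sS n0 r_gt0 kb _ (sum_le As re) p4 np.
    rewrite sq => h; apply: (le_trans _ (h _)).
      rewrite lee_fin /c1 le_eqVlt; apply/orP; left; apply/eqP.
      by field; rewrite !gt_eqF// sqrtr_gt0.
    by move=> i; have /andP[+ _] := As i; apply: le_trans.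
- apply: (@le_trans _ _ ((c2 * r ^+ 2 * e0 ^+ d / 3)%:E)).
    by rewrite lee_fin ler_pM2r ?invr_gt0// ler_pM2r// ler_pM2r.
  apply: (class_risk_ge (f := linear_density i0)).
  + rewrite (_ : density_fun _ = fun x : 'rV[R]_d => 0 + ((D + 1) * C0) * x ord0 i0).
      by apply: hoelder_class_affine => //; exact: ltW.
    by apply/funext => x; rewrite /= add0r.
  + by rewrite mulr_gt0.
  + move=> s As; have sS := AS As.
    apply: le_trans (kde_error_linear b01 sS n0 i0); rewrite lee_fin.
    have hs : 2^-1 <= `|1 - (D + 1) * s ord0 i0|.
      rewrite (le_trans _ (ler_norm _))//.
      have /andP[_ h] := As i0.
      have : (D + 1) * s ord0 i0 <= (D + 1) * (2 * e0) by rewrite ler_pM2l//; lra.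
      have := e0D; lra.
    have -> : c2 * r ^+ 2 = (D + 1) * C0 * (r ^+ 2 / k * 2^-1 / (D + 2)).
      by rewrite /c2; field; rewrite !gt_eqF//; lra.
    have DC : 0 < (D + 1) * C0 by exact: linear_const_gt0.
    rewrite ler_pM2l// ler_pM2r ?invr_gt0; last lra.
    by rewrite ler_pM ?divr_ge0 ?(ltW k0) ?(ltW r2_gt0)// ler_pdivrMr// mulrC ltW.
Qed.

End kde_class_risk.

(** * Extrapolation along an axis *)

Section extrapolation.
Context {R : realType}.
Implicit Types (g : nat -> R -> R) (f : R -> R) (N m : nat).

(** The coefficients that express the value at 0 of a polynomial of degree less
    than N by its values at 1, ..., N, as a list of coefficients and arguments in
    which an argument may be repeated; the recursion is that of the N-th finite
    difference. *)
Fixpoint extrap N : seq (R * nat) :=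
  if N is N'.+1 then extrap N' ++ (1, 1%N) :: [seq (- t.1, t.2.+1) | t <- extrap N']
  else [::].

Lemma extrap_range N t : t \in extrap N -> (0 < t.2 <= N)%N.
Proof.
elim: N t => [|N IH] t //=; rewrite mem_cat inE => /or3P[/IH/andP[-> h]|/eqP ->//|].
  exact: leqW.
by move=> /mapP[u /IH/andP[_ h] ->].
Qed.

Definition bdiff f (x : R) : R := f x - f (x + 1).

Lemma sum_extrap N f x :
  f x - \sum_(t <- extrap N) t.1 * f (x + t.2%:R) = iter N bdiff f x.
Proof.
elim: N x => [|N IH] x; first by rewrite /= big_nil subr0.
have bE h y : bdiff h y = h y - h (y + 1) by [].
rewrite iterS bE -!IH /= big_cat big_cons big_map/= mul1r.
have -> : \sum_(t <- extrap N) - t.1 * f (x + t.2.+1%:R) =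
    - \sum_(t <- extrap N) t.1 * f (x + 1 + t.2%:R).
  by rewrite -sumrN; apply: eq_bigr => t _; rewrite mulNr -addrA nat1r.
ring.
Qed.

Lemma sum_extrap1 N : (0 < N)%N -> \sum_(t <- extrap N) t.1 = 1 :> R.
Proof.
case: N => // N _; elim: N => [|N IH]; first by rewrite /= big_cons big_nil addr0.
have := sum_extrap N.+2 (fun=> 1) 0.
rewrite (eq_bigr (fun t : R * nat => t.1)) => [h|t _]; last by rewrite mulr1.
have z k x : iter k.+1 bdiff (fun=> 1) x = 0.
  elim: k x => [|k IHk] x; first by rewrite /= /bdiff subrr.
  by rewrite iterS /bdiff !IHk subrr.
by move: h; rewrite z => /eqP; rewrite subr_eq0 => /eqP.
Qed.

(** The mean value theorem for iterated differences: by induction the difference of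
    order m of the first difference of g is one of its derivatives of order m, and
    the mean value theorem applies to the latter. *)
Lemma iter_bdiff_mvt m g (a : R) :
  (forall k (x : R), (k < m)%N -> a <= x <= a + m%:R ->
    is_derive x 1 (g k) (g k.+1 x)) ->
  exists2 xi, a <= xi <= a + m%:R & iter m bdiff (g 0%N) a = (- 1) ^+ m * g m xi.
Proof.
elim: m g => [|m IH] g dg.
  by exists a; rewrite ?addr0 ?lexx// expr0 mul1r.
have [k x km xm|xi /andP[x1 x2]] := IH (fun k => bdiff (g k)).
  have xm1 : a <= x <= a + m.+1%:R.
    by move: xm; rewrite -natr1; lra.
  have xm2 : a <= x + 1 <= a + m.+1%:R.
    by move: xm; rewrite -natr1; lra.
  have d1 := dg k x (ltnW km) xm1.
  have d2 := dg k (x + 1) (ltnW km) xm2.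
  apply: is_deriveB.
  have -> : g k.+1 (x + 1) = g k.+1 (x + 1) * 1 by rewrite mulr1.
  apply: (@is_derive1_comp R (g k) (fun y => y + 1)).
  have [] := @derive_along_line R R^o (fun y : R => y + 1) x 1 1.
    by move=> h; rewrite [_ *: (1 : R^o)]mulr1 mulr1; ring.
  by split.
rewrite -iterSr => xiE.
have dm x : xi <= x <= xi + 1 -> is_derive x 1 (g m) (g m.+1 x).
  by move=> xx; apply: dg => //; rewrite -natr1; lra.
have xx1 : xi <= xi + 1 by rewrite lerDl.
have doo z : z \in `]xi, xi + 1[ -> is_derive z 1 (g m) (g m.+1 z).
  by rewrite in_itv/= => zz; apply: dm; lra.
have cont : {within `[xi, xi + 1], continuous (g m)}.
  apply: derivable_within_continuous => z; rewrite in_itv/= => zz.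
  by have := dm z zz.
have [z zin zE] := MVT_segment xx1 doo cont.
move: zin; rewrite in_itv/= => zz.
exists z; first by rewrite -natr1; lra.
apply: (etrans xiE); rewrite /bdiff exprS mulN1r mulNr -mulrN; congr (_ * _).
by have := zE; rewrite addrAC subrr add0r mulr1 => <-; rewrite opprB.
Qed.

(** With m.+1 nodes the error is the difference of order m.+1 of g at 0, hence, by
    the mean value theorem at order m, a difference of two values of the m-th
    derivative: only its modulus of continuity enters, as for a function whose
    derivative of order m is merely Hoelder continuous. *)
Lemma extrap_error m g (H : R) :
  (forall k (x : R), (k < m)%N -> 0 <= x <= m.+1%:R ->
    is_derive x 1 (g k) (g k.+1 x)) ->
  (forall x y : R, 0 <= x <= m.+1%:R -> 0 <= y <= m.+1%:R ->
    `|g m x - g m y| <= H) ->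
  `|g 0%N 0 - \sum_(t <- extrap m.+1) t.1 * g 0%N t.2%:R| <= H.
Proof.
move=> dg Hg.
rewrite (eq_bigr (fun t : R * nat => t.1 * g 0%N (0 + t.2%:R))); last first.
  by move=> t _; rewrite add0r.
rewrite sum_extrap iterS {1}/bdiff.
have [k x km xm|x xm ->] := @iter_bdiff_mvt m g 0.
  by apply: dg => //; move: xm; rewrite -natr1; lra.
have [k y km ym|y ym ->] := @iter_bdiff_mvt m g (0 + 1).
  by apply: dg => //; move: ym; rewrite -natr1; lra.
rewrite -mulrBr normrM normrX normrN1 expr1n mul1r; apply: Hg.
  by move: xm; rewrite -natr1; lra.
by move: ym; rewrite -natr1; lra.
Qed.

End extrapolation.

Section open_simplex.
Context {R : realType} {d : nat}.
Implicit Types s : 'rV[R]_d.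

Definition open_simplex : set 'rV[R]_d :=
  [set s | (forall i, 0 < s ord0 i) /\ \sum_(i < d) s ord0 i < 1].

Lemma open_simplex_sub : open_simplex `<=` simplex d.
Proof.
by move=> s [s0 s1]; apply/simplexP; split=> [i|]; apply: ltW.
Qed.

Lemma open_simplex_interior s : open_simplex s -> (simplex d)^° s.
Proof.
move=> [s0 s1]; pose e := Num.min (\big[Num.min/1]_(i < d) s ord0 i)
  ((1 - \sum_(i < d) s ord0 i) / (d%:R + 1)).
have d1 : 0 < d%:R + 1 :> R by rewrite ltr_pwDr// ler0n.
have e0 : 0 < e.
  rewrite lt_min divr_gt0 ?subr_gt0// andbT.
  by apply: (big_ind (fun x => 0 < x)) => // x y x0 y0; rewrite lt_min x0.
apply/nbhs_ballP; exists e => //= t /= st.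
have ti i : `|s ord0 i - t ord0 i| < e by have [_ h] := st; exact: h.
apply/simplexP; split=> [i|].
  have := ti i; rewrite lt_min => /andP[+ _].
  have : \big[Num.min/1]_(j < d) s ord0 j <= s ord0 i by exact: bigmin_le_cond.
  by rewrite ltr_distl => h /andP[_ h2]; lra.
apply: (@le_trans _ _ (\sum_(i < d) (s ord0 i + e))).
  by apply: ler_sum => i _; have := ti i; rewrite ltr_distlC => /andP[_ /ltW].
rewrite big_split/= sumr_const card_ord -[X in _ + X]mulr_natr -lerBrDl.
have : e <= (1 - \sum_(i < d) s ord0 i) / (d%:R + 1) by rewrite ge_min lexx orbT.
rewrite ler_pdivlMr// mulrDr mulr1; lra.
Qed.

Lemma open_simplex_segment s (i : 'I_d) (a x : R) :
  open_simplex s -> open_simplex (s + a *: delta_mx ord0 i) -> 0 <= x <= 1 ->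
  open_simplex (s + (x * a) *: delta_mx ord0 i).
Proof.
move=> [s0 s1] [t0 t1] /andP[x0 x1].
have E : s + (x * a) *: delta_mx ord0 i =
    (1 - x) *: s + x *: (s + a *: delta_mx ord0 i).
  by rewrite scalerDr scalerA addrA -scalerDl subrK scale1r.
have [->|x_gt0] := eqVneq x 0; first by rewrite mul0r scale0r addr0.
have xp : 0 < x by rewrite lt0r x_gt0.
have nx : 0 <= 1 - x by lra.
rewrite E; split=> [j|].
  have h := t0 j; rewrite mxE [X in 0 < X + _]mxE [X in 0 < _ + X]mxE.
  by rewrite ltr_wpDl ?mulr_ge0 ?(ltW (s0 j))// mulr_gt0.
have -> : \sum_(j < d) ((1 - x) *: s + x *: (s + a *: delta_mx ord0 i)) ord0 j =
  (1 - x) * (\sum_(j < d) s ord0 j) +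
    x * (\sum_(j < d) (s + a *: delta_mx ord0 i) ord0 j).
  rewrite !mulr_sumr -big_split/=; apply: eq_bigr => j _.
  by rewrite mxE [X in X + _ = _]mxE [X in _ + X = _]mxE.
have h1 : (1 - x) * \sum_(j < d) s ord0 j <= (1 - x) * 1 by rewrite ler_wpM2l// ltW.
have h2 : x * \sum_(j < d) (s + a *: delta_mx ord0 i) ord0 j < x * 1 by rewrite ltr_pM2l.
lra.
Qed.

End open_simplex.

Section hoelder_axis.
Context {R : realType} {d : nat} (beta L : R) (f : 'rV[R]_d -> R).
Hypotheses (hbeta : 2 < beta) (hL : 0 < L).
Hypothesis fH : hoelder_class d beta L f.

Local Notation m := (hoelder_order beta).

Let gm (i : 'I_d) : {ffun 'I_d -> nat} := [ffun j => (m * (j == i))%N].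

Lemma mindex_dirs_axis i : mindex_dirs (gm i) = nseq m i.
Proof.
rewrite /mindex_dirs.
have -> : [seq nseq (gm i j) j | j <- enum 'I_d] =
    [seq nseq (m * (j == i)) i | j <- enum 'I_d].
  apply: eq_map => j; rewrite ffunE; case: eqP => [->//|_].
  by rewrite muln0.
have h (l : seq 'I_d) : flatten [seq nseq (m * (j == i)) i | j <- l] =
    nseq (m * count_mem i l) i.
  elim: l => [|j l IH] /=; first by rewrite muln0.
  by rewrite IH -nseqD -mulnDr eq_sym.
by rewrite h count_uniq_mem ?enum_uniq// mem_enum muln1.
Qed.

Let sum_gm i : (\sum_(j < d) gm i j)%N = m.
Proof.
rewrite (bigD1 i)//= ffunE eqxx muln1 big1 ?addn0// => j /negbTE ji.
by rewrite ffunE ji muln0.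
Qed.

Let F i k := iter_partial (nseq k i) f.

Let has_F i : has_iter_partial (simplex d)^° (nseq m i) f.
Proof. by have [+ _] := fH (sum_gm i); rewrite mindex_dirs_axis. Qed.

Let derivable_F i k s : (k < m)%N -> open_simplex s ->
  derivable (F i k) s (delta_mx ord0 i).
Proof.
move=> km /open_simplex_interior sI.
have : has_iter_partial (simplex d)^° (nseq k.+1 i) f.
  have := has_F i; rewrite -(subnK km).
  by move: (m - k.+1)%N => j; elim: j => // j IH; rewrite addSn => -[/IH].
by case=> _; exact.
Qed.

Let is_derive_line i k s (t : R) : (k < m)%N ->
  open_simplex (s + t *: delta_mx ord0 i) ->
  is_derive t 1 (fun t => F i k (s + t *: delta_mx ord0 i))
    (F i k.+1 (s + t *: delta_mx ord0 i)).
Proof.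
move=> km st; have dF := derivable_F km st.
have E : (fun h => h^-1 *: (((fun t => F i k (s + t *: delta_mx ord0 i)) \o shift t)
     (h *: (1 : R^o)) - F i k (s + t *: delta_mx ord0 i))) =
   (fun h => h^-1 *: ((F i k \o shift (s + t *: delta_mx ord0 i))
     (h *: delta_mx ord0 i) - F i k (s + t *: delta_mx ord0 i))).
  apply/funext => h /=; congr (_ *: (F i k _ - _)).
  by rewrite [_ *: (1 : R^o)]mulr1 scalerDl addrCA.
split; first by rewrite /derivable E; exact: dF.
by rewrite /derive E.
Qed.

(** Along a line parallel to the i-th axis, f is a function of one variable whose
    derivatives are the pure partial derivatives of f, and the multi-index with the
    entry m at i, and 0 elsewhere, is one of those in the definition of the class. *)
Lemma extrap_axis_error s i (a : R) :
  open_simplex s -> open_simplex (s + (m.+1%:R * a) *: delta_mx ord0 i) ->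
  `|f s - \sum_(t <- extrap m.+1) t.1 * f (s + (t.2%:R * a) *: delta_mx ord0 i)|
    <= L * m.+1%:R `^ (beta - m%:R) * `|a| `^ beta.
Proof.
move=> sG tG.
have m0 : 0 < m.+1%:R :> R by rewrite ltr0n.
have mb : m%:R < beta by apply: hoelder_order_lt; exact: lt_trans hbeta.
pose g k x := a ^+ k * F i k (s + (x * a) *: delta_mx ord0 i).
have inG x : 0 <= x <= m.+1%:R -> open_simplex (s + (x * a) *: delta_mx ord0 i).
  move=> /andP[x0 xm].
  have -> : x * a = x / m.+1%:R * (m.+1%:R * a) by field; rewrite addrC natr1 gt_eqF.
  apply: open_simplex_segment => //.
  by rewrite (divr_ge0 x0 (ltW m0)) ler_pdivrMr// mul1r.
have E0 : f s = g 0%N 0 by rewrite /g expr0 mul1r mul0r scale0r addr0.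
have E1 : \sum_(t <- extrap m.+1) t.1 * f (s + (t.2%:R * a) *: delta_mx ord0 i) =
    \sum_(t <- extrap m.+1) t.1 * g 0%N t.2%:R.
  by apply: eq_bigr => t _; rewrite /g expr0 mul1r.
rewrite E0 E1; apply: extrap_error.
  move=> k x km xm.
  have -> : g k = a ^+ k \*: (F i k \o (fun t => s + t *: delta_mx ord0 i) \o
      (fun x => x * a)) by apply/funext => y; rewrite /g /= .
  have -> : g k.+1 x = a ^+ k *: (F i k.+1 (s + (x * a) *: delta_mx ord0 i) * a).
    by rewrite /g exprSr -mulrA [a * _]mulrC.
  apply: is_deriveZ.
  apply: is_derive1_comp; first exact: is_derive_line km (inG x xm).
  have [] := @derive_along_line R R^o (fun y : R => y * a) x 1 a.
    by move=> h; rewrite [_ *: (1 : R^o)]mulr1; ring.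
  by split.
move=> x y xm ym.
rewrite /g -mulrBr normrM normrX.
have [_ Hd] := fH (sum_gm i).
rewrite mindex_dirs_axis in Hd.
apply: (@le_trans _ _ (`|a| ^+ m * (L * (m.+1%:R * `|a|) `^ (beta - m%:R)))).
  rewrite ler_wpM2l ?exprn_ge0//.
  rewrite (le_trans (Hd _ _ (open_simplex_interior (inG x xm))
    (open_simplex_interior (inG y ym))))// ler_pM2l//.
  rewrite ge0_ler_powR ?nnegrE ?subr_ge0 ?(ltW mb)//.
  - by apply: sumr_ge0.
  rewrite opprD addrACA subrr add0r -scalerBl -mulrBl.
  rewrite /norm1 (bigD1 i)//= big1 ?addr0; last first.
    by move=> j ji; rewrite !mxE (negbTE ji) andbF mulr0 normr0.
  rewrite !mxE !eqxx mulr1 normrM ler_wpM2r//.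
  by rewrite ler_norml; lra.
rewrite le_eqVlt; apply/orP; left; apply/eqP.
rewrite powRM// ?ltW//.
have [a0|a0] := eqVneq `|a| 0.
  rewrite a0 !powR0 ?mulr0// gt_eqF ?subr_gt0//.
  exact: lt_trans hbeta.
rewrite -powR_mulrn//.
rewrite (_ : `|a| `^ beta = `|a| `^ m%:R * `|a| `^ (beta - m%:R)); first ring.
by rewrite -powRD ?a0 ?implybT// addrC subrK.
Qed.

End hoelder_axis.

(** * Stencils that approximate a function from inside the simplex *)

Section stencils.
Context {R : realType} {d : nat}.
Local Notation rV := 'rV[R]_d.
Local Notation e_ i := (delta_mx ord0 i : rV).
Variables (N : nat) (h : R).

(** A box is given by its vector u of side lengths, and its lowest corner is at
    s + u. Extrapolating along each axis of l in turn, with nodes at c (1 + w_i) h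
    for c = 1, ..., N, expresses f s by the values of f at the points
    s + u + (u_i w_i)_i with u_i = c_i h: for a w that runs over the unit cube these
    points run over the box. Averaging over w thus replaces point evaluations by
    averages over boxes of side at least h, and the nodes are never at s itself, so
    that the boxes have positive volume. *)
Fixpoint plus_stencil (l : seq 'I_d) : seq (R * rV) :=
  if l is i :: l' then
    [seq (c.1 * t.1, (c.2%:R * h) *: e_ i + t.2) | c <- extrap N, t <- plus_stencil l']
  else [:: (1, 0)].

(** The displacements that precede the extrapolation, which increases all the
    coordinates and would leave the simplex near the face where they sum to 1:
    none where this sum is far from 1, and otherwise a decrease of a coordinate
    that is far from 0, again by extrapolation along an axis. *)
Definition shifts (o : option 'I_d) : seq (R * rV) :=
  if o is Some i then
    [seq (c.1, - (c.2%:R * (2 * d%:R * N%:R * h)) *: e_ i) | c <- extrap N]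
  else [:: (1, 0)].

Definition stencil (o : option 'I_d) : seq (R * (rV * rV)) :=
  [seq (c.1 * t.1, (c.2, t.2)) | c <- shifts o, t <- plus_stencil (enum 'I_d)].

(** The point of parameter w in the box with displacement v and side lengths u. *)
Definition stencil_point (s v u w : rV) : rV :=
  s + v + u + \row_i (u ord0 i * w ord0 i).

Definition extrap_norm : R := \sum_(c <- extrap N) `|c.1|.

Lemma extrap_norm_ge1 : (0 < N)%N -> 1 <= extrap_norm.
Proof.
move=> N0; rewrite -(sum_extrap1 (R := R) N0); apply: ler_sum => c _.
exact: ler_norm.
Qed.

Hypothesis h0 : 0 < h.

Lemma sum_delta (i : 'I_d) (a : R) : \sum_(j < d) (a *: e_ i) ord0 j = a.
Proof.
rewrite (bigD1 i)//= big1 ?addr0 => [|j /negbTE ji].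
  by rewrite !mxE !eqxx mulr1.
by rewrite !mxE ji andbF mulr0.
Qed.

Lemma sum_mxD (s t : rV) : \sum_(j < d) (s + t) ord0 j =
  \sum_(j < d) s ord0 j + \sum_(j < d) t ord0 j.
Proof. by rewrite -big_split; apply: eq_bigr => j _; rewrite mxE. Qed.

Lemma plus_stencil_range l t : t \in plus_stencil l ->
  [/\ forall i, 0 <= t.2 ord0 i, forall i, i \in l -> h <= t.2 ord0 i &
      \sum_(i < d) t.2 ord0 i <= (size l)%:R * (N%:R * h)].
Proof.
elim: l t => [|i l IH] t /=.
  rewrite inE => /eqP -> /=; split=> // [i|]; first by rewrite mxE.
  by rewrite big1 ?mul0r// => j _; rewrite mxE.
case/allpairsP => -[c u] /= [cE /IH[u0 ul us] ->] /=.
have /andP[c1 cN] := extrap_range cE.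
have ch : h <= c.2%:R * h by rewrite ler_peMl ?ler1n// ltW.
have e0 j : 0 <= ((c.2%:R * h) *: e_ i) ord0 j.
  by rewrite !mxE !mulr_ge0 ?ler0n ?(ltW h0).
split.
- by move=> j; rewrite mxE addr_ge0.
- move=> j; rewrite inE => /orP[/eqP ->|/ul jl]; rewrite mxE.
    rewrite -[leLHS]addr0 lerD//.
    by rewrite !mxE !eqxx mulr1.
  by rewrite -[leLHS]add0r lerD.
- rewrite sum_mxD sum_delta -[(size l).+1%:R]natr1 mulrDl mul1r addrC lerD//.
  by rewrite ler_wpM2r ?(ltW h0)// ler_nat.
Qed.

Lemma plus_stencil_norm l :
  \sum_(t <- plus_stencil l) `|t.1| = extrap_norm ^+ size l.
Proof.
elim: l => [|i l IH] /=; first by rewrite big_seq1 normr1 expr0.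
rewrite big_allpairs_dep/= exprS -IH mulr_suml; apply: eq_bigr => c _.
by rewrite mulr_sumr; apply: eq_bigr => t _; rewrite normrM.
Qed.

Lemma stencil_point_open l t (s w : rV) : t \in plus_stencil l ->
  (forall i, 0 < s ord0 i) ->
  \sum_(i < d) s ord0 i + (size l)%:R * (2 * N%:R * h) < 1 ->
  (forall i, 0 <= w ord0 i <= 1) -> open_simplex (stencil_point s 0 t.2 w).
Proof.
move=> /plus_stencil_range[t0 _ ts] s0 s1 w01; split=> [i|].
  rewrite !mxE addr0; have /andP[w0 _] := w01 i.
  by rewrite -addrA ltr_wpDr// addr_ge0// mulr_ge0.
rewrite /stencil_point addr0 !sum_mxD.
apply: le_lt_trans s1; rewrite -addrA lerD2l.
apply: (@le_trans _ _ (2 * \sum_(i < d) t.2 ord0 i)).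
  rewrite mulr2n mulrDl mul1r lerD2l; apply: ler_sum => i _.
  by rewrite mxE ler_piMr//; have /andP[] := w01 i.
rewrite (_ : _ * (2 * _ * h) = 2 * ((size l)%:R * (N%:R * h))); last by ring.
by rewrite ler_pM2l.
Qed.

(** A displacement along an axis scales with the position in the box, as the nodes of
    an extrapolation with step h (1 + w_i). *)
Lemma stencil_pointS (s u w : rV) (i : 'I_d) (a : R) :
  stencil_point s 0 (a *: e_ i + u) w =
  stencil_point (s + (a * (1 + w ord0 i)) *: e_ i) 0 u w.
Proof.
apply/rowP => j; rewrite !mxE eqxx /=.
by have [->|_] := eqVneq j i; rewrite /= ?mulr1n ?mulr0n; ring.
Qed.

Section bias.
Variables (f : rV -> R) (B beta : R).
Hypothesis N0 : (0 < N)%N.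
Hypothesis B0 : 0 <= B.
Hypothesis beta0 : 0 < beta.
Hypothesis axis_error : forall (s : rV) i a,
  open_simplex s -> open_simplex (s + (N%:R * a) *: e_ i) ->
  `|f s - \sum_(c <- extrap N) c.1 * f (s + (c.2%:R * a) *: e_ i)|
    <= B * `|a| `^ beta.

Let A1 := extrap_norm_ge1 N0.

(** Each axis contributes its own extrapolation error, at points that remain in the
    simplex, multiplied by the sum of the absolute values of the coefficients of the
    extrapolations already performed. *)
Lemma plus_stencil_error l (s w : rV) :
  (forall i, 0 < s ord0 i) ->
  \sum_(i < d) s ord0 i + (size l)%:R * (2 * N%:R * h) < 1 ->
  (forall i, 0 <= w ord0 i <= 1) ->
  `|f s - \sum_(t <- plus_stencil l) t.1 * f (stencil_point s 0 t.2 w)|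
    <= (size l)%:R * extrap_norm ^+ size l * (B * (2 * h) `^ beta).
Proof.
have H0 : 0 <= B * (2 * h) `^ beta by rewrite mulr_ge0 ?powR_ge0.
elim: l s => [|i l IH] s s0 s1 w01.
  rewrite /= big_seq1 mul1r (_ : stencil_point s 0 0 w = s) ?subrr ?normr0 ?mul0r//.
  by apply/rowP => j; rewrite !mxE mul0r !addr0.
pose a := h * (1 + w ord0 i).
have /andP[wi0 wi1] := w01 i.
have ha : h <= a by rewrite /a ler_peMr ?(ltW h0)// lerDl.
have a2 : a <= 2 * h by rewrite /a mulrC ler_wpM2r ?(ltW h0)//; lra.
have a0 : 0 < a by exact: lt_le_trans ha.
have moved (k : nat) : (k <= N)%N ->
    (forall j, 0 < (s + (k%:R * a) *: e_ i) ord0 j) /\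
    \sum_(j < d) (s + (k%:R * a) *: e_ i) ord0 j
      + (size l)%:R * (2 * N%:R * h) < 1.
  move=> kN; split=> [j|].
    rewrite mxE ltr_wpDr// !mxE; apply: mulr_ge0; last exact: ler0n.
    by rewrite mulr_ge0 ?ler0n ?(ltW a0).
  rewrite sum_mxD sum_delta; apply: le_lt_trans s1; rewrite -addrA lerD2l.
  have -> : (size (i :: l))%:R * (2 * N%:R * h) =
      N%:R * (2 * h) + (size l)%:R * (2 * N%:R * h).
    by rewrite /= -[(size l).+1%:R]natr1; ring.
  rewrite lerD2r.
  by rewrite ler_pM ?ler0n ?(ltW a0)// ler_nat.
have opn (k : nat) : (k <= N)%N -> open_simplex (s + (k%:R * a) *: e_ i).
  move=> /moved[p1 p2]; split => //; apply: le_lt_trans p2.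
  by rewrite lerDl !mulr_ge0 ?ler0n ?(ltW h0).
have sG : open_simplex s by have := opn 0%N isT; rewrite mul0r scale0r addr0.
have -> : \sum_(t <- plus_stencil (i :: l)) t.1 * f (stencil_point s 0 t.2 w) =
   \sum_(c <- extrap N) c.1 * \sum_(t <- plus_stencil l)
      t.1 * f (stencil_point (s + (c.2%:R * a) *: e_ i) 0 t.2 w).
  rewrite /= big_allpairs_dep/=; apply: eq_bigr => c _.
  rewrite mulr_sumr; apply: eq_bigr => t _.
  by rewrite stencil_pointS -[c.2%:R * h * _]mulrA -mulrA.
set U := \sum_(c <- extrap N) c.1 * f (s + (c.2%:R * a) *: e_ i).
rewrite (_ : f s - _ = (f s - U) + (U - \sum_(c <- extrap N) c.1 *
   \sum_(t <- plus_stencil l)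
      t.1 * f (stencil_point (s + (c.2%:R * a) *: e_ i) 0 t.2 w))); last by ring.
apply: (le_trans (ler_normD _ _)).
have b1 : `|f s - U| <= B * (2 * h) `^ beta.
  rewrite (le_trans (axis_error sG (opn N (leqnn N))))// ler_wpM2l//.
  by rewrite ge0_ler_powR ?nnegrE ?(ltW beta0) ?mulr_ge0 ?(ltW h0)// gtr0_norm.
have S1 := A1; set S := extrap_norm in S1 IH *.
set T := B * _ in H0 b1 IH *.
have b2 : `|U - \sum_(c <- extrap N) c.1 * \sum_(t <- plus_stencil l)
      t.1 * f (stencil_point (s + (c.2%:R * a) *: e_ i) 0 t.2 w)| <=
    S * ((size l)%:R * S ^+ size l * T).
  rewrite /U -sumrB (le_trans (ler_norm_sum _ _ _))// /S /extrap_norm mulr_suml.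
  rewrite big_seq [leRHS]big_seq; apply: ler_sum => c cE.
  have /andP[_ cN] := extrap_range cE.
  rewrite -mulrBr normrM ler_wpM2l//.
  by have [p1 p2] := moved _ cN; exact: IH.
apply: (le_trans (lerD b1 b2)).
rewrite /= -[(size l).+1%:R]natr1 exprS.
have Sl : 1 <= S * S ^+ size l by rewrite -exprS exprn_ege1.
rewrite (_ : ((size l)%:R + 1) * (S * S ^+ size l) * T =
  S * S ^+ size l * T + S * ((size l)%:R * S ^+ size l * T)); last by ring.
by rewrite lerD2r ler_peMl.
Qed.

Definition shift_region (o : option 'I_d) (s : rV) : bool :=
  if o is Some i then (d%:R + 1)^-1 <= s ord0 i
  else (d%:R + 1)^-1 <= 1 - \sum_(i < d) s ord0 i.

(** The coordinates and the complement of their sum to 1 are d + 1 numbers with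
    sum 1. *)
Lemma shift_region_cover (s : rV) : exists o, shift_region o s.
Proof.
have d1 : 0 < d%:R + 1 :> R by rewrite ltr_pwDr// ler0n.
apply: contrapT => /forallNP H.
have H0 : 1 - \sum_(i < d) s ord0 i < (d%:R + 1)^-1.
  by rewrite ltNge; apply/negP; exact: (H None).
have Hi i : s ord0 i < (d%:R + 1)^-1.
  by rewrite ltNge; apply/negP; exact: (H (Some i)).
have : \sum_(i < d) s ord0 i <= \sum_(i < d) (d%:R + 1)^-1.
  by apply: ler_sum => i _; exact: ltW.
rewrite sumr_const card_ord -[X in _ <= X -> _]mulr_natr => hs.
have : (d%:R + 1)^-1 * d%:R + (d%:R + 1)^-1 = 1 :> R.
  by rewrite -[X in _ + X]mulr1 -mulrDr mulVf// gt_eqF.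
lra.
Qed.

Hypothesis hsmall : 2 * d%:R * N%:R ^+ 2 * h < (d%:R + 1)^-1.

Let N1 : 1 <= N%:R :> R. Proof. by rewrite ler1n. Qed.

Let H := 2 * d%:R * N%:R * h.

Let H_ge0 : 0 <= H. Proof. by rewrite !mulr_ge0 ?ler0n ?(ltW h0). Qed.

Let NH : N%:R * H < (d%:R + 1)^-1.
Proof. by rewrite (_ : N%:R * H = 2 * d%:R * N%:R ^+ 2 * h)// /H; ring. Qed.

Let H_small : H < (d%:R + 1)^-1.
Proof. by apply: le_lt_trans NH; rewrite ler_peMl. Qed.

(** After the shift there is room for the moves that increase the coordinates. *)
Lemma shift_room o (s : rV) c : shift_region o s -> open_simplex s -> c \in shifts o ->
  (forall i, 0 < (s + c.2) ord0 i) /\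
  \sum_(i < d) (s + c.2) ord0 i + d%:R * (2 * N%:R * h) < 1.
Proof.
have HE : d%:R * (2 * N%:R * h) = H by rewrite /H; ring.
case: o => [i|] /= reg [s0 s1]; rewrite HE.
  case/mapP => -[c0 k] kE -> /=; have /andP[/= k1 kN] := extrap_range kE.
  have kH : H <= k%:R * H by rewrite ler_peMl ?ler1n.
  have kNH : k%:R * H <= N%:R * H by rewrite ler_wpM2r// ler_nat.
  split=> [j|].
    rewrite !mxE eqxx /=; have [->|_] := eqVneq j i.
      by rewrite mulr1n mulr1; have := NH; rewrite -/H; lra.
    by rewrite mulr0n mulr0 addr0.
  by rewrite sum_mxD sum_delta -/H; lra.
rewrite inE => /eqP -> /=; split=> [i|]; first by rewrite mxE mxE addr0.
rewrite addr0; have := H_small; lra.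
Qed.

Lemma stencil_range o t : t \in stencil o ->
  forall i, h <= t.2.2 ord0 i.
Proof.
case/allpairsP => -[c u] /= [_ /plus_stencil_range[_ ul _] ->] /= i.
by apply: ul; rewrite mem_enum.
Qed.

Lemma stencil_open o t (s w : rV) : shift_region o s -> open_simplex s ->
  t \in stencil o -> (forall i, 0 <= w ord0 i <= 1) ->
  open_simplex (stencil_point s t.2.1 t.2.2 w).
Proof.
move=> reg sG /allpairsP[[c u] /= [cE uE ->]] w01 /=.
have [p1 p2] := shift_room reg sG cE.
have := @stencil_point_open (enum 'I_d) u (s + c.2) w uE p1.
rewrite size_enum_ord => /(_ p2 w01).
by rewrite /stencil_point addr0.
Qed.

Lemma stencil_norm o : \sum_(t <- stencil o) `|t.1| <= extrap_norm ^+ d.+1.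
Proof.
rewrite big_allpairs_dep/=.
under eq_bigr => c _.
  under eq_bigr do rewrite normrM /=.
  rewrite -mulr_sumr plus_stencil_norm size_enum_ord; over.
rewrite -mulr_suml exprS ler_wpM2r ?exprn_ge0 ?(le_trans ler01 A1)//.
case: o => [i|] /=; last by rewrite big_seq1 normr1.
by rewrite big_map.
Qed.

Definition stencil_const : R :=
  B * (2 * d%:R * N%:R) `^ beta + d%:R * extrap_norm ^+ d.+1 * (B * 2 `^ beta).

Lemma stencil_error o (s w : rV) : shift_region o s -> open_simplex s ->
  (forall i, 0 <= w ord0 i <= 1) ->
  `|f s - \sum_(t <- stencil o) t.1 * f (stencil_point s t.2.1 t.2.2 w)|
    <= stencil_const * h `^ beta.
Proof.
move=> reg sG w01.
have -> : \sum_(t <- stencil o) t.1 * f (stencil_point s t.2.1 t.2.2 w) =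
   \sum_(c <- shifts o) c.1 * \sum_(t <- plus_stencil (enum 'I_d))
      t.1 * f (stencil_point (s + c.2) 0 t.2 w).
  rewrite big_allpairs_dep/=; apply: eq_bigr => c _.
  rewrite mulr_sumr; apply: eq_bigr => t _.
  by rewrite -mulrA /stencil_point addr0.
have S0 : 0 <= extrap_norm by exact: le_trans ler01 A1.
pose T := B * (2 * h) `^ beta.
have T0 : 0 <= T by rewrite mulr_ge0 ?powR_ge0.
have TE : T = B * 2 `^ beta * h `^ beta by rewrite /T powRM ?(ltW h0)// mulrA.
have b1 : `|f s - \sum_(c <- shifts o) c.1 * f (s + c.2)| <= B * H `^ beta.
  case: o reg => [i|] /= reg.
    rewrite big_map/=.
    under eq_bigr do rewrite -mulrN.
    have e a : (N%:R * - a) *: e_ i = - (N%:R * a) *: e_ i by rewrite mulrN.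
    have tG : open_simplex (s + (N%:R * - H) *: e_ i).
      have [s0 s1] := sG; rewrite e; split=> [j|].
        rewrite !mxE eqxx /=; have [->|_] := eqVneq j i.
          by rewrite mulr1n mulr1; have := NH; lra.
        by rewrite mulr0n mulr0 addr0.
      rewrite sum_mxD sum_delta; have : 0 <= N%:R * H by rewrite mulr_ge0 ?ler0n.
      lra.
    by have := axis_error sG tG; rewrite [`|- H|]normrN (ger0_norm H_ge0).
  by rewrite big_seq1 addr0 mul1r subrr normr0 mulr_ge0 ?powR_ge0.
set U := (X in f s - X) in b1.
have b2 : `|U - \sum_(c <- shifts o) c.1 * \sum_(t <- plus_stencil (enum 'I_d))
      t.1 * f (stencil_point (s + c.2) 0 t.2 w)| <=
    extrap_norm * (d%:R * extrap_norm ^+ d * T).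
  apply: (@le_trans _ _ ((\sum_(c <- shifts o) `|c.1|) * (d%:R * extrap_norm ^+ d * T))).
    rewrite /U -sumrB (le_trans (ler_norm_sum _ _ _))// mulr_suml.
    rewrite big_seq [leRHS]big_seq; apply: ler_sum => c cE.
    rewrite -mulrBr normrM ler_wpM2l//.
    have [p1 p2] := shift_room reg sG cE.
    have := @plus_stencil_error (enum 'I_d) (s + c.2) w p1.
    by rewrite size_enum_ord => /(_ p2 w01).
  have X0 : 0 <= d%:R * extrap_norm ^+ d * T.
    by rewrite mulr_ge0// mulr_ge0 ?ler0n ?exprn_ge0.
  rewrite ler_wpM2r//.
  case: (o) => [i|] /=; last by rewrite big_seq1 normr1.
  by rewrite big_map.
rewrite -[f s](subrK U) -addrA (le_trans (ler_normD _ _))//.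
apply: (le_trans (lerD b1 b2)).
rewrite /stencil_const TE /H powRM ?mulr_ge0 ?ler0n ?(ltW h0)//.
rewrite le_eqVlt; apply/orP; left; apply/eqP.
by rewrite [extrap_norm ^+ d.+1]exprS; ring.
Qed.

End bias.

End stencils.

(** * The kernel of a stencil *)

Section integral_sum_seq.
Context d (T : measurableType d) (R : realType) (mu : {measure set T -> \bar R}).
Variables (D : set T) (mD : measurable D).

Lemma integral_sum_seq (I : eqType) (s : seq I) (F : I -> T -> R) :
  (forall i, i \in s -> mu.-integrable D (EFin \o F i)) ->
  mu.-integrable D (EFin \o (fun x => \sum_(i <- s) F i x)) /\
  (\int[mu]_(x in D) (\sum_(i <- s) F i x)%:E =
   \sum_(i <- s) \int[mu]_(x in D) (F i x)%:E)%E.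
Proof.
elim: s => [_|i s IH iF].
  have E : (EFin \o (fun x : T => \sum_(i <- [::]) F i x)) = cst 0%E.
    by apply/funext => x /=; rewrite big_nil.
  split; first by rewrite E; exact: integrable0.
  by rewrite big_nil integral0_eq// => x _; rewrite big_nil.
have [js|IH1 IH2] := IH.
  by move=> jss; apply: iF; rewrite inE jss orbT.
have i1 : mu.-integrable D (EFin \o F i) by apply: iF; rewrite mem_head.
have E : (EFin \o (fun x => \sum_(j <- i :: s) F j x)) =
    ((EFin \o F i) \+ (EFin \o (fun x => (\sum_(j <- s) F j x)%R)))%E.
  by apply/funext => x /=; rewrite big_cons EFinD.
split; first by rewrite E; exact: integrableD.
rewrite big_cons -IH2 -integralD//.
by apply: eq_integral => x _; rewrite big_cons EFinD.
Qed.

End integral_sum_seq.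

Section stencil_kernel.
Context {R : realType} {d : nat}.
Local Notation rV := 'rV[R]_d.

Definition box_ind (y u x : rV) : R :=
  \prod_(i < d)
    ((y ord0 i + u ord0 i <= x ord0 i <= y ord0 i + 2 * u ord0 i)%R : bool)%:R.

(** The linear combination of the uniform densities on the boxes of the stencil:
    integrated against the law of an observation, it gives the same combination of
    the averages of f over these boxes. *)
Definition stencil_kernel (T : seq (R * (rV * rV))) (s x : rV) : R :=
  \sum_(t <- T) t.1 / \prod_(i < d) t.2.2 ord0 i * box_ind (s + t.2.1) t.2.2 x.

Definition unit_cube : set rV := [set w | forall i, 0 <= w ord0 i <= 1].

Lemma measurable_unit_cube : measurable unit_cube.
Proof.
rewrite (_ : unit_cube = (\bigcap_(i in [set: 'I_d])
    ((fun x : rV => x ord0 i) @^-1` `[0, 1]))).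
  apply: fin_bigcap_measurable => [|i _]; first exact: finite_finset.
  by rewrite -[X in measurable X]setTI; apply: measurable_coord.
by apply/seteqP; split=> x /= H i; [move=> _|]; have := H i; rewrite ?in_itv//=; apply.
Qed.

Lemma lebesgue_unit_cube : lebesgue_rV unit_cube = 1%E.
Proof.
rewrite (@lebesgue_rV_box R d (fun=> 0) (fun=> 1))//.
by rewrite big1// => i _; rewrite subr0.
Qed.

Lemma box_ind_01 y u x : 0 <= box_ind y u x <= 1.
Proof.
apply/andP; split; first by apply: prodr_ge0 => i _; rewrite ler0n.
by apply: prodr_ile1 => i _; rewrite ler0n lern1 leq_b1.
Qed.

Lemma measurable_fun_box_ind d' (X : measurableType d') (y x : X -> rV) (u : rV) :
  measurable_fun setT y -> measurable_fun setT x ->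
  measurable_fun setT (fun z => box_ind (y z) u (x z)).
Proof.
move=> my mx; apply: measurable_prod => i _.
have mi (w : X -> rV) : measurable_fun setT w ->
    measurable_fun setT (fun t => w t ord0 i).
  by move=> mw; exact: (measurableT_comp (measurable_coord i) mw).
apply: measurableT_comp => //; apply: measurable_and; apply: measurable_fun_ler.
- by apply: measurable_funD => //; exact: mi.
- exact: mi.
- exact: mi.
- by apply: measurable_funD => //; exact: mi.
Qed.

Lemma measurable_fun_stencil_kernel d' (X : measurableType d') T (s x : X -> rV) :
  measurable_fun setT s -> measurable_fun setT x ->
  measurable_fun setT (fun z => stencil_kernel T (s z) (x z)).
Proof.
move=> ms mx; apply: measurable_sum => t; apply: measurable_funM => //.
apply: measurable_fun_box_ind => //; apply: measurable_fun_rV => i.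
under eq_fun do rewrite mxE.
by apply: measurable_funD => //; exact: (measurableT_comp (measurable_coord i) ms).
Qed.

Variable f : simplex_density R d.

Section one_box.
Variables (s v u : rV).
Hypothesis u0 : forall i, 0 < u ord0 i.
Hypothesis box_open : forall w, unit_cube w -> open_simplex (stencil_point s v u w).

Lemma box_ind_point w : box_ind (s + v) u (stencil_point s v u w) =
  \1_unit_cube w.
Proof.
rewrite indicE; have [wC|wC] := boolP (w \in unit_cube).
  rewrite inE in wC; rewrite /box_ind big1// => i _.
  have c : (s + v) ord0 i + u ord0 i <= stencil_point s v u w ord0 i
      <= (s + v) ord0 i + 2 * u ord0 i.
    have /andP[w0 w1] := wC i; have ui := u0 i; rewrite !mxE.
    have : 0 <= u ord0 i * w ord0 i by rewrite mulr_ge0// ltW.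
    have : u ord0 i * w ord0 i <= u ord0 i by rewrite ler_piMr// ltW.
    lra.
  by rewrite c.
have [i wi] : exists i, ~~ (0 <= w ord0 i <= 1).
  apply: contrapT => /forallNP H; move/negP : wC; apply; rewrite inE => i.
  by apply: contrapT => /negP h; exact: (H i).
have c : ((s + v) ord0 i + u ord0 i <= stencil_point s v u w ord0 i
      <= (s + v) ord0 i + 2 * u ord0 i) = false.
  apply/negbTE; apply: contra wi; have ui := u0 i; rewrite !mxE => c.
  have h1 : u ord0 i * 0 <= u ord0 i * w ord0 i by lra.
  have h2 : u ord0 i * w ord0 i <= u ord0 i * 1 by lra.
  by move: h1 h2; rewrite !ler_pM2l// => -> ->.
by rewrite /box_ind (bigD1 i)//= c mul0r.
Qed.

Definition box_mean : R :=
  fine (\int[lebesgue_rV]_(w in unit_cube) (f (stencil_point s v u w))%:E).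

Let fr (x : rV) : \bar R := ((fun x => (f x)%:E) \_ (simplex d)) x.

Let mfr : measurable_fun setT fr.
Proof.
apply/(measurable_restrictT _ _).1; first exact: measurable_simplex.
by apply/measurable_EFinP; exact: measurable_density.
Qed.

Let fr0 x : (0 <= fr x)%E.
Proof.
rewrite /fr patchE; case: ifPn => // /set_mem Sx.
by rewrite lee_fin density_ge0.
Qed.

Let mpt : measurable_fun setT (stencil_point s v u).
Proof.
apply: measurable_fun_rV => i; under eq_fun do rewrite !mxE.
by apply: measurable_funD => //; apply: measurable_funM => //; exact: measurable_coord.
Qed.

Let fr_point w : unit_cube w -> fr (stencil_point s v u w) =
  (f (stencil_point s v u w))%:E.
Proof.
by move=> wC; rewrite /fr patchE mem_set//; apply: open_simplex_sub; exact: box_open.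
Qed.

Lemma measurable_box_point :
  measurable_fun unit_cube (fun w => (f (stencil_point s v u w))%:E).
Proof.
apply: (eq_measurable_fun (fr \o stencil_point s v u)).
  by move=> w /set_mem wC; rewrite /= fr_point.
by apply: measurable_funTS; exact: (measurableT_comp mfr mpt).
Qed.

Lemma box_point_ge0 w : unit_cube w -> 0 <= f (stencil_point s v u w).
Proof.
by move=> wC; rewrite density_ge0//; apply: open_simplex_sub; exact: box_open.
Qed.

Let box_meanEe :
  (\int[law f]_x (box_ind (s + v) u x)%:E = (\prod_(i < d) u ord0 i)%:E *
   \int[lebesgue_rV]_(w in unit_cube) (f (stencil_point s v u w))%:E)%E.
Proof.
have mbox : measurable_fun setT (fun x : rV => (box_ind (s + v) u x)%:E).
  apply/measurable_EFinP.
  by apply: measurable_fun_box_ind => //; exact: measurable_id.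
have box0 x : (0 <= (box_ind (s + v) u x)%:E)%E.
  by rewrite lee_fin; have /andP[] := box_ind_01 (s + v) u x.
rewrite ge0_integral_law// integral_mkcond.
transitivity (\int[lebesgue_rV]_x ((box_ind (s + v) u x)%:E * fr x))%E.
  apply: eq_integral => x _; rewrite /fr !patchE.
  by case: ifPn => // _; rewrite mule0.
rewrite (ge0_integral_affine (s + v + u) u0); last 2 first.
- exact: emeasurable_funM.
- by move=> x; rewrite mule_ge0.
congr (_ * _)%E; rewrite [RHS]integral_mkcond; apply: eq_integral => w _.
rewrite -/(stencil_point s v u w) box_ind_point indicE patchE.
by case: ifPn => [/set_mem wC|_]; rewrite ?mul0e// mul1e fr_point.
Qed.

Let prod_u0 : 0 < \prod_(i < d) u ord0 i.
Proof. exact: prodr_gt0. Qed.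

Let box_ind_le1 : (\int[law f]_x (box_ind (s + v) u x)%:E <= 1)%E.
Proof.
apply: (@le_trans _ _ (\int[law f]_x (cst 1%E x))%E).
  apply: ge0_le_integral => //.
  - by move=> x _; rewrite lee_fin; have /andP[] := box_ind_01 (s + v) u x.
  - apply/measurable_EFinP.
    by apply: measurable_fun_box_ind => //; exact: measurable_id.
  - by move=> x _; rewrite lee_fin; have /andP[] := box_ind_01 (s + v) u x.
by rewrite integral_cst// mul1e [leLHS]probability_setT.
Qed.

Lemma EFin_box_mean : box_mean%:E =
  (\int[lebesgue_rV]_(w in unit_cube) (f (stencil_point s v u w))%:E)%E.
Proof.
have I0 : (0 <= \int[lebesgue_rV]_(w in unit_cube) (f (stencil_point s v u w))%:E)%E.
  by apply: integral_ge0 => w wC; rewrite lee_fin box_point_ge0.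
rewrite /box_mean fineK// ge0_fin_numE//.
have := box_ind_le1; rewrite box_meanEe.
move: I0; case: (\int[_]_(_ in _) _)%E => [r| |]//= _; first by rewrite ltry.
by rewrite gt0_muley ?lte_fin.
Qed.

Lemma integral_law_box_ind :
  (\int[law f]_x (box_ind (s + v) u x)%:E =
   (\prod_(i < d) u ord0 i * box_mean)%:E)%E.
Proof. by rewrite box_meanEe EFinM -EFin_box_mean. Qed.

Lemma integrable_box_point : lebesgue_rV.-integrable unit_cube
  (EFin \o (fun w => f (stencil_point s v u w))).
Proof.
apply/integrableP; split; first exact: measurable_box_point.
rewrite (eq_integral (fun w => (f (stencil_point s v u w))%:E)); last first.
  by move=> w /set_mem wC; rewrite /= ger0_norm// box_point_ge0.
by rewrite -EFin_box_mean ltry.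
Qed.

Lemma box_mean_le (M : R) : (forall x, open_simplex x -> f x <= M) ->
  box_mean <= M.
Proof.
move=> fM; rewrite -lee_fin EFin_box_mean.
apply: (@le_trans _ _ (\int[lebesgue_rV]_(w in unit_cube) cst M%:E w)%E).
  apply: ge0_le_integral => //.
  - exact: measurable_unit_cube.
  - by move=> w wC; rewrite lee_fin box_point_ge0.
  - exact: measurable_box_point.
  - by move=> w wC; rewrite lee_fin fM//; exact: box_open.
rewrite integral_cst ?[X in (_ * X)%E]lebesgue_unit_cube ?mule1//.
exact: measurable_unit_cube.
Qed.

End one_box.

Variables (T : seq (R * (rV * rV))) (s : rV) (h A delta : R).
Hypothesis h0 : 0 < h.
Hypothesis T_range : forall t, t \in T -> forall i, h <= t.2.2 ord0 i.
Hypothesis T_open : forall t w, t \in T -> unit_cube w ->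
  open_simplex (stencil_point s t.2.1 t.2.2 w).
Hypothesis T_norm : \sum_(t <- T) `|t.1| <= A.
Hypothesis T_error : forall w, unit_cube w ->
  `|f s - \sum_(t <- T) t.1 * f (stencil_point s t.2.1 t.2.2 w)| <= delta.

Let u0 t i : t \in T -> 0 < t.2.2 ord0 i.
Proof. by move=> tT; rewrite (lt_le_trans h0)// T_range. Qed.

Let prod_u t : t \in T -> h ^+ d <= \prod_(i < d) t.2.2 ord0 i.
Proof.
move=> tT; rewrite -[X in _ ^+ X]card_ord -prodr_const; apply: ler_prod => i _.
by rewrite (ltW h0) T_range.
Qed.

Let prod_gt0 t : t \in T -> 0 < \prod_(i < d) t.2.2 ord0 i.
Proof. by move=> tT; rewrite (lt_le_trans _ (prod_u tT))// exprn_gt0. Qed.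

Let A0 : 0 <= A.
Proof. by rewrite (le_trans _ T_norm)// sumr_ge0. Qed.

Lemma stencil_kernel_le x : `|stencil_kernel T s x| <= A / h ^+ d.
Proof.
rewrite (le_trans (ler_norm_sum _ _ _))//.
apply: (@le_trans _ _ (\sum_(t <- T) `|t.1| / h ^+ d)); last first.
  by rewrite -mulr_suml ler_wpM2r// invr_ge0 exprn_ge0// ltW.
rewrite big_seq [leRHS]big_seq; apply: ler_sum => t tT.
have /andP[b0 b1] := box_ind_01 (s + t.2.1) t.2.2 x.
have p0 := prod_gt0 tT.
rewrite !normrM normfV (gtr0_norm p0) (ger0_norm b0) -mulrA.
rewrite ler_wpM2l// -[leRHS]mulr1 ler_pM ?invr_ge0 ?(ltW p0)//.
by rewrite lef_pV2 ?posrE ?exprn_gt0 ?prod_u.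
Qed.

Lemma measurable_stencil_kernel : measurable_fun setT (stencil_kernel T s).
Proof.
by apply: measurable_fun_stencil_kernel => //; exact: measurable_id.
Qed.

Let integrable_box (t : R * (rV * rV)) (a : R) : (law f).-integrable setT
  (EFin \o (fun x => a * box_ind (s + t.2.1) t.2.2 x)).
Proof.
apply: (@le_integrable _ _ _ (law f) _ measurableT _ (EFin \o cst `|a|)) => //.
- apply/measurable_EFinP; apply: measurable_funM => //.
  by apply: measurable_fun_box_ind => //; exact: measurable_id.
- move=> x _; rewrite /= lee_fin normrM normr_id ler_piMr//.
  by have /andP[b0 b1] := box_ind_01 (s + t.2.1) t.2.2 x; rewrite ger0_norm.
- exact: finite_measure_integrable_cst.
Qed.

Local Notation mean t := (box_mean s t.2.1 t.2.2).

Let integral_term t a : t \in T ->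
  (\int[law f]_x (a / \prod_(i < d) t.2.2 ord0 i * box_ind (s + t.2.1) t.2.2 x)%:E
    = (a * mean t)%:E)%E.
Proof.
move=> tT; have p0 := prod_gt0 tT.
under eq_integral do rewrite EFinM.
rewrite integralZl//; last first.
  have := integrable_box t 1; apply: eq_integrable => // x _.
  by rewrite /= mul1r.
rewrite integral_law_box_ind => [|i|w wC]; [|exact: u0|exact: T_open].
by rewrite -EFinM; congr (_%:E); rewrite mulrA divfK ?gt_eqF.
Qed.

(** The error of the stencil is bounded uniformly in the parameter w, hence also
    after averaging over the unit cube. *)
Lemma stencil_kernel_mean : exists2 mw : R,
  (\int[law f]_x (stencil_kernel T s x)%:E = mw%:E)%E & `|mw - f s| <= delta.
Proof.
exists (\sum_(t <- T) t.1 * mean t).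
  have [_ ->] := @integral_sum_seq _ _ _ (law f) _ measurableT _ T
    (fun t x => t.1 / \prod_(i < d) t.2.2 ord0 i * box_ind (s + t.2.1) t.2.2 x)
    (fun t _ => integrable_box t (t.1 / \prod_(i < d) t.2.2 ord0 i)).
  rewrite -sumEFin big_seq [RHS]big_seq; apply: eq_bigr => t tT.
  exact: integral_term.
have mC := @measurable_unit_cube.
have iT t : t \in T -> lebesgue_rV.-integrable unit_cube
    (EFin \o (fun w => t.1 * f (stencil_point s t.2.1 t.2.2 w))).
  move=> tT; have i1 := integrable_box_point (fun i => u0 i tT) (fun w => T_open tT).
  rewrite /comp; under eq_fun do rewrite EFinM.
  exact: integrableZl.
have [iS IS] := integral_sum_seq mC iT.
have IE : (\int[lebesgue_rV]_(w in unit_cube)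
     (\sum_(t <- T) t.1 * f (stencil_point s t.2.1 t.2.2 w))%:E =
   (\sum_(t <- T) t.1 * mean t)%:E)%E.
  rewrite IS -sumEFin big_seq [RHS]big_seq; apply: eq_bigr => t tT.
  have i1 := integrable_box_point (fun i => u0 i tT) (fun w => T_open tT).
  under eq_integral do rewrite EFinM.
  rewrite integralZl// EFinM EFin_box_mean//; first exact: (fun i => u0 i tT).
  by move=> w; exact: T_open.
have ic : lebesgue_rV.-integrable unit_cube (EFin \o cst (f s)).
  apply/integrableP; split; first exact/measurable_EFinP.
  by rewrite /= integral_cst// [X in (_ * X)%E]lebesgue_unit_cube mule1 ltry.
have cE : (\int[lebesgue_rV]_(w in unit_cube) (EFin \o cst (f s)) w = (f s)%:E)%E.
  by rewrite /= integral_cst// [X in (_ * X)%E]lebesgue_unit_cube mule1.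
rewrite -lee_fin.
have -> : (`|\sum_(t <- T) t.1 * mean t - f s|%:E =
   `|\int[lebesgue_rV]_(w in unit_cube)
     ((\sum_(t <- T) t.1 * f (stencil_point s t.2.1 t.2.2 w))%:E - (f s)%:E)|)%E.
  by rewrite integralB// IE cE -EFinB.
apply: le_trans (le_abse_integral _ _ _) _ => //.
  apply: emeasurable_funB => //.
  by case/integrableP: iS.
apply: (@le_trans _ _ (\int[lebesgue_rV]_(w in unit_cube) cst delta%:E w)%E).
  apply: ge0_le_integral => //.
  - apply: measurableT_comp => //; apply: emeasurable_funB => //.
    by case/integrableP: iS.
  - move=> w wC; rewrite -EFinB /= lee_fin distrC; exact: T_error.
by rewrite integral_cst// [X in (_ * X)%E]lebesgue_unit_cube mule1.
Qed.

(** One factor of the square is bounded by the supremum of the kernel, and the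
    integral of the other one by M times the sum of the absolute values of the
    coefficients. *)
Lemma stencil_kernel_sqr (M : R) : 0 <= M ->
  (forall x, open_simplex x -> f x <= M) ->
  (\int[law f]_x (stencil_kernel T s x ^+ 2)%:E <=
    (A ^+ 2 * M / h ^+ d)%:E)%E.
Proof.
move=> M0 fM.
pose g (t : R * (rV * rV)) (x : rV) :=
  `|t.1| / \prod_(i < d) t.2.2 ord0 i * box_ind (s + t.2.1) t.2.2 x.
have [ig gE] := @integral_sum_seq _ _ _ (law f) _ measurableT _ T g
    (fun t _ => integrable_box t (`|t.1| / \prod_(i < d) t.2.2 ord0 i)).
have Ah : 0 <= A / h ^+ d by rewrite divr_ge0// exprn_ge0// ltW.
have g0 x : 0 <= \sum_(t <- T) g t x.
  rewrite big_seq; apply: sumr_ge0 => t tT.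
  have /andP[b0 _] := box_ind_01 (s + t.2.1) t.2.2 x.
  by rewrite mulr_ge0// divr_ge0// ltW// prod_gt0.
have mg : measurable_fun setT (fun x => \sum_(t <- T) g t x).
  by apply/measurable_EFinP; case/integrableP: ig.
apply: (@le_trans _ _ (\int[law f]_x (A / h ^+ d * \sum_(t <- T) g t x)%:E)%E).
  apply: ge0_le_integral => //.
  - by move=> x _; rewrite lee_fin sqr_ge0.
  - apply/measurable_EFinP; apply: measurable_funX; exact: measurable_stencil_kernel.
  - by apply/measurable_EFinP; exact: measurable_funM.
  - move=> x _; rewrite lee_fin -real_normK ?num_real// expr2.
    rewrite ler_pM// ?stencil_kernel_le//.
    rewrite (le_trans (ler_norm_sum _ _ _))// big_seq [leRHS]big_seq.
    apply: ler_sum => t tT; rewrite /g !normrM normfV.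
    have /andP[b0 _] := box_ind_01 (s + t.2.1) t.2.2 x.
    by rewrite (ger0_norm b0) (gtr0_norm (prod_gt0 tT)).
rewrite ge0_integral_EFinZl//.
apply: (@le_trans _ _ ((A / h ^+ d)%:E * (A * M)%:E)%E).
  rewrite lee_wpmul2l ?lee_fin// gE.
  apply: (@le_trans _ _ (\sum_(t <- T) (`|t.1| * M)%:E)%E).
    rewrite big_seq [leRHS]big_seq; apply: lee_sum => t tT.
    rewrite /g integral_term// lee_fin ler_wpM2l//.
    apply: box_mean_le => [i|w wC|//]; [exact: u0|exact: T_open].
  by rewrite sumEFin lee_fin -mulr_suml ler_wpM2r.
by rewrite -EFinM lee_fin le_eqVlt; apply/orP; left; apply/eqP; ring.
Qed.

End stencil_kernel.

(** * The boundary of the simplex *)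

Section boundary.
Context {R : realType} {d : nat}.
Local Notation rV := 'rV[R]_d.
Local Notation leb := (@lebesgue_measure R).

Let coord0 (i : 'I_d) : set rV := [set s | s ord0 i = 0].

Let face : set rV := [set s | \sum_(i < d) s ord0 i = 1].

Let measurable_sum_coord :
  measurable_fun setT (fun s : rV => \sum_(i < d) s ord0 i).
Proof. by apply: measurable_sum => i; exact: measurable_coord. Qed.

Let measurable_coord0 i : measurable (coord0 i).
Proof.
rewrite (_ : coord0 i = (fun s : rV => s ord0 i) @^-1` [set 0])//.
by rewrite -[X in measurable X]setTI; apply: measurable_coord.
Qed.

Let measurable_face : measurable face.
Proof.
rewrite (_ : face = (fun s : rV => \sum_(i < d) s ord0 i) @^-1` [set 1])//.
by rewrite -[X in measurable X]setTI; exact: measurable_sum_coord.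
Qed.

Lemma lebesgue_coord0 i : lebesgue_rV (coord0 i) = 0%E.
Proof.
pose B j : set (measurableTypeR R) := if j == i then [set 0] else setT.
transitivity (tuple_measure leb d
    [set t : d.-tuple (measurableTypeR R) | forall j, B j (tnth t j)]).
  congr (tuple_measure _ _ _); apply/seteqP; split=> t /=; rewrite /coord0 /= mxE.
    by move=> ti j; rewrite /B; case: eqP => // ->.
  by move=> /(_ i); rewrite /B eqxx.
rewrite tuple_measure_box; last by move=> j; rewrite /B; case: ifP.
by rewrite (bigD1 i)//= {1}/B eqxx lebesgue_measure_set1 mul0e.
Qed.

Lemma measurable_open_simplex : measurable (@open_simplex R d).
Proof.
rewrite (_ : open_simplex = (\bigcap_(i in [set: 'I_d])
    ((fun s : rV => s ord0 i) @^-1` `]0, +oo[)) `&`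
    ((fun s : rV => \sum_(i < d) s ord0 i) @^-1` `]-oo, 1[)); last first.
  apply/seteqP; split=> s /=.
    move=> [s0 s1]; split; last by rewrite in_itv.
    by move=> i _ /=; rewrite in_itv/= s0.
  rewrite in_itv/= => -[s0 s1]; split=> // i.
  by have /= := s0 i Logic.I; rewrite in_itv/= andbT.
apply: measurableI.
  apply: fin_bigcap_measurable => [|i _]; first exact: finite_finset.
  by rewrite -[X in measurable X]setTI; apply: measurable_coord.
by rewrite -[X in measurable X]setTI; exact: measurable_sum_coord.
Qed.

(** The first coordinate is determined by the other ones. *)
Lemma lebesgue_face : (0 < d)%N -> lebesgue_rV face = 0%E.
Proof.
move=> d0.
have -> : lebesgue_rV face = (\int[lebesgue_rV]_x (\1_face x)%:E)%E.
  by rewrite integral_indic// setIT.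
rewrite integral_lebesgue_rV//; last first.
  by apply/measurable_EFinP; exact: measurable_indic.
have mg : @measurable_fun _ _ (d.-tuple (measurableTypeR R)) (\bar R) setT
    (fun t => (\1_face (\row_i tnth t i))%:E).
  apply: (measurableT_comp (f := fun x : rV => (\1_face x)%:E)).
    by apply/measurable_EFinP; exact: measurable_indic.
  exact: measurable_rV_of_tuple.
move: d0 mg; rewrite /face; case: (d) => // k _ mg.
rewrite (integral_tuple_measureS_swap _ mg)//.
apply: integral0_eq => t _.
transitivity (\int[leb]_x (\1_[set (1 - \sum_(i < k) tnth t i)] x)%:E)%E.
  apply: eq_integral => x _; congr (_%:E); rewrite !indicE.
  congr (nat_of_bool _)%:R; apply/idP/idP; rewrite !inE /= big_ord_recl mxE /=;
    under [X in _ + X = _]eq_bigr do rewrite mxE tnthS.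
    by move=> <-; rewrite addrK.
  by move=> ->; rewrite subrK.
by rewrite integral_indic// setIT; exact: lebesgue_measure_set1.
Qed.

Lemma lebesgue_boundary : (0 < d)%N ->
  lebesgue_rV (simplex d `\` @open_simplex R d) = 0%E.
Proof.
move=> d0; pose U := \big[setU/set0]_(i < d) coord0 i.
have [mU U0] : measurable U /\ lebesgue_rV U = 0%E.
  apply: (@big_ind _ (fun A : set rV => measurable A /\ lebesgue_rV A = 0%E)).
  - by split; [exact: measurable0|exact: measure0].
  - by move=> A B [mA A0] [mB B0]; split; [exact: measurableU|exact: null_set_setU].
  - by move=> i _; split; [exact: measurable_coord0|exact: lebesgue_coord0].
have UF : lebesgue_rV (U `|` face) = 0%E.
  by apply: null_set_setU => //; exact: lebesgue_face.
apply/eqP; rewrite eq_le measure_ge0 andbT -UF.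
apply: le_measure; rewrite ?inE//.
- by apply: measurableD; [exact: measurable_simplex|exact: measurable_open_simplex].
- exact: measurableU.
- move=> s [/simplexP[s0 s1] sG].
  have [E|E] := eqVneq (\sum_(i < d) s ord0 i) 1; first by right.
  left; apply: contrapT => H; apply: sG; split; last by rewrite lt_neqAle E.
  move=> i; rewrite lt_neqAle s0 andbT eq_sym; apply/eqP => si; apply: H.
  by rewrite /U -bigcup_seq/=; exists i => //=; rewrite mem_index_enum.
Qed.

End boundary.

(** * The minimax risk *)

Section stencil_estimator.
Context {R : realType} {d : nat}.
Local Notation rV := 'rV[R]_d.
Variables (N : nat) (h : R).

(** The shift depends on the point: choosing the first admissible one in a finite
    list keeps the kernel measurable jointly in the point and the observation. *)
Definition local_kernel (s x : rV) : R :=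
  foldr (fun o k => if shift_region o s then stencil_kernel (stencil N h o) s x else k)
    0 (enum {: option 'I_d}).

Lemma local_kernelE s : exists2 o, shift_region o s &
  local_kernel s = stencil_kernel (stencil N h o) s.
Proof.
have [ o1 o1s] := shift_region_cover s.
have : o1 \in enum {: option 'I_d} by rewrite mem_enum.
rewrite /local_kernel; elim: (enum _) => // o l IH.
have [os _|os] := boolP (shift_region o s).
  by exists o => //; apply/funext => x; rewrite /= os.
rewrite inE => /orP[/eqP E|/IH [ o2 o2s E]]; first by rewrite -E o1s in os.
by exists o2 => //; rewrite -E; apply/funext => x; rewrite /= (negbTE os).
Qed.

Lemma measurable_shift_region o : measurable_fun setT (fun s : rV => shift_region o s).
Proof.
case: o => [i|] /=; apply: measurable_fun_ler => //; first exact: measurable_coord.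
by apply: measurable_funB => //; apply: measurable_sum => i; exact: measurable_coord.
Qed.

Lemma measurable_fun_local_kernel d' (X : measurableType d') (s x : X -> rV) :
  measurable_fun setT s -> measurable_fun setT x ->
  measurable_fun setT (fun z => local_kernel (s z) (x z)).
Proof.
move=> ms mx; rewrite /local_kernel; elim: (enum _) => //= o l IH.
apply: measurable_fun_ifT => //.
  exact: (measurableT_comp (measurable_shift_region o) ms).
exact: measurable_fun_stencil_kernel.
Qed.

Definition stencil_estimator n (X : n.-tuple rV) (s : rV) : R :=
  n%:R^-1 * \sum_(i < n) local_kernel s (tnth X i).

Lemma is_estimator_stencil_estimator n : is_estimator (@stencil_estimator n).
Proof.
apply: measurable_funTS; apply: measurable_funM => //.
apply: measurable_sum => i; apply: measurable_fun_local_kernel.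
  exact: measurable_snd.
exact: (measurableT_comp (measurable_tnth i) measurable_fst).
Qed.

End stencil_estimator.

Section upper_bound.
Context {R : realType} {d : nat}.
Local Notation rV := 'rV[R]_d.
Variables (L p beta : R).
Hypotheses (d0 : (0 < d)%N) (L0 : 0 < L) (p1 : 1 <= p) (beta2 : 2 < beta).

Let N := (hoelder_order beta).+1.
Let B := L * N%:R `^ (beta - (hoelder_order beta)%:R).
Let A : R := extrap_norm N ^+ d.+1.
Let K := @stencil_const R d N B beta.

Let N0 : (0 < N)%N. Proof. by []. Qed.

Let beta0 : 0 < beta. Proof. exact: lt_trans beta2. Qed.

Let B0 : 0 <= B. Proof. by rewrite /B mulr_ge0 ?powR_ge0// ltW. Qed.

Let A1 : 1 <= A. Proof. exact/exprn_ege1/extrap_norm_ge1. Qed.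

Let A0 : 0 < A. Proof. exact: lt_le_trans ltr01 A1. Qed.

Let small (h : R) := 2 * d%:R * N%:R ^+ 2 * h < (d%:R + 1)^-1.

Let K0 : 0 <= K.
Proof.
rewrite /K /stencil_const addr_ge0// mulr_ge0 ?powR_ge0//.
  by rewrite mulr_ge0 ?ler0n// (le_trans ler01 A1).
by rewrite mulr_ge0 ?powR_ge0.
Qed.

Section class_member.
Variable f : simplex_density R d.
Hypothesis fH : hoelder_class d beta L f.

Let axis_error := extrap_axis_error beta2 L0 fH.

Section bandwidth.
Variable h : R.
Hypotheses (h0 : 0 < h) (hs : small h).

Lemma local_kernel_le (s x : rV) : `|local_kernel N h s x| <= A / h ^+ d.
Proof.
have [ o os ->] := local_kernelE N h s.
apply: stencil_kernel_le => //; first exact: stencil_range.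
exact: stencil_norm.
Qed.

Lemma local_kernel_mean s : open_simplex s -> exists2 mw : R,
  (\int[law f]_x (local_kernel N h s x)%:E = mw%:E)%E &
  `|mw - f s| <= K * h `^ beta.
Proof.
move=> sG; have [ o os ->] := local_kernelE N h s.
apply: (stencil_kernel_mean h0).
- exact: stencil_range.
- by move=> t w tT wC; exact: (stencil_open h0 N0 hs os sG tT wC).
- by move=> w wC; exact: stencil_error.
Qed.

Lemma local_kernel_sqr s (M : R) : open_simplex s -> 0 <= M ->
  (forall x, open_simplex x -> f x <= M) ->
  (\int[law f]_x (local_kernel N h s x ^+ 2)%:E <= (A ^+ 2 * M / h ^+ d)%:E)%E.
Proof.
move=> sG M0 fM; have [ o os ->] := local_kernelE N h s.
apply: stencil_kernel_sqr => //.
- exact: stencil_range.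
- by move=> t w tT wC; exact: (stencil_open h0 N0 hs os sG tT wC).
- exact: stencil_norm.
Qed.

Lemma measurable_local_kernel (s : rV) : measurable_fun setT (local_kernel N h s).
Proof. by apply: measurable_fun_local_kernel => //; exact: measurable_id. Qed.

(** A density of the class is bounded in terms of the class only: the mean of the
    kernel is close to the density, and the kernel is bounded. *)
Lemma class_density_le s : open_simplex s -> f s <= A / h ^+ d + K * h `^ beta.
Proof.
move=> sG; have [mw mwE mwf] := local_kernel_mean sG.
have : mw <= A / h ^+ d.
  rewrite -lee_fin -mwE (le_trans (lee_abs _))//.
  apply: (le_trans (le_abse_integral _ _ _)) => //.
    by apply/measurable_EFinP; exact: measurable_local_kernel.
  apply: (@le_trans _ _ (\int[law f]_x cst (A / h ^+ d)%:E x)%E).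
    apply: ge0_le_integral => //.
    - by apply: measurableT_comp => //; apply/measurable_EFinP; exact: measurable_local_kernel.
    - by move=> x _; rewrite /= lee_fin local_kernel_le.
  by rewrite integral_cst// [X in (_ * X)%E]probability_setT mule1.
by move: mwf; rewrite ler_norml => /andP[]; lra.
Qed.

End bandwidth.
End class_member.

(** A bandwidth at most h1 is at most 1, and small enough for the stencils. *)
Let h1 : R := ((d%:R + 1) * (2 * d%:R * N%:R ^+ 2 + 1))^-1.

Let q0 : 0 <= 2 * d%:R * N%:R ^+ 2 :> R.
Proof. by rewrite !mulr_ge0 ?exprn_ge0. Qed.

Let d1 : 0 < d%:R + 1 :> R. Proof. by rewrite ltr_pwDr. Qed.

Let h1_gt0 : 0 < h1.
Proof. by rewrite invr_gt0 mulr_gt0// ltr_pwDr. Qed.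

Let h1_le1 : h1 <= 1.
Proof.
rewrite invf_le1; last by rewrite mulr_gt0// ltr_pwDr.
by rewrite -[leLHS]mulr1 ler_pM// lerDr.
Qed.

Let small_le h : 0 < h -> h <= h1 -> small h.
Proof.
move=> h0 hh; apply: (@le_lt_trans _ _ (2 * d%:R * N%:R ^+ 2 * h1)).
  by rewrite ler_wpM2l.
rewrite /h1 invfM mulrCA -[ltRHS]mulr1 ltr_pM2l ?invr_gt0//.
by rewrite ltr_pdivrMr ?ltr_pwDr// mul1r ltrDl.
Qed.

(** A bound for all the densities of the class. *)
Let M : R := A / h1 ^+ d + K * h1 `^ beta.

Let M0 : 0 <= M.
Proof.
apply: addr_ge0; last by rewrite mulr_ge0 ?powR_ge0.
by rewrite divr_ge0 ?(ltW A0)// exprn_ge0// (ltW h1_gt0).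
Qed.

(** In the bound for the p-th moment of the error take lambda = 1 / (2 A e): then
    the factor (p / lambda) ^ p is (2 p A e) ^ p, and the exponent is at most
    K / (2 A) + M / 2. *)
Let C : R := 2 * p * A * (2 * expR (K / (2 * A) + M / 2)) `^ p^-1.

Section rate.
Variables (n : nat) (h : R).
Hypotheses (n0 : (0 < n)%N) (h0 : 0 < h) (hh : h <= h1).
Hypothesis balance : n%:R * h ^+ d * (h `^ beta) ^+ 2 = 1.

Let e := h `^ beta.

Let e0 : 0 < e. Proof. exact: powR_gt0. Qed.

Let e1 : e <= 1.
Proof.
have E : 1 = 1 `^ beta :> R by rewrite powR1.
rewrite /e E ge0_ler_powR ?nnegrE ?(ltW beta0) ?(ltW h0)//.
exact: le_trans hh h1_le1.
Qed.

Let nn : 0 < n%:R :> R. Proof. by rewrite ltr0n. Qed.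

Let hd : 0 < h ^+ d. Proof. exact: exprn_gt0. Qed.

(** The equation n h ^ d e ^ 2 = 1 with e = h ^ beta balances the bias, of order e,
    with the standard deviation, of order (n h ^ d) ^ (- 1 / 2). *)
Lemma stencil_estimator_loss (f : simplex_density R d) s :
  hoelder_class d beta L f -> open_simplex s ->
  (mean_loss p f (@stencil_estimator R d N h n) s <= ((C * e) `^ p)%:E)%E.
Proof.
move=> fH sG; have p0 : 0 < p by exact: lt_le_trans ltr01 p1.
have hs := small_le h0 hh.
have fM x : open_simplex x -> f x <= M.
  by move=> xG; apply: class_density_le => //; exact: small_le.
have [mw mwE mwf] := local_kernel_mean fH h0 hs sG.
rewrite /mean_loss integral_sample_space; last 2 first.
- apply/measurable_EFinP; apply: (measurableT_comp (measurable_powR p)).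
  apply: measurableT_comp => //; apply: measurable_funB => //.
  apply: measurable_funM => //.
  exact: (@measurable_tuple_sum _ rV R n (fun=> local_kernel N h s) (fun=> measurable_local_kernel h s)).
- by move=> X; rewrite lee_fin powR_ge0.
have l0 : 0 < (2 * A * e)^-1 by rewrite invr_gt0 !mulr_gt0.
have nE : n%:R = (h ^+ d * e ^+ 2)^-1.
  have q : h ^+ d * e ^+ 2 != 0 by rewrite mulf_neq0 ?gt_eqF// exprn_gt0.
  by apply: (mulIf q); rewrite mulVf// mulrA.
have ls : (2 * A * e)^-1 * (A / h ^+ d) / n%:R <= 2^-1.
  rewrite (_ : _ / _ = e / 2); last first.
    by rewrite nE; field; rewrite !gt_eqF.
  by have := e1; lra.
have := integral_powR_mean_le (f s) p0 l0 n0
  (measurable_local_kernel h s) (local_kernel_le h0 s) mwE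
  (local_kernel_sqr h0 hs sG M0 fM) ls.
rewrite /stencil_estimator => bound; apply: (le_trans bound).
rewrite lee_fin /C.
have E1 : p / (2 * A * e)^-1 = 2 * p * A * e by rewrite invrK; ring.
rewrite E1.
have X0 : 0 <= 2 * expR (K / (2 * A) + M / 2) by rewrite mulr_ge0 ?expR_ge0.
have c0 : 0 <= 2 * p * A by rewrite !mulr_ge0 ?ltW.
rewrite [X in _ <= X `^ p]mulrAC [leRHS]powRM ?powR_ge0 ?mulr_ge0 ?(ltW e0) ?(ltW A0) ?(ltW p0)//.
rewrite -[(_ `^ p^-1) `^ p]powRrM mulVf ?gt_eqF// powRr1//.
rewrite -mulrA ler_wpM2l ?powR_ge0//.
rewrite ler_pM2l// ler_expR lerD//.
  rewrite (le_trans (ler_wpM2l (ltW l0) mwf))// le_eqVlt; apply/orP; left; apply/eqP.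
  by rewrite -/e; field; rewrite !gt_eqF.
rewrite le_eqVlt; apply/orP; left; apply/eqP.
by rewrite nE; field; rewrite !gt_eqF.
Qed.

Let C0 : 0 <= C.
Proof. by rewrite !mulr_ge0 ?powR_ge0 ?(ltW A0)// (le_trans ler01). Qed.

Lemma minimax_risk_le : (minimax_risk d n p beta L <= (C * e)%:E)%E.
Proof.
apply: (@le_trans _ _ (class_risk p beta L (@stencil_estimator R d N h n))).
  apply: ereal_inf_lbound; exists (@stencil_estimator R d N h n) => //.
  exact: is_estimator_stencil_estimator.
apply: ge_ereal_sup => _ [f fH <-].
apply: (risk_le p1 (@is_estimator_stencil_estimator R d N h n) measurable_open_simplex).
- exact: open_simplex_sub.
- exact: lebesgue_boundary.
- by rewrite mulr_ge0// ltW.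
- by move=> s sG; exact: stencil_estimator_loss.
Qed.

End rate.

Lemma minimax_risk_rate : exists2 C : R, 0 < C & exists2 h1 : R, 0 < h1 &
  forall n h, (0 < n)%N -> 0 < h <= h1 ->
  n%:R * h ^+ d * (h `^ beta) ^+ 2 = 1 ->
  (minimax_risk d n p beta L <= (C * h `^ beta)%:E)%E.
Proof.
exists C; first by rewrite !mulr_gt0 ?powR_gt0 ?mulr_gt0 ?expR_gt0// (lt_le_trans ltr01).
by exists h1 => // n h n0 /andP[h0 hh]; exact: minimax_risk_le.
Qed.

End upper_bound.

(** * Comparison of the rates *)

Section rates.
Context {R : realType}.

Lemma powR_nat_cvgy (k M : R) : 0 < k -> \forall n \near \oo, M <= n%:R `^ k.
Proof.
move=> k0; have k0' := ltW k0; have M1 : 0 <= `|M| + 1 by rewrite addr_ge0.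
near=> n.
have nM : (`|M| + 1) `^ k^-1 <= n%:R by near: n; exact: nbhs_infty_ger.
apply: (@le_trans _ _ (((`|M| + 1) `^ k^-1) `^ k)).
  rewrite -powRrM mulVf ?gt_eqF// powRr1//.
  by rewrite (le_trans (ler_norm M))// lerDl.
by rewrite ge0_ler_powR ?nnegrE ?powR_ge0.
Unshelve. all: by end_near. Qed.

Lemma powRN_nat_le (k e : R) : 0 < k -> 0 < e ->
  \forall n \near \oo, n%:R `^ (- k) <= e.
Proof.
move=> k0 e0; near=> n.
have ne : e^-1 <= n%:R `^ k by near: n; exact: powR_nat_cvgy.
have n0 : 0 < n%:R `^ k by rewrite (lt_le_trans _ ne)// invr_gt0.
by rewrite powRN invf_ple ?posrE// .
Unshelve. all: by end_near. Qed.

Lemma powR_natX (n m : nat) (k : R) : (n%:R `^ k) ^+ m = n%:R `^ (k * m%:R) :> R.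
Proof. by rewrite -powR_mulrn ?powR_ge0// powRrM. Qed.

(** The quotient by y = 0 is infinite for x > 0, so that y may vanish. *)
Lemma lee_quotient (a b : R) (x y : \bar R) : 0 <= a -> 0 < b ->
  (a%:E <= x)%E -> (0 <= y)%E -> (y <= b%:E)%E -> ((a / b)%:E <= x / y)%E.
Proof.
move=> a0 b0 ax y0 yb.
have -> : ((a / b)%:E = a%:E / b%:E)%E by rewrite inver gt_eqF// EFinM.
apply: lee_pmul => //; first by rewrite inve_ge0 lee_fin ltW.
by rewrite lee_pV2// !inE// lee_fin ltW.
Qed.

End rates.

Lemma minimax_risk_ge0 (R : realType) (d n : nat) (p beta L : R) :
  (0 < d)%N -> 0 <= L -> 2 < beta -> (0 <= minimax_risk d n p beta L)%E.
Proof.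
move=> d0 L0 b2; apply: le_ereal_inf_tmp => _ [fhat _ <-].
apply: (@le_trans _ _ (risk p fhat (@uniform_density R d))); first exact: poweR_ge0.
apply: ereal_sup_ubound; exists (@uniform_density R d) => //=.
have := @hoelder_class_affine R d beta L (Ordinal d0) (@simplex_const R d) 0 b2 L0.
by congr hoelder_class; apply/funext => x; rewrite mul0r addr0.
Qed.

Unset Implicit Arguments.

Theorem proposition2 (R : realType) (d : nat) (L p beta : R)
    (hd : (0 < d)%N) (hL : 0 < L) (hp : 1 <= p) (hbeta : 2 < beta)
    (b : nat -> R) (hb : forall n : nat, (0 < n)%N -> 0 < b n < 1) :
  limn_einf (fun n : nat =>
    (class_risk p beta L (@dirichlet_kde R d n (b n))
       / minimax_risk d n p beta L)%E) = +oo%E.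
Proof.
have [c c0 [r0 r0_gt0 lower]] := kde_class_risk_ge hd hL hp hbeta.
have [C C0 [h0 h0_gt0 upper]] := minimax_risk_rate hd hL hp hbeta.
have dR : 0 < d%:R :> R by rewrite ltr0n.
pose u := (d%:R + 4)^-1 : R; pose v := (d%:R + 2 * beta)^-1 : R.
have u0 : 0 < u by rewrite invr_gt0; lra.
have v0 : 0 < v by rewrite invr_gt0; lra.
(* The exponents of n in the two rates differ, and beta > 2 decides the sign. *)
have k0 : 0 < beta * v - 2 * u.
  have -> : beta * v - 2 * u = d%:R * (beta - 2) * (u * v).
    by rewrite /u /v; field; apply/andP; split; rewrite gt_eqF//; lra.
  by rewrite !mulr_gt0// subr_gt0.
have ratio M : \forall n \near \oo, (M%:E <=
    class_risk p beta L (@dirichlet_kde R d n (b n)) / minimax_risk d n p beta L)%E.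
  near=> n.
  have n0 : (0 < n)%N by near: n; exact: nbhs_infty_gt.
  have nR : n%:R != 0 :> R by rewrite pnatr_eq0 -lt0n.
  pose r := n%:R `^ (- u) : R; pose h := n%:R `^ (- v) : R.
  have rr : 0 < r <= r0.
    rewrite powR_gt0 ?ltr0n//= ?/r ?/h; near: n; exact: powRN_nat_le.
  have hh : 0 < h <= h0.
    rewrite powR_gt0 ?ltr0n//= ?/r ?/h; near: n; exact: powRN_nat_le.
  have rE : n%:R * r ^+ (d + 4) = 1.
    rewrite powR_natX natrD mulNr mulVf; last by rewrite gt_eqF//; lra.
    by rewrite powR_inv1// mulfV.
  have hE : n%:R * h ^+ d * (h `^ beta) ^+ 2 = 1.
    rewrite -[h `^ beta]powRrM !powR_natX -mulrA -powRD ?nR ?implybT//.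
    rewrite (_ : - v * d%:R + - v * beta * 2 = -1).
      by rewrite powR_inv1// mulfV.
    by rewrite /v; field; rewrite gt_eqF//; lra.
  have low := lower n (b n) r n0 (hb n n0) rr rE.
  have upp := upper n h n0 hh hE.
  apply: le_trans (lee_quotient _ _ low (minimax_risk_ge0 _ _ _ _ _) upp) => //.
  - have -> : c * r ^+ 2 / (C * h `^ beta) = c / C * n%:R `^ (beta * v - 2 * u).
      have -> : n%:R `^ (beta * v - 2 * u) = r ^+ 2 / h `^ beta.
        rewrite powR_natX -powRrM -powRN -powRD ?nR ?implybT//.
        by congr (_ `^ _); ring.
      by field; rewrite !gt_eqF// !powR_gt0// ltr0n.
    rewrite lee_fin -ler_pdivrMl ?divr_gt0//.
    near: n; exact: powR_nat_cvgy.
  - by rewrite mulr_ge0 ?sqr_ge0 ?(ltW c0).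
  - by rewrite mulr_gt0// powR_gt0//; case/andP: hh.
  - exact: ltW.
have : (fun n : nat => (class_risk p beta L (@dirichlet_kde R d n (b n))
    / minimax_risk d n p beta L)%E) @ \oo --> +oo%E by apply/cvgeyPge.
by move=> /cvg_limn_einf_sup[].
Unshelve. all: by end_near. Qed.
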